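(* Let $s\in\mathcal{S}$, put $p=1/s$, so that both $\lfloor s+1\rfloor$ and $\lceil s+1\rceil$ minimize $g_s$ over the integers $x\ge2$, and write $g^*=g_s(\lfloor s+1\rfloor)=g_s(\lceil s+1\rceil)$. Let $(\Xi_k)_{k\ge2}$ be independent random variables such that, for every $k\ge2$, $$\mathbb{P}(\Xi_k>t)=\exp(-a_k e^t),\qquad t\in\mathbb{R}.$$ Then: (a) as $n\to\infty$, the optimal weight $W_n=W_n(s)$ satisfies the convergence in distribution $$\frac{(\log n)^{s+1}}{s\,g^*}\left(W_n-\frac{g^*}{(\log n)^s}\right)+\frac12\log\log n-\frac{p\log g^*}{2}\ \stackrel{d}{\longrightarrow}\ \min\left(\frac{\Xi_{\lfloor s+1\rfloor}}{\lfloor s+1\rfloor-1},\frac{\Xi_{\lceil s+1\rceil}}{\lceil s+1\rceil-1}\right);$$ (b) as $n\to\infty$, the hopcount satisfies $H_n(s)\stackrel{d}{\longrightarrow}H^*$, where $$H^*=\arg\min\left\{\frac{\Xi_k}{k-1}: k\in\{\lfloor s+1\rfloor,\lceil s+1\rceil\}\right\}.$$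
   Context: Let $K_n$ be the complete graph on vertex set $\{1,\dots,n\}$. Fix $s>0$ and put $p=1/s$. Attach to the edges $\{i,j\}$, $1\le i<j\le n$, the weights $E_{\{i,j\}}^{-s}$, where the $E_{\{i,j\}}$ are i.i.d. exponential random variables with mean $1$. The weight of a path is the sum of the weights of its edges. The optimal path is the (almost surely unique) path between vertex $1$ and vertex $n$ of minimal weight; $W_n=W_n(s)$ denotes its weight and $H_n=H_n(s)$ (the hopcount) its number of edges. Define $g_s(x)=\dfrac{x^{s+1}}{(x-1)^s}$ for $x\ge 2$. Define $\mathcal{S}=\{s_2,s_3,\dots\}$ with $s_j=\dfrac{\log(1+j^{-1})}{\log(1+(j^2-1)^{-1})}\in(j-1,j)$, $j=2,3,\dots$; $s_j$ is the solution $s$ of $g_s(j)=g_s(j+1)$. These are the values of $s$ for which the integer minimizer of $g_s$ over the integers $x\ge2$ is not unique. Define, for $k\ge1$, $a_k=\left(\dfrac{2\pi p}{1+p}\right)^{(k-1)/2}k^{((k-1)p-1)/2}$. *)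

(* Defs.v *)
From HB Require Import structures.
From mathcomp Require Import all_boot all_order all_algebra.
From mathcomp Require Import finmap.
From mathcomp Require Import all_classical all_reals all_analysis.
From mathcomp Require Import measurable_realfun ring lra.

Set Implicit Arguments.
Unset Strict Implicit.
Unset Printing Implicit Defensive.

Import Order.TTheory GRing.Theory Num.Theory.
Import numFieldNormedType.Exports.

Local Open Scope classical_set_scope.
Local Open Scope ring_scope.

Section random_variables.
Context {R : realType}.

Definition mutually_independent d (T : measurableType d) (P : probability T R)
    (I : choiceType) (D : {pred I}) (X : I -> {RV P >-> R}) : Prop :=
  forall (J : {fset I}) (B : I -> set R),
    {subset J <= D} -> (forall i, measurable (B i)) ->
    (P (\bigcap_(i in [set` J]) (X i @^-1` B i)) =
     \prod_(i <- J) P (X i @^-1` B i))%E.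

Definition exponentially_distributed d (T : measurableType d)
    (P : probability T R) (rate : R) (X : {RV P >-> R}) : Prop :=
  forall B : set R, measurable B ->
    distribution P X B = exponential_prob rate B.

(* The X n may live on different probability spaces. *)
Definition cvg_in_distribution (d : nat -> measure_display)
    (T : forall n, measurableType (d n)) (P : forall n, probability (T n) R)
    (X : forall n, {RV (P n) >-> R})
    d' (T' : measurableType d') (Q : probability T' R) (Y : {RV Q >-> R}) :
    Prop :=
  forall x : R, {for x, continuous (cdf Y)} ->
    cdf (X n) x @[n --> \oo] --> cdf Y x.

End random_variables.

Section complete_graph.
Context {R : realType}.
Variable n : nat.

(* The complete graph on N = n + 2 vertices: 'I_n.+2 is {1, ..., N} shifted by
   one, so that the end points 1 and N are ord0 and ord_max. *)
Definition adjacent : rel 'I_n.+2 := [rel x y | x != y].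

Definition edges : {pred {set 'I_n.+2}} :=
  [pred e : {set 'I_n.+2} | #|e| == 2%N].

(* A path is the sequence of its vertices; these are distinct, so at most n.+2
   of them occur. *)
Definition is_path (p : seq 'I_n.+2) : bool :=
  if p is x :: q then
    [&& x == ord0, last x q == ord_max, path adjacent x q & uniq (x :: q)]
  else false.

Definition path_edges (p : seq 'I_n.+2) : seq {set 'I_n.+2} :=
  [seq [set uv.1; uv.2]%SET | uv <- zip p (behead p)].

Definition path_weight (wt : {set 'I_n.+2} -> R) (p : seq 'I_n.+2) : R :=
  \sum_(e <- path_edges p) wt e.

Definition direct_path : n.+2.-bseq 'I_n.+2 :=
  widen_bseq (isT : 2 <= n.+2)%N [bseq ord0; ord_max].

Lemma direct_pathP : is_path direct_path.
Proof. by rewrite /is_path /= !eqxx. Qed.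

(* If several paths have minimal weight (an event of probability zero for
   continuous weights), [arg min] picks one of them. *)
Definition optimal_path (wt : {set 'I_n.+2} -> R) : n.+2.-bseq 'I_n.+2 :=
  [arg min_(p < direct_path | is_path p) path_weight wt p]%O.

Lemma optimal_pathP (wt : {set 'I_n.+2} -> R) :
  is_path (optimal_path wt) /\
  forall p : seq 'I_n.+2, is_path p ->
    path_weight wt (optimal_path wt) <= path_weight wt p.
Proof.
rewrite /optimal_path; case: arg_minP => [|p0 p0P p0_min]; first exact: direct_pathP.
split=> // p pP.
have sp : (size p <= n.+2)%N.
  case: p pP => [//|x q] /and4P[_ _ _ q_uniq].
  by have := max_card [in x :: q]; rewrite (card_uniqP q_uniq) card_ord.
exact: (p0_min (Bseq sp)).
Qed.

End complete_graph.

Section arg_min_measurable.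
Context d (T : measurableType d) {R : realType} {I : finType}.
Variables (i0 : I) (Pr : pred I) (F : I -> T -> R).
Hypothesis mF : forall i, measurable_fun [set: T] (F i).

Let amin (w : T) : I := [arg min_(i < i0 | Pr i) F i w]%O.

Let cmp (w : T) : {ffun I * I -> bool} := [ffun ij => F ij.1 w <= F ij.2 w].

Let amin_cmp w w' : cmp w = cmp w' -> amin w = amin w'.
Proof.
move=> /ffunP cww'; rewrite /amin /Order.arg_min /extremum.
congr (odflt _ _); apply: eq_pick => i /=; congr (_ && _).
apply: eq_forallb => j; congr (_ ==> _).
by have := cww' (i, j); rewrite !ffunE.
Qed.

Let measurable_cmp c : measurable [set w | cmp w = c].
Proof.
rewrite (_ : [set w | _] = \bigcap_(ij in [set: I * I])
    [set w | (F ij.1 w <= F ij.2 w) = c ij]); last first.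
  apply/seteqP; split=> [w /= <- ij _|w /= h]; first by rewrite /= ffunE.
  by apply/ffunP => ij; rewrite ffunE; exact: h.
apply: fin_bigcap_measurable => [|ij _]; first exact: finite_finset.
have mle : measurable [set w | F ij.1 w <= F ij.2 w].
  rewrite -[X in measurable X]setTI.
  exact: measurable_fun_le.
case: (c ij); first exact: mle.
rewrite (_ : [set w | _] = ~` [set w | F ij.1 w <= F ij.2 w]).
  exact: measurableC.
by apply/seteqP; split=> w /=; [move=> ->|move/negP/negbTE].
Qed.

Lemma measurable_comp_arg_min (G : I -> T -> R) :
  (forall i, measurable_fun [set: T] (G i)) ->
  measurable_fun [set: T]
    (fun w => G [arg min_(i < i0 | Pr i) F i w]%O w).
Proof.
move=> mG.
have mA i : measurable [set w | amin w = i].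
  rewrite (_ : [set w | _] = \bigcup_(c in [set c | exists2 w, cmp w = c & amin w = i])
      [set w | cmp w = c]); last first.
    apply/seteqP; split=> [w /= wi|w /= [c [w' <- <-]] /amin_cmp//].
    by exists (cmp w) => //; exists w.
  apply: fin_bigcup_measurable => [|c _]; first exact: finite_finset.
  exact: measurable_cmp.
rewrite (_ : (fun w => _) =
    (fun w => \sum_i \1_[set w | amin w = i] w * G i w)); last first.
  apply/funext => w; rewrite (bigD1 (amin w))//= big1 => [|i iw].
    by rewrite addr0 indicE mem_set// mul1r.
  rewrite indicE memNset ?mul0r//= => wi.
  by move: iw; rewrite wi eqxx.
by apply: measurable_sum => i; apply: measurable_funM.
Qed.

End arg_min_measurable.

Section constants.
Context {R : realType}.
Implicit Types (s x : R) (j k : nat).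

Definition g s x : R := x `^ (s + 1) / (x - 1) `^ s.

Definition s_ j : R :=
  ln (1 + j%:R^-1) / ln (1 + (j%:R ^+ 2 - 1)^-1).

Definition special_s : set R := [set s_ j | j in [set j : nat | (2 <= j)%N]].

Definition kfloor s : nat := `|Num.floor (s + 1)|%N.

Definition kceil s : nat := `|Num.ceil (s + 1)|%N.

(* By [gstarP] below, kfloor s and kceil s both minimize g s over the integers
   >= 2 when s is special. *)
Definition gstar s : R := g s (kfloor s)%:R.

Definition a_ s k : R :=
  let p := s^-1 in
  (2 * pi * p / (1 + p)) `^ ((k%:R - 1) / 2) *
  k%:R `^ (((k%:R - 1) * p - 1) / 2).

Let bernoulli x k : -1 <= x -> 1 + k%:R * x <= (1 + x) ^+ k.
Proof.
move=> x1; elim: k => [|k IH]; first by rewrite mul0r addr0 expr0.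
rewrite exprS.
have x10 : 0 <= 1 + x by lra.
apply: le_trans (ler_wpM2l x10 IH).
have : 0 <= k%:R * x ^+ 2 by rewrite mulr_ge0// sqr_ge0.
rewrite -natr1; lra.
Qed.

Let den_gt0 k : (2 <= k)%N -> 0 < ln (1 + (k%:R ^+ 2 - 1)^-1) :> R.
Proof.
move=> k2; have k2R : 2 <= k%:R :> R by rewrite (ler_nat _ 2).
by rewrite ln_gt0// ltrDl invr_gt0; nra.
Qed.

Lemma s_lt k : (2 <= k)%N -> s_ k < k%:R.
Proof.
move=> k2; have k2R : 2 <= k%:R :> R by rewrite (ler_nat _ 2).
have k1 : 0 < k%:R ^+ 2 - 1 :> R by nra.
have k1V : 0 < (k%:R ^+ 2 - 1)^-1 :> R by rewrite invr_gt0.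
have kV : 0 < k%:R^-1 :> R by rewrite invr_gt0; lra.
rewrite /s_ ltr_pdivrMr ?den_gt0// mulr_natl -lnXn; last by lra.
rewrite ltr_ln ?posrE ?exprn_gt0//; [|lra..].
apply: lt_le_trans (bernoulli _ _); last by lra.
by rewrite ltrD2l ltr_pdivlMr// mulrC ltr_pdivrMr; nra.
Qed.

Lemma s_gt k : (2 <= k)%N -> k%:R - 1 < s_ k.
Proof.
case: k => [//|k] k2; have k2R : 2 <= k.+1%:R :> R by rewrite (ler_nat _ 2).
rewrite /s_ ltr_pdivlMr ?den_gt0//.
set x : R := k.+1%:R in k2R *.
have xk : x - 1 = k%:R by rewrite /x -natr1 addrK.
clearbody x.
have x1 : 0 < x ^+ 2 - 1 by nra.
have x1V : 0 < (x ^+ 2 - 1)^-1 by rewrite invr_gt0.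
have xV : 0 < x^-1 by rewrite invr_gt0; lra.
rewrite xk mulr_natl -lnXn; last by lra.
rewrite ltr_ln ?posrE ?exprn_gt0//; last lra.
have x0 : 0 < x by lra.
have x2 : 1 < x ^+ 2 by lra.
have x20 : 0 < x ^+ 2 by lra.
have x2V : x ^- 2 < 1 by rewrite invf_lt1.
have := @bernoulli (- x ^- 2) k; rewrite lerN2 => /(_ (ltW x2V)) B.
have y0 : 0 < 1 - x ^- 2 by rewrite subr_gt0.
have -> : 1 + (x ^+ 2 - 1)^-1 = (1 - x ^- 2)^-1.
  by field; rewrite !gt_eqF.
rewrite exprVn invf_plt ?posrE ?exprn_gt0//; last lra.
apply: lt_le_trans B; rewrite -xk.
rewrite -subr_gt0 (_ : _ - _ = (x + 1)^-1 * x ^- 2).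
  by rewrite mulr_gt0 ?invr_gt0//; lra.
by field; rewrite !gt_eqF//; lra.
by lra.
Qed.

Let g_step s k : (2 <= k)%N ->
  ((g s k%:R <= g s k.+1%:R) = (s <= s_ k)) *
  ((g s k.+1%:R <= g s k%:R) = (s_ k <= s)).
Proof.
move=> k2; have k2R : 2 <= k%:R :> R by rewrite (ler_nat _ 2).
rewrite /g -natr1 addrK /s_ [s <= _]ler_pdivlMr ?den_gt0//.
rewrite [_ <= s]ler_pdivrMr ?den_gt0//.
have -> : 1 + k%:R^-1 = (k%:R + 1) / k%:R :> R by field; lra.
have -> : 1 + (k%:R ^+ 2 - 1)^-1 = k%:R ^+ 2 / ((k%:R - 1) * (k%:R + 1)) :> R.
  by field; rewrite !gt_eqF//; nra.
have k1 : 0 < k%:R - 1 :> R by lra.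
have k0 : 0 < k%:R :> R by lra.
have k3 : 0 < k%:R + 1 :> R by lra.
split; rewrite -[LHS]ler_ln ?posrE ?divr_gt0 ?powR_gt0//.
  rewrite !ln_div ?posrE ?powR_gt0 ?exprn_gt0 ?mulr_gt0// !ln_powR.
  rewrite (lnM (x := k%:R - 1)) ?posrE// lnXn// -(mulr_natl _ 2).
  by apply/idP/idP => h; lra.
rewrite !ln_div ?posrE ?powR_gt0 ?exprn_gt0 ?mulr_gt0// !ln_powR.
rewrite (lnM (x := k%:R - 1)) ?posrE// lnXn// -(mulr_natl _ 2).
by apply/idP/idP => h; lra.
Qed.

Lemma kfloor_s_ j : (2 <= j)%N -> kfloor (s_ j) = j.
Proof.
move=> j2; rewrite /kfloor (@floor_def _ _ j)//.
have := s_lt j2; have := s_gt j2.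
rewrite rmorphD/= -pmulrn; lra.
Qed.

Lemma kceil_s_ j : (2 <= j)%N -> kceil (s_ j) = j.+1.
Proof.
move=> j2; rewrite /kceil (@ceil_def _ _ j.+1)//.
have := s_lt j2; have := s_gt j2.
rewrite rmorphB/= -pmulrn -natr1; lra.
Qed.

Lemma gstarP s : special_s s ->
  g s (kceil s)%:R = gstar s /\
  forall k, (2 <= k)%N -> gstar s <= g s k%:R.
Proof.
move=> [j /= j2 <-]; rewrite /gstar kfloor_s_// kceil_s_//.
have s_incr m k : (2 <= m)%N -> (m < k)%N -> s_ m < s_ k.
  move=> m2 mk; apply: lt_trans (s_lt m2) _.
  apply: le_lt_trans (s_gt (leq_trans m2 (ltnW mk))).
  by rewrite lerBrDr natr1 ler_nat.
split; first by apply/eqP; rewrite eq_le !g_step// lexx.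
move=> k k2; have [jk|/ltnW kj] := leqP j k.
  elim: k jk {k2} => [|k IH]; first by rewrite leqn0 => /eqP ->.
  rewrite leq_eqVlt => /predU1P[<-//|]; rewrite ltnS => jk.
  apply: le_trans (IH jk) _; rewrite g_step ?(leq_trans j2)//.
  by move: jk; rewrite leq_eqVlt => /predU1P[<-//|/s_incr jk]; exact/ltW/jk.
rewrite -(subKn kj); move: k2; rewrite -{1}(subKn kj).
elim: (j - k)%N => [|i IH] ji2; first by rewrite subn0.
have ji : (j - i = (j - i.+1).+1)%N.
  by rewrite -subSn ?subSS// ltnW// -subn_gt0 (leq_trans _ ji2).
have ji2' : (2 <= j - i)%N by rewrite ji ltnW.
apply: le_trans (IH ji2') _; rewrite ji g_step//.
by apply/ltW/s_incr => //; rewrite -ji leq_subr.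
Qed.

End constants.

Section optimal_weight_and_hopcount.
Context d (T : measurableType d) {R : realType} (P : probability T R).
(* Only the E e with e an edge matter: E is evaluated along paths only. *)
Variables (s : R) (n : nat) (E : {set 'I_n.+2} -> {RV P >-> R}).

Definition edge_weight (w : T) : {set 'I_n.+2} -> R :=
  fun e => E e w `^ (- s).

Definition opt_weight (w : T) : R :=
  path_weight (edge_weight w) (optimal_path (edge_weight w)).

Definition hopcount (w : T) : R :=
  (size (path_edges (optimal_path (edge_weight w))))%:R.

Let measurable_path_weight (p : seq 'I_n.+2) :
  measurable_fun [set: T] (fun w => path_weight (edge_weight w) p).
Proof.
apply: measurable_sum => e.
by apply: (measurableT_comp (measurable_powR _)).
Qed.

Let pw (p : n.+2.-bseq 'I_n.+2) (w : T) : R := path_weight (edge_weight w) p.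

Let mpw p : measurable_fun [set: T] (pw p).
Proof. exact: measurable_path_weight. Qed.

Let measurable_opt_weight : measurable_fun [set: T] opt_weight.
Proof. exact: (measurable_comp_arg_min _ _ mpw mpw). Qed.

HB.instance Definition _ :=
  isMeasurableFun.Build _ _ _ _ opt_weight measurable_opt_weight.

Let measurable_hopcount : measurable_fun [set: T] hopcount.
Proof.
exact: (measurable_comp_arg_min _ _ mpw (fun p =>
  @measurable_cst _ _ T R [set: T] (size (path_edges p))%:R)).
Qed.

HB.instance Definition _ :=
  isMeasurableFun.Build _ _ _ _ hopcount measurable_hopcount.

Definition normalized_weight (w : T) : R :=
  let L := ln n.+2%:R in
  let p := s^-1 in
  L `^ (s + 1) / (s * gstar s) * (opt_weight w - gstar s / L `^ s)
  + 2^-1 * ln L - p * ln (gstar s) / 2.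

Let measurable_normalized_weight : measurable_fun [set: T] normalized_weight.
Proof.
apply: measurable_funB => //; apply: measurable_funD => //.
by apply: measurable_funM => //; apply: measurable_funB.
Qed.

HB.instance Definition _ :=
  isMeasurableFun.Build _ _ _ _ normalized_weight measurable_normalized_weight.

End optimal_weight_and_hopcount.

Section limits.
Context d (T : measurableType d) {R : realType} (Q : probability T R).
Variables (s : R) (Xi : nat -> {RV Q >-> R}).

Definition limit_weight (w : T) : R :=
  Num.min (Xi (kfloor s) w / ((kfloor s)%:R - 1))
          (Xi (kceil s) w / ((kceil s)%:R - 1)).

(* The arg min; a tie has probability zero when the Xi k are independent with
   continuous laws. *)
Definition limit_hopcount (w : T) : R :=
  if Xi (kfloor s) w / ((kfloor s)%:R - 1) <=
     Xi (kceil s) w / ((kceil s)%:R - 1)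
  then (kfloor s)%:R else (kceil s)%:R.

Let measurable_scaled k :
  measurable_fun [set: T] (fun w => Xi k w / (k%:R - 1)).
Proof. by apply: measurable_funM => //; exact: measurable_cst. Qed.

Let measurable_limit_weight : measurable_fun [set: T] limit_weight.
Proof. by apply: measurable_minr; exact: measurable_scaled. Qed.

HB.instance Definition _ :=
  isMeasurableFun.Build _ _ _ _ limit_weight measurable_limit_weight.

Let measurable_limit_hopcount : measurable_fun [set: T] limit_hopcount.
Proof.
apply: measurable_fun_ifT; [|exact: measurable_cst..].
by apply: measurable_fun_ler; exact: measurable_scaled.
Qed.

HB.instance Definition _ :=
  isMeasurableFun.Build _ _ _ _ limit_hopcount measurable_limit_hopcount.

End limits.

(* Main.v *)
(** Write N = n + 2, L = ln N and p = 1/s.  Laplace's method, applied along the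
    recursion that adds one edge at a time, gives
      P(E_1^-s + ... + E_k^-s <= x) ~ a_k x^(-p(k-1)/2) exp(- k^(1+p) x^-p)
    as x -> 0, and a convexity argument shows that k^(1+p) x^-p is the least
    possible value of E_1 + ... + E_k on this event.  Hence at the level x_n(y)
    at which the normalized weight equals y, the mean number of paths with k
    edges and weight at most x_n(y) tends to a_k e^((k-1)y) for the two lengths
    k minimizing g_s, and the mean number of such paths of all other lengths
    tends to 0.  Two distinct paths that share an edge can be light together
    only at an additional cost in the sum of the E, so the dependent pairs are
    negligible and the events "the path is light" behave as if independent:
    the probability of no light path of length j at level y and none of length
    j+1 at level z tends to exp(- a_j e^((j-1)y)) exp(- a_(j+1) e^(jz)), which
    is P(Xi_j/(j-1) > y, Xi_(j+1)/j > z).  For y = z this is (a).  For (b), the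
    same limit taken along a fine grid of levels bounds from below the
    probabilities that the optimal path has j, respectively j+1, edges; these
    bounds add up to almost 1 and hold for the limiting variables as well. *)
Require Import Defs.
From mathcomp Require Import all_boot all_order all_algebra.
From mathcomp Require Import finmap.
From mathcomp Require Import all_classical all_reals all_analysis.
From mathcomp Require Import measurable_realfun ring lra zify.

Set Implicit Arguments.
Unset Strict Implicit.
Unset Printing Implicit Defensive.

Import Order.TTheory GRing.Theory Num.Theory.
Import numFieldNormedType.Exports.

Local Open Scope classical_set_scope.
Local Open Scope ring_scope.

(** * Convexity and the rate function *)

(** The obstacle is the dependence of paths with a common edge. A path u that visits o vertices off
    v has at least o+1 edges off v, and there are about N^o such u: if these edges had the full
    weight x at their disposal, number and energy would balance again and the pairs would contribute
    a quantity of order one. They are negligible because the shared edge uses up part of the weight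
    allowed to u, which raises the energy by a further kappa G x^-p, a factor N^-kappa. Sharp
    asymptotics are needed only for the mean number of paths of the two optimal lengths. Everywhere
    else Chernoff bounds with a slightly reduced rate suffice, and their loss is tuned to cost at
    most half of the gap at hand. Two separate levels y and z are kept for the two lengths because
    the hopcount compares two random levels, which requires their joint law. *)

Section tangent.
Context {R : realType}.
Implicit Types p v x s : R.

Lemma powRN_ge_tangent p v : 0 < p -> 0 < v -> 1 - p * (v - 1) <= v `^ (- p).
Proof.
move=> p0 v0; rewrite /powR gt_eqF//.
have h := @le_ln1Dx R (v - 1); rewrite (_ : 1 + (v - 1) = v) in h; last by ring.
have {}h : ln v <= v - 1 by apply: h; lra.
apply: le_trans (expR_ge1Dx _); nra.
Qed.

Lemma powRN_gt_tangent p v :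
  0 < p -> 0 < v -> v != 1 -> 1 - p * (v - 1) < v `^ (- p).
Proof.
move=> p0 v0 v1; rewrite /powR gt_eqF//.
have h := @le_ln1Dx R (v - 1); rewrite (_ : 1 + (v - 1) = v) in h; last by ring.
have {}h : ln v <= v - 1 by apply: h; lra.
apply: le_lt_trans (expR_gt1Dx _); first nra.
by apply: mulf_neq0; rewrite ?oppr_eq0 ?ln_eq0// gt_eqF.
Qed.

Lemma powRDp v x y : 0 < v -> v `^ (x + y) = v `^ x * v `^ y.
Proof. by move=> v0; rewrite powRD// (gt_eqF v0) implybT. Qed.

Lemma powRNV_K s v : s != 0 -> 0 <= v -> (v `^ - s) `^ (- s^-1) = v.
Proof. by move=> s0 v0; rewrite -powRrM mulrNN mulfV// powRr1. Qed.

Lemma powRNVV_K s v : s != 0 -> 0 <= v -> (v `^ (- s^-1)) `^ (- s) = v.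
Proof. by move=> s0 v0; rewrite -powRrM mulrNN mulVf// powRr1. Qed.

(** With a_i = t_i^-s one has t_i = a_i^-p. The convex function a^-p lies above its tangent at y =
    x/k, and the linear terms of the tangents add up to something nonnegative because the a_i have
    sum at most x. *)
Lemma power_mean (I : Type) (r : seq I) (t : I -> R) s x :
  0 < s -> 0 < x -> (0 < size r)%N ->
  (forall i, 0 < t i) -> \sum_(i <- r) t i `^ (- s) <= x ->
  (size r)%:R `^ (1 + s^-1) * x `^ (- s^-1) <= \sum_(i <- r) t i.
Proof.
move=> s0 x0 r0 t0 Sx; set p := s^-1; set k : R := (size r)%:R.
have p0 : 0 < p by rewrite invr_gt0.
have k0 : 0 < k by rewrite ltr0n.
set y := x / k; have y0 : 0 < y by rewrite divr_gt0.
have -> : k `^ (1 + p) * x `^ (- p) = k * y `^ (- p).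
  rewrite /y powRM ?invr_ge0 ?ltW// powRDp// powRr1 ?ltW//.
  by rewrite -[k^-1]powR_inv1 ?ltW// -powRrM mulrNN mul1r mulrA mulrAC.
have step i : y `^ (- p) * (1 - p * (t i `^ (- s) / y - 1)) <= t i.
  have ti := t0 i.
  rewrite -[leRHS](@powRNV_K s) ?(ltW ti) ?gt_eqF// -/p.
  have : 0 < t i `^ (- s) by rewrite powR_gt0.
  move: (t i `^ (- s)) => a a0.
  have -> : a `^ (- p) = y `^ (- p) * (a / y) `^ (- p).
    by rewrite -powRM ?ltW ?divr_gt0// mulrC divfK// gt_eqF.
  by rewrite ler_wpM2l ?powR_ge0// powRN_ge_tangent// divr_gt0.
apply: le_trans (ler_sum _ (fun i _ => step i)).
rewrite -mulr_sumr [leLHS]mulrC ler_wpM2l ?powR_ge0//.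
rewrite big_split/= sumrN -mulr_sumr big_split/= -mulr_suml sumrN.
rewrite big_const_seq count_predT iter_addr_0 -/k.
have : (\sum_(i <- r) t i `^ (- s)) / y <= k.
  by rewrite ler_pdivrMr// mulrC /y divfK// gt_eqF.
nra.
Qed.

End tangent.

Section derivatives.
Context {R : realType}.

Lemma is_derive_powR (a x : R) :
  0 < x -> is_derive x 1 (fun y => y `^ a) (a * x `^ (a - 1)).
Proof.
move=> x0; apply: DeriveDef.
  by apply: derivable_powR; rewrite in_itv/= andbT.
by rewrite -derive1E powR_derive1// in_itv/= andbT.
Qed.

Lemma continuous_powR (a x : R) : 0 < x -> {for x, continuous (fun y => y `^ a)}.
Proof.
move=> x0; apply/differentiable_continuous/derivable1_diffP.
by have [] := is_derive_powR a x0.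
Qed.

Lemma is_derive_continuous (f : R -> R) (x d : R) :
  is_derive x 1 f d -> {for x, continuous f}.
Proof.
by move=> fd; apply/differentiable_continuous/derivable1_diffP; have [] := fd.
Qed.

Lemma MVT_nonstrict (f df : R -> R) (a b : R) : a <= b ->
  (forall x, a <= x <= b -> is_derive x 1 f (df x)) ->
  exists2 c, a <= c <= b & f b - f a = df c * (b - a).
Proof.
move=> ab fd; have [||c] := @MVT_segment R f df a b ab; last 1 first.
- by rewrite in_itv/= => cab ->; exists c.
- by move=> x; rewrite in_itv/= => /andP[/ltW ax /ltW xb]; apply: fd; rewrite ax.
apply: continuous_in_subspaceT => x; rewrite inE/= in_itv/= => xab.
exact: is_derive_continuous (fd x xab).
Qed.

(** Only the value of the second derivative at x0 is available, so the mean value theorem is applied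
    to f minus its quadratic term: the derivative of this difference is at most e |y - x0| near
    x0. *)
Lemma taylor2 (f df : R -> R) (x0 c r e : R) : 0 < r -> 0 < e ->
  (forall x, `|x - x0| <= r -> is_derive x 1 f (df x)) ->
  df x0 = 0 -> is_derive x0 1 df c ->
  exists2 d : R, 0 < d & forall x, `|x - x0| <= d ->
    `|f x - f x0 - c / 2 * (x - x0) ^+ 2| <= e * (x - x0) ^+ 2.
Proof.
move=> r0 e0 fd df0 dfc.
have [d d0 dP] : exists2 d : R, 0 < d & forall x, `|x - x0| <= d ->
    `|df x - c * (x - x0)| <= e * `|x - x0|.
  have [q [qE qc qx0]] := (is_derive1_caratheodory _ _ _).1 dfc.
  have /cvgrPdist_le/(_ e e0)/nbhs_ballP[d /= d0 dP] := qc.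
  exists (d / 2); first by rewrite divr_gt0.
  move=> x xd; have := qE x; rewrite df0 subr0 => ->.
  rewrite -mulrBl normrM ler_wpM2r// distrC -qx0; apply: dP.
  by rewrite /ball/= distrC (le_lt_trans xd)// ltr_pdivrMr// ltr_pMr// ltr1n.
exists (Num.min d r); first by rewrite lt_min d0.
move=> x; rewrite le_min => /andP[xd xr].
pose g y := f y - c / 2 * (y - x0) ^+ 2.
have gd y : `|y - x0| <= r -> is_derive y 1 g (df y - c * (y - x0)).
  move=> /fd fdy; rewrite /g.
  apply: is_derive_eq.
  by rewrite /GRing.scale/= subr0 !mulr1; lra.
have gx0 : f x - f x0 - c / 2 * (x - x0) ^+ 2 = g x - g x0.
  by rewrite /g subrr expr0n/=; ring.
rewrite gx0; have [xx0|/ltW xx0] := leP x0 x.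
  have [|y /andP[y1 y2] ->] := @MVT_nonstrict g (fun y => df y - c * (y - x0)) x0 x xx0.
    move=> y /andP[y1 y2]; apply: gd; move: xr; rewrite !ger0_norm ?subr_ge0//; lra.
  rewrite normrM expr2 mulrA (ger0_norm (_ : 0 <= x - x0)) ?subr_ge0// ler_wpM2r ?subr_ge0//.
  have nx : `|x - x0| = x - x0 by rewrite ger0_norm ?subr_ge0.
  have ny : `|y - x0| = y - x0 by rewrite ger0_norm ?subr_ge0.
  apply: le_trans (dP y _) _; first lra.
  by rewrite ler_wpM2l ?(ltW e0)//; lra.
have [|y /andP[y1 y2] gE] := @MVT_nonstrict g (fun y => df y - c * (y - x0)) x x0 xx0.
  move=> y /andP[y1 y2]; apply: gd; move: xr; rewrite !ler0_norm ?subr_le0//; lra.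
rewrite distrC gE normrM (ger0_norm (_ : 0 <= x0 - x)) ?subr_ge0//.
have -> : e * (x - x0) ^+ 2 = e * (x0 - x) * (x0 - x) by ring.
rewrite ler_wpM2r ?subr_ge0//.
have nx : `|x - x0| = x0 - x by rewrite ler0_norm ?subr_le0// opprB.
have ny : `|y - x0| = x0 - y by rewrite ler0_norm ?subr_le0// opprB.
apply: le_trans (dP y _) _; first lra.
by rewrite ler_wpM2l ?(ltW e0)//; lra.
Qed.

End derivatives.

Section rate.
Context {R : realType}.
Variables (s K : R).
Hypotheses (s0 : 0 < s) (K0 : 0 < K).
Let p := s^-1.
Let p0 : 0 < p. Proof. by rewrite invr_gt0. Qed.
Let ps : p * s = 1. Proof. by rewrite mulVf ?gt_eqF. Qed.

(* With t scaled by x^-p, [rate t] x^-p is the least energy of K edges of total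
   weight x - t^-s together with one edge of energy t; [rate_pt] is its
   minimizer and [rate_curv] its second derivative there. *)
Definition rate (t : R) := K `^ (1 + s^-1) * (1 - t `^ (- s)) `^ (- s^-1) + t.
Definition rate' (t : R) := 1 - K `^ (1 + s^-1) * (t `^ s - 1) `^ (- (1 + s^-1)).
Definition rate_pt := (K + 1) `^ s^-1.
Definition rate_curv := (1 + s^-1) * s / K * (K + 1) `^ (1 - s^-1).

Lemma powR_gt1 (t a : R) : 1 < t -> 0 < a -> 1 < t `^ a.
Proof.
move=> t1 a0; have t0 : 0 < t by lra.
by rewrite /powR gt_eqF// expR_gt1 mulr_gt0// ln_gt0.
Qed.

Lemma rate_pt_gt1 : 1 < rate_pt.
Proof. by apply: powR_gt1 => //; have := K0; lra. Qed.

Lemma rate_ptE : rate_pt `^ s = K + 1.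
Proof. by rewrite -powRrM ps powRr1//; have := K0; lra. Qed.

Lemma powRN_lt1 (t a : R) : 1 < t -> 0 < a -> 0 < 1 - t `^ (- a) < 1.
Proof.
move=> t1 a0; have := powR_gt1 t1 a0; rewrite powRN => h.
have h0 : 0 < t `^ a by lra.
by rewrite subr_gt0 invf_lt1// h/= ltrBlDr ltrDl invr_gt0.
Qed.

Lemma is_derive_rate (t : R) : 1 < t -> is_derive t 1 rate (rate' t).
Proof.
move=> t1; have t0 : 0 < t by lra.
have /andP[u0 u1] := powRN_lt1 t1 s0.
have d1 : is_derive t 1 (fun x => 1 - x `^ (- s)) (s * t `^ (- s - 1)).
  have h := is_derive_powR (- s) t0; apply: is_derive_eq.
  by ring.
have d2 := is_derive_powR (- p) u0.
have d3 := @is_derive1_comp _ (fun y => y `^ (- p)) (fun x => 1 - x `^ (- s)) _ _ _ d2 d1.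
rewrite /rate -/p; apply: is_derive_eq; rewrite /rate' /GRing.scale/=.
(* (t^s)^-(1+p) is the factor t^(-s-1) of the inner derivative, and the remaining factor p s is
   1. *)
rewrite -/p; have e1 : t `^ s - 1 = t `^ s * (1 - t `^ (- s)).
  by rewrite powRN; field; rewrite gt_eqF// powR_gt0.
have -> : - (1 + p) = - p - 1 by ring.
rewrite e1 powRM ?powR_ge0 ?ltW// -powRrM.
have -> : s * (- p - 1) = - s - 1 by have := ps; lra.
have := ps; move: (K `^ _) ((1 - _) `^ (- p - 1)) (t `^ (- s - 1)) => A B C ps'.
by transitivity (1 - A * B * (p * s) * C); [ring|rewrite ps'; ring].
Qed.

Lemma rate_ptP : rate rate_pt = (K + 1) `^ (1 + p).
Proof.
have K1 : 0 < K + 1 by have := K0; lra.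
rewrite /rate -/p powRN rate_ptE.
have -> : 1 - (K + 1)^-1 = K / (K + 1) by field; rewrite gt_eqF.
rewrite powRM ?invr_ge0 ?ltW// -[(K + 1)^-1]powR_inv1 ?ltW// -powRrM mulN1r opprK.
rewrite mulrA -powRDp// (_ : 1 + p - p = 1); last by ring.
by rewrite powRr1 ?ltW// /rate_pt -/p powRDp// powRr1 ?ltW//; ring.
Qed.

Lemma rate'_pt : rate' rate_pt = 0.
Proof.
rewrite /rate' rate_ptE addrK -powRDp// -/p.
by rewrite subrr powRr0 subrr.
Qed.

Lemma is_derive_rate' : is_derive rate_pt 1 rate' rate_curv.
Proof.
have K1 : 0 < K + 1 by have := K0; lra.
have t1 := rate_pt_gt1; have t0 : 0 < rate_pt by lra.
have d1 := is_derive_powR s t0.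
have u0 : 0 < rate_pt `^ s - 1 by rewrite rate_ptE addrK.
have d2 := is_derive_powR (- (1 + p)) u0.
have d4 : is_derive rate_pt 1 (fun t => t `^ s - 1) (s * rate_pt `^ (s - 1)).
  by apply: is_derive_eq; rewrite subr0.
have d3 := @is_derive1_comp _ (fun y => y `^ (- (1 + p))) (fun t => t `^ s - 1) _ _ _ d2 d4.
rewrite /rate' -/p; apply: is_derive_eq.
rewrite /GRing.scale/= rate_ptE addrK /rate_curv -/p.
have -> : rate_pt `^ (s - 1) = (K + 1) `^ (1 - p).
  by rewrite /rate_pt -/p -powRrM mulrBr mulr1 ps.
have -> : K `^ (- (1 + p) - 1) = (K `^ (1 + p))^-1 / K.
  by rewrite powRDp// powRN powR_inv1 ?ltW.
by field; rewrite !gt_eqF ?powR_gt0.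
Qed.

Lemma rate_curv_gt0 : 0 < rate_curv.
Proof.
have K1 : 0 < K + 1 by have := K0; lra.
rewrite /rate_curv -/p mulr_gt0 ?powR_gt0// divr_gt0 ?mulr_gt0//.
by have := p0; lra.
Qed.

Lemma rate_quad (e : R) : 0 < e -> exists2 d : R, 0 < d &
  forall t, `|t - rate_pt| <= d ->
    1 < t /\ `|rate t - (K + 1) `^ (1 + p) - rate_curv / 2 * (t - rate_pt) ^+ 2|
      <= e * (t - rate_pt) ^+ 2.
Proof.
move=> e0; have t1 := rate_pt_gt1; pose r := (rate_pt - 1) / 2.
have r0 : 0 < r by rewrite /r; lra.
have near1 t : `|t - rate_pt| <= r -> 1 < t.
  by rewrite ler_norml => /andP[+ _]; rewrite /r; lra.
have rd t : `|t - rate_pt| <= r -> is_derive t 1 rate (rate' t).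
  by move/near1; exact: is_derive_rate.
have [d d0 dP] := taylor2 r0 e0 rd rate'_pt is_derive_rate'.
exists (Num.min d r); first by rewrite lt_min d0.
move=> t; rewrite le_min => /andP[td /near1 tr]; split=> //.
by rewrite -rate_ptP; exact: dP.
Qed.

Lemma rate'_ge0 t : rate_pt <= t -> 0 <= rate' t.
Proof.
move=> tt; have t1 := rate_pt_gt1.
rewrite /rate' -/p subr_ge0 -ler_pdivlMl ?powR_gt0// mulr1 -powRN.
have p1 : 0 <= 1 + p by have := p0; lra.
have tK : K <= t `^ s - 1.
  rewrite lerBrDr -rate_ptE; apply: ge0_ler_powR; rewrite ?nnegrE ?(ltW s0)//; lra.
have K' := K0; rewrite !powRN lef_pV2 ?posrE ?powR_gt0//; last lra.
by apply: ge0_ler_powR; rewrite ?nnegrE//; lra.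
Qed.

Lemma rate'_le0 t : 1 < t -> t <= rate_pt -> rate' t <= 0.
Proof.
move=> t1 tt; have t0 : 0 < t by lra.
rewrite /rate' -/p subr_le0 -ler_pdivrMl ?powR_gt0// mulr1 -powRN.
have p1 : 0 <= 1 + p by have := p0; lra.
have tK : t `^ s - 1 <= K.
  rewrite lerBlDr -rate_ptE; apply: ge0_ler_powR; rewrite ?nnegrE ?(ltW s0)//; lra.
have ts := powR_gt1 t1 s0; have K' := K0.
rewrite !powRN lef_pV2 ?posrE ?powR_gt0//; last lra.
by apply: ge0_ler_powR; rewrite ?nnegrE//; lra.
Qed.

(** [rate] decreases up to [rate_pt] and increases after it, so beyond distance d it is at least its
    value at the smaller distance m. There the quadratic expansion, with half of its main term given
    away as error, leaves rate_curv / 4 * m^2. *)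
Lemma rate_far (d : R) : 0 < d -> exists2 e : R, 0 < e &
  forall t, 1 < t -> d <= `|t - rate_pt| -> (K + 1) `^ (1 + p) + e <= rate t.
Proof.
move=> d0; have c0 := rate_curv_gt0.
have [|d1 d10 d1P] := @rate_quad (rate_curv / 4); first by lra.
pose m := Num.min d d1.
have m0 : 0 < m by rewrite lt_min d0.
have [md md1] : m <= d /\ m <= d1 by rewrite /m !ge_min !lexx orbT.
exists (rate_curv / 4 * m ^+ 2); first by rewrite mulr_gt0 ?exprn_gt0//; lra.
have t1 := rate_pt_gt1.
move=> t tgt1 td; have [tp|tp] := leP rate_pt t.
  have td' : m <= t - rate_pt by apply: le_trans md _; rewrite -[leRHS]ger0_norm ?subr_ge0.
  have := d1P (rate_pt + m); rewrite addrAC subrr add0r ger0_norm ?(ltW m0)//.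
  move=> /(_ md1)[_]; rewrite ler_norml => /andP[h _].
  have [|u /andP[u1 u2]|c /andP[c1 c2] E] := @MVT_nonstrict _ rate rate' (rate_pt + m) t; first lra.
    by apply: is_derive_rate; lra.
  have : 0 <= rate' c * (t - (rate_pt + m)) by rewrite mulr_ge0 ?rate'_ge0//; lra.
  by lra.
have td' : m <= rate_pt - t.
  by apply: le_trans md _; rewrite distrC ger0_norm ?subr_ge0 ?(ltW tp)// in td.
have := d1P (rate_pt - m); rewrite addrAC subrr add0r sqrrN normrN ger0_norm ?(ltW m0)//.
move=> /(_ md1)[u1]; rewrite ler_norml => /andP[h _].
have [|u /andP[u2 u3]|c /andP[c1 c2] E] := @MVT_nonstrict _ rate rate' t (rate_pt - m); first lra.
  by apply: is_derive_rate; lra.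
have : rate' c * (rate_pt - m - t) <= 0 by rewrite mulr_le0_ge0 ?rate'_le0//; lra.
by lra.
Qed.

Lemma rate_ge t : 1 < t -> (K + 1) `^ (1 + p) <= rate t.
Proof.
move=> t1; have [->|tt] := eqVneq t rate_pt; first by rewrite rate_ptP.
have [|e e0] := @rate_far `|t - rate_pt|; first by rewrite normr_gt0 subr_eq0.
by move=> /(_ t t1 (lexx _)); lra.
Qed.

End rate.

(** * Laplace asymptotics of the weight of k edges *)

Section gaussian.
Context {R : realType}.
Local Notation leb := (@lebesgue_measure R).

Definition gauss (m v t : R) : R := expR (- (t - m) ^+ 2 / (2 * v)).

Lemma measurable_gauss m v : measurable_fun [set: R] (gauss m v).
Proof.
apply: measurableT_comp => //; apply: measurable_funM => //.
apply: measurableT_comp => //; apply: measurable_funX => //.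
exact: measurable_funB.
Qed.

Lemma integral_gauss (m v : R) : 0 < v ->
  (\int[leb]_t (gauss m v t)%:E = (Num.sqrt (2 * pi * v))%:E)%E.
Proof.
move=> v0; have sv : 0 < Num.sqrt v by rewrite sqrtr_gt0.
have := integral_normal_pdf m (Num.sqrt v).
rewrite normal_pdfE ?gt_eqF//.
have -> : normal_peak (Num.sqrt v) = (Num.sqrt (2 * pi * v))^-1.
  by rewrite /normal_peak sqr_sqrtr ?ltW//; congr (Num.sqrt _)^-1; ring.
have -> : normal_fun m (Num.sqrt v) = gauss m v.
  apply/funext => x; rewrite /normal_fun /gauss sqr_sqrtr ?ltW//.
  by congr (expR (_ / _)); ring.
under eq_integral do rewrite EFinM.
rewrite ge0_integralZl//=; last 2 first.
- by apply/measurable_EFinP; exact: measurable_gauss.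
- by move=> x _; rewrite lee_fin expR_ge0.
set q := Num.sqrt _; have q0 : 0 < q by rewrite sqrtr_gt0 !mulr_gt0// pi_gt0.
move=> /(congr1 (fun z => q%:E * z)%E); rewrite mule1 muleA -EFinM divff ?gt_eqF//.
by rewrite mul1e.
Qed.

(** The factor d of the exponential density is left out: rates below 1 occur only in dominating
    functions, of mass d^-1. The support is open because [powR] gives the value 0, not infinity, to
    t^-s at t = 0. *)
Definition edens (d t : R) : R := expR (- (d * t)) * (0 < t)%R%:R.

Lemma measurable_edens d : measurable_fun [set: R] (edens d).
Proof.
apply: measurable_funM.
  apply: measurableT_comp => //; apply: measurableT_comp => //.
rewrite (_ : (fun _ => _) = \1_`]0, +oo[); first exact: measurable_indic.
by apply/funext => t; rewrite indicE mem_setE/= in_itv/= andbT.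
Qed.

Lemma edens_ge0 d t : 0 <= edens d t.
Proof. by rewrite mulr_ge0 ?expR_ge0. Qed.

Lemma edens_ae_exponential (h : R -> R) : measurable_fun [set: R] h ->
  (forall t, 0 <= h t) ->
  (\int[leb]_t (h t * edens 1 t)%:E = \int[leb]_t (h t * exponential_pdf 1 t)%:E)%E.
Proof.
move=> mh h0; apply: ge0_ae_eq_integral => //.
- by apply/measurable_EFinP; apply: measurable_funM => //; exact: measurable_edens.
- apply/measurable_EFinP; apply: measurable_funM => //.
  exact: measurable_exponential_pdf.
- by move=> t _; rewrite lee_fin mulr_ge0 ?edens_ge0.
- by move=> t _; rewrite lee_fin mulr_ge0 ?exponential_pdf_ge0.
- exists [set 0]; split => //=; first exact: lebesgue_measure_set1.
  move=> t /=; apply: contra_notP => /eqP t0 _.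
  congr (_ * _)%:E; rewrite /edens mul1r.
  have [tn|tp|te] := ltgtP t 0; last by rewrite te eqxx in t0.
    by rewrite mulr0 lt0_exponential_pdf.
  by rewrite exponential_pdfE ?ltW// mul1r mulN1r mulr1.
Qed.

Lemma integral_edens (d : R) : 0 < d -> (\int[leb]_t (edens d t)%:E = (d^-1)%:E)%E.
Proof.
move=> d0; have := integral_exponential_pdf d0.
have -> : (\int[leb]_t (exponential_pdf d t)%:E = \int[leb]_t (d%:E * (edens d t)%:E))%E.
  apply: ge0_ae_eq_integral => //.
  - by apply/measurable_EFinP; exact: measurable_exponential_pdf.
  - apply/measurable_EFinP; apply: measurable_funM => //; exact: measurable_edens.
  - by move=> t _; rewrite lee_fin ?exponential_pdf_ge0 ?ltW.
  - by move=> t _; rewrite lee_fin mulr_ge0 ?edens_ge0 ?ltW.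
  - exists [set 0]; split => //=; first exact: lebesgue_measure_set1.
    move=> t /=; apply: contra_notP => /eqP t0 _.
    rewrite -EFinM; congr (_)%:E; rewrite /edens.
    have [tn|tp|te] := ltgtP t 0; last by rewrite te eqxx in t0.
      by rewrite mulr0 mulr0 lt0_exponential_pdf.
    by rewrite exponential_pdfE ?ltW// mulNr mulr1.
rewrite ge0_integralZl//=; last 3 first.
- by apply/measurable_EFinP; exact: measurable_edens.
- by move=> x _; rewrite lee_fin edens_ge0.
- by rewrite lee_fin ltW.
move=> /(congr1 (fun z => (d^-1)%:E * z)%E).
by rewrite mule1 muleA -EFinM mulVf ?gt_eqF// mul1e.
Qed.

End gaussian.

Section laplace.
Context {R : realType}.
Local Notation leb := (@lebesgue_measure R).

Lemma cvg_expRN_pinfty (k : R) : 0 < k -> expR (- (k * x)) @[x --> +oo] --> 0.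
Proof.
move=> k0; apply: (@cvg_comp _ _ _ (fun x => k * x) (fun x => expR (- x)) _ (pinfty_nbhs R)).
  exact: gt0_cvgMry.
exact: cvgr_expR.
Qed.

Lemma near_expRN_le (C k e : R) : 0 < k -> 0 < e ->
  \forall L \near +oo, C * expR (- (k * L)) <= e.
Proof.
move=> k0 e0.
have h : C * expR (- (k * x)) @[x --> +oo] --> 0.
  by rewrite -(mulr0 C); apply: cvgMl_tmp; exact: cvg_expRN_pinfty.
by apply: (@cvgr_le _ _ _ _ _ 0).
Qed.

Lemma le_integral_EFin (f g : R -> R) :
  measurable_fun [set: R] f -> measurable_fun [set: R] g ->
  (forall t, 0 <= f t) -> (forall t, f t <= g t) ->
  (\int[leb]_t (f t)%:E <= \int[leb]_t (g t)%:E)%E.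
Proof.
move=> mf mg f0 fg; apply: ge0_le_integral => //.
- by move=> t _; rewrite lee_fin.
- exact/measurable_EFinP.
- exact/measurable_EFinP.
- by move=> t _; rewrite lee_fin.
Qed.

Lemma integral_lincomb (f g : R -> R) (a b I J : R) :
  measurable_fun [set: R] f -> measurable_fun [set: R] g ->
  (forall t, 0 <= f t) -> (forall t, 0 <= g t) -> 0 <= a -> 0 <= b ->
  (\int[leb]_t (f t)%:E = I%:E)%E -> (\int[leb]_t (g t)%:E = J%:E)%E ->
  (\int[leb]_t (a * f t + b * g t)%:E = (a * I + b * J)%:E)%E.
Proof.
move=> mf mg f0 g0 a0 b0 fI gJ.
under eq_integral do rewrite EFinD.
rewrite ge0_integralD//.
- under eq_integral do rewrite EFinM.
  under [X in (_ + X)%E]eq_integral do rewrite EFinM.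
  rewrite !ge0_integralZl//.
  + by rewrite fI gJ.
  + exact/measurable_EFinP.
  + by move=> t _; rewrite lee_fin.
  + exact/measurable_EFinP.
  + by move=> t _; rewrite lee_fin.
- by move=> t _; rewrite lee_fin mulr_ge0.
- by apply/measurable_EFinP; apply: measurable_funM.
- by move=> t _; rewrite lee_fin mulr_ge0.
- by apply/measurable_EFinP; apply: measurable_funM.
Qed.

(* [f L] is sandwiched between Gaussians near L tau, c being the curvature of the
   phase and b the prefactor, and is exponentially small elsewhere. *)
Lemma laplace (f : R -> R -> R) (J : R -> R) (tau c b : R) :
  0 < c -> 0 < b ->
  (forall L t, 0 <= f L t) -> (forall L, measurable_fun [set: R] (f L)) ->
  (forall L : R, 0 < L -> (\int[leb]_t (f L t)%:E = (J L)%:E)%E) ->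
  (forall e : R, 0 < e -> e < b -> e < c -> exists2 d : R, 0 < d & exists M : R, forall L t, M <= L ->
    `|t - L * tau| <= d * L ->
    (b - e) * gauss (L * tau) (L / (c + e)) t <= f L t <=
    (b + e) * gauss (L * tau) (L / (c - e)) t) ->
  (forall d : R, 0 < d -> exists C k e M : R, [/\ 0 <= C, 0 < k, 0 < e &
     forall L t, M <= L -> d * L < `|t - L * tau| ->
       f L t <= C * expR (- (k * L)) * edens e t]) ->
  J L / Num.sqrt L @[L --> +oo] --> b * Num.sqrt (2 * pi / c).
Proof.
move=> c0 b0 f0 mf fJ near_ far.
have pi0 := @pi_gt0 R.
pose A e := (b + e) * Num.sqrt (2 * pi / (c - e)).
pose B e := (b - e) * Num.sqrt (2 * pi / (c + e)).
have A0 : A x @[x --> 0] --> b * Num.sqrt (2 * pi / c).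
  rewrite -[X in X * _](addr0 b) -[X in _ / X](subr0 c).
  apply: cvgM; first by apply: cvgD => //; exact: cvg_cst.
  apply: cvg_comp; last exact: sqrt_continuous.
  apply: cvgM; first exact: cvg_cst.
  apply: cvgV; first by rewrite subr0 gt_eqF.
  by apply: cvgB => //; exact: cvg_cst.
have B0 : B x @[x --> 0] --> b * Num.sqrt (2 * pi / c).
  rewrite -[X in X * _](subr0 b) -[X in _ / X](addr0 c).
  apply: cvgM; first by apply: cvgB => //; exact: cvg_cst.
  apply: cvg_comp; last exact: sqrt_continuous.
  apply: cvgM; first exact: cvg_cst.
  apply: cvgV; first by rewrite addr0 gt_eqF.
  by apply: cvgD => //; exact: cvg_cst.
apply/cvgrPdist_le => eps eps0.
have eps2 : 0 < eps / 2 by rewrite divr_gt0.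
(* Continuity of the two constants at 0 fixes the relative error e; the window d and the thresholds
   for L are chosen after it. *)
have [e [e0 eb ec Ae Be]] : exists e, [/\ 0 < e, e < b, e < c,
    A e <= b * Num.sqrt (2 * pi / c) + eps / 2 &
    b * Num.sqrt (2 * pi / c) - eps / 2 <= B e].
  have /cvgrPdist_le/(_ _ eps2) hA := cvg_at_right_filter A0.
  have /cvgrPdist_le/(_ _ eps2) hB := cvg_at_right_filter B0.
  near (0 : R)^'+ => e; exists e; split => //.
  - have : `|b * Num.sqrt (2 * pi / c) - A e| <= eps / 2 by near: e.
    by rewrite ler_norml; lra.
  - have : `|b * Num.sqrt (2 * pi / c) - B e| <= eps / 2 by near: e.
    by rewrite ler_norml; lra.
have [d d0 [M1 h1]] := near_ e e0 eb ec.
have [C [k [dd [M2 [C0 k0 dd0 h2]]]]] := far d d0.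
(* For the lower bound the Gaussian has to be cut off outside the window. Half of its exponent is at
   least k' L there; the other half is a Gaussian of twice the variance, whose mass is in C'. *)
pose k' := (c + e) * d ^+ 2 / 4.
have k'0 : 0 < k' by rewrite divr_gt0// mulr_gt0 ?exprn_gt0//; lra.
pose C' := (b - e) * Num.sqrt (2 * pi * (2 / (c + e))).
have C'0 : 0 <= C' by rewrite mulr_ge0 ?sqrtr_ge0//; lra.
have upper L : M1 <= L -> M2 <= L -> 0 < L ->
    J L <= A e * Num.sqrt L + C / dd * expR (- (k * L)).
  move=> ML1 ML2 L0; have v0 : 0 < L / (c - e) by rewrite divr_gt0//; lra.
  have Ck : 0 <= C * expR (- (k * L)) by rewrite mulr_ge0 ?expR_ge0.
  have be : 0 <= b + e by lra.
  have := integral_lincomb (measurable_gauss (L * tau) (L / (c - e)))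
    (measurable_edens dd) (fun t => expR_ge0 _) (@edens_ge0 _ dd) be Ck
    (integral_gauss (L * tau) v0) (integral_edens dd0).
  have -> : (b + e) * Num.sqrt (2 * pi * (L / (c - e))) = A e * Num.sqrt L.
    rewrite /A -[RHS]mulrA -sqrtrM ?divr_ge0 ?mulr_ge0 ?(ltW pi0)//; last lra.
    by congr (_ * Num.sqrt _); ring.
  move=> I; rewrite -lee_fin -fJ// (mulrAC C dd^-1) -[leRHS]I.
  apply: le_integral_EFin => //.
    apply: measurable_funD; apply: measurable_funM => //.
    - exact: measurable_gauss.
    - exact: measurable_edens.
  move=> t; have [td|td] := leP (`|t - L * tau|) (d * L).
    have /andP[_ h] := h1 _ _ ML1 td; apply: le_trans h _.
    by rewrite lerDl mulr_ge0 ?edens_ge0.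
  apply: le_trans (h2 _ _ ML2 td) _.
  by rewrite lerDr mulr_ge0 ?expR_ge0.
have lower L : M1 <= L -> 0 < L ->
    B e * Num.sqrt L <= J L + C' * Num.sqrt L * expR (- (k' * L)).
  move=> ML1 L0; have v0 : 0 < L / (c + e) by rewrite divr_gt0//; lra.
  have w0 : 0 < 2 * L / (c + e) by rewrite -mulrA mulr_gt0.
  have Ck : 0 <= (b - e) * expR (- (k' * L)) by rewrite mulr_ge0 ?expR_ge0//; lra.
  have be : 0 <= b - e by lra.
  have := integral_lincomb (mf L)
    (measurable_gauss (L * tau) (2 * L / (c + e))) (f0 L) (fun t => expR_ge0 _)
    ler01 Ck (fJ L L0) (integral_gauss (L * tau) w0).
  have -> : (b - e) * expR (- (k' * L)) * Num.sqrt (2 * pi * (2 * L / (c + e))) =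
      C' * Num.sqrt L * expR (- (k' * L)).
    rewrite (_ : 2 * pi * (2 * L / (c + e)) = 2 * pi * (2 / (c + e)) * L); last by ring.
    rewrite sqrtrM; first by rewrite /C'; ring.
    by rewrite !mulr_ge0 ?invr_ge0 ?(ltW pi0)//; lra.
  rewrite mul1r => I; rewrite -lee_fin -[leRHS]I.
  (* The summand with coefficient 0 lets [integral_lincomb] integrate a single multiple of a
     Gaussian. *)
  have -> : (B e * Num.sqrt L)%:E =
      (\int[leb]_t ((b - e) * gauss (L * tau) (L / (c + e)) t +
                    0 * gauss (L * tau) (L / (c + e)) t)%:E)%E.
    have IG := integral_gauss (L * tau) v0.
    rewrite (integral_lincomb _ _ _ _ _ _ IG IG) //;
      try exact: measurable_gauss; try by move=> t; exact: expR_ge0.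
    rewrite mul0r addr0 /B -[in LHS]mulrA -sqrtrM ?divr_ge0 ?mulr_ge0 ?(ltW pi0)//; last lra.
    by congr (_ * Num.sqrt _)%:E; ring.
  apply: le_integral_EFin => //.
  - by apply: measurable_funD; apply: measurable_funM => //; exact: measurable_gauss.
  - by apply: measurable_funD; apply: measurable_funM => //; exact: measurable_gauss.
  - by move=> t; rewrite mul0r addr0 mulr_ge0 ?expR_ge0.
  move=> t; rewrite mul0r addr0 mul1r; have [td|td] := leP (`|t - L * tau|) (d * L).
    have /andP[h _] := h1 _ _ ML1 td; apply: le_trans h _.
    by rewrite lerDl mulr_ge0 ?expR_ge0.
  apply: (@le_trans _ _ ((b - e) * expR (- (k' * L)) * gauss (L * tau) (2 * L / (c + e)) t)); last first.
    by rewrite lerDr.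
  rewrite -mulrA ler_wpM2l//.
  rewrite /gauss -expRD ler_expR.
  have td2 : (d * L) ^+ 2 <= (t - L * tau) ^+ 2.
    rewrite -[leRHS]real_normK ?num_real// ler_pXn2r ?nnegrE ?normr_ge0 ?mulr_ge0 ?ltW//.
  have -> : - (t - L * tau) ^+ 2 / (2 * (L / (c + e))) =
      - ((c + e) / (4 * L) * (t - L * tau) ^+ 2) + - (t - L * tau) ^+ 2 / (2 * (2 * L / (c + e))).
    by field; rewrite !gt_eqF//; lra.
  rewrite lerD2r lerN2.
  have -> : k' * L = (c + e) / (4 * L) * (d * L) ^+ 2 by rewrite /k'; field; rewrite gt_eqF.
  by rewrite ler_wpM2l// divr_ge0 ?mulr_ge0 ?ltW//; lra.
have small1 := near_expRN_le (C / dd) k0 eps2.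
have small2 := near_expRN_le C' k'0 eps2.
near=> L.
have L1 : 1 <= L by near: L; apply: nbhs_pinfty_ge; exact: num_real.
have ML1 : M1 <= L by near: L; apply: nbhs_pinfty_ge; exact: num_real.
have ML2 : M2 <= L by near: L; apply: nbhs_pinfty_ge; exact: num_real.
have L0 : 0 < L by lra.
have sL : 1 <= Num.sqrt L by rewrite -sqrtr1 ler_sqrt.
have sL0 : 0 < Num.sqrt L by lra.
have s1 : C / dd * expR (- (k * L)) <= eps / 2 by near: L.
have s2 : C' * expR (- (k' * L)) <= eps / 2 by near: L.
rewrite ler_distlC; apply/andP; split.
  rewrite ler_pdivlMr//; have := lower L ML1 L0; nra.
rewrite ler_pdivrMr//; have := upper L ML1 ML2 L0; nra.
Unshelve. all: by end_near. Qed.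

End laplace.

Section weight_cdf.
Context {R : realType}.
Local Notation leb := (@lebesgue_measure R).
Variable s : R.
Hypothesis s0 : 0 < s.
Let p := s^-1.
Let p0 : 0 < p. Proof. by rewrite invr_gt0. Qed.

Lemma powRN_anti (a u v : R) : 0 <= a -> 0 < u -> u <= v -> v `^ (- a) <= u `^ (- a).
Proof.
move=> a0 u0 uv; have v0 : 0 < v by lra.
rewrite !powRN lef_pV2 ?posrE ?powR_gt0//.
by apply: ge0_ler_powR; rewrite ?nnegrE// ltW.
Qed.

Lemma powRN_le_swap (t x : R) : 0 < t -> 0 < x ->
  (t `^ (- s) <= x) = (x `^ (- p) <= t).
Proof.
move=> t0 x0; apply/idP/idP => h.
  by rewrite -[leRHS](@powRNV_K _ s) ?(gt_eqF s0) ?(ltW t0)// powRN_anti ?powR_gt0 ?(ltW p0).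
by rewrite -[leRHS](@powRNVV_K _ s) ?(gt_eqF s0) ?(ltW x0)// powRN_anti ?powR_gt0 ?(ltW s0).
Qed.

(** Homogeneity: weights scale like x and energies like x^-p, so the effect of one more edge is
    governed by a function of the single variable t / L. *)
Lemma rate_scale (K x t : R) : 0 < x -> 0 < t -> 0 < x - t `^ (- s) ->
  let L := x `^ (- p) in
  [/\ 0 < L, 1 < t / L, (x - t `^ (- s)) `^ (- p) = L * (1 - (t / L) `^ (- s)) `^ (- p) &
    K `^ (1 + p) * (x - t `^ (- s)) `^ (- p) + t = L * rate s K (t / L)].
Proof.
move=> x0 t0; rewrite subr_gt0 => xt L.
have L0 : 0 < L by rewrite powR_gt0.
have LK : L `^ (- s) = x by rewrite /L powRNVV_K ?gt_eqF// ltW.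
have tL : 1 < t / L.
  rewrite ltr_pdivlMr// mul1r ltNge; apply/negP => h.
  by have := powRN_anti (ltW s0) t0 h; rewrite LK leNgt xt.
have e : x - t `^ (- s) = x * (1 - (t / L) `^ (- s)).
  rewrite [(t / L) `^ _]powRM ?invr_ge0 ?ltW// -[L^-1]powR_inv1 ?ltW// -powRrM mulN1r opprK.
  have -> : L `^ s = x^-1 by rewrite -LK -powRN opprK.
  by field; rewrite gt_eqF.
have /andP[u0 _] := powRN_lt1 tL s0.
have e2 : (x - t `^ (- s)) `^ (- p) = L * (1 - (t / L) `^ (- s)) `^ (- p).
  by rewrite e powRM ?ltW.
split=> //; rewrite e2 /rate -/p mulrDr [L * (_ / _)]mulrC divfK ?gt_eqF//.
by ring.
Qed.

Lemma rate_scale_ge (K x t : R) : 0 < K -> 0 < x -> 0 < t -> 0 < x - t `^ (- s) ->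
  (K + 1) `^ (1 + p) * x `^ (- p) <= K `^ (1 + p) * (x - t `^ (- s)) `^ (- p) + t.
Proof.
move=> K0 x0 t0 xt; have [L0 tL _ ->] := rate_scale K x0 t0 xt.
by rewrite [leLHS]mulrC ler_wpM2l ?(ltW L0)// rate_ge.
Qed.

(* The distribution function of E_1^-s + ... + E_k^-s, conditioning on the last
   summand. *)
Fixpoint wcdf (k : nat) (x : R) : R :=
  if k is k'.+1 then fine (\int[leb]_t (wcdf k' (x - t `^ (- s)) * edens 1 t)%:E)%E
  else (0 <= x)%R%:R.

Lemma measurable_wcdf_int (F : R -> R) x : nondecreasing_fun F ->
  measurable_fun [set: R] (fun t => F (x - t `^ (- s)) * edens 1 t).
Proof.
move=> ndF; apply: measurable_funM; last exact: measurable_edens.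
apply: (@measurableT_comp _ _ _ _ _ _ F).
  exact: nondecreasing_measurable.
by apply: measurable_funB => //; exact: (measurable_powR _).
Qed.

Lemma wcdf_int_fin (F : R -> R) x : nondecreasing_fun F ->
  (forall y, 0 <= F y <= 1) ->
  (0 <= \int[leb]_t (F (x - t `^ (- s)) * edens 1 t)%:E <= 1)%E.
Proof.
move=> ndF F01; apply/andP; split.
  apply: integral_ge0 => t _; rewrite lee_fin mulr_ge0 ?edens_ge0//.
  by have /andP[] := F01 (x - t `^ (- s)).
have -> : 1%E = (1^-1 : R)%:E by rewrite invr1.
rewrite -integral_edens//; apply: le_integral_EFin.
- exact: measurable_wcdf_int.
- exact: measurable_edens.
- move=> t; rewrite mulr_ge0 ?edens_ge0//.
  by have /andP[] := F01 (x - t `^ (- s)).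
- move=> t; rewrite ler_piMl ?edens_ge0//.
  by have /andP[] := F01 (x - t `^ (- s)).
Qed.

Lemma wcdf_basic k : nondecreasing_fun (wcdf k) /\ forall x, 0 <= wcdf k x <= 1.
Proof.
elim: k => [|k [nd b]] /=.
  split=> [x y xy|x].
    by rewrite ler_nat; case: (leP 0 x) => // x0; rewrite (le_trans x0).
  by case: (0 <= x); rewrite /= ?ler01 ?lexx.
have fi x := wcdf_int_fin x nd b.
split=> [x y xy|x].
  have /andP[h1 h2] := fi x; have /andP[h3 h4] := fi y.
  apply: fine_le.
  - by rewrite ge0_fin_numE// (le_lt_trans h2)// ltry.
  - by rewrite ge0_fin_numE// (le_lt_trans h4)// ltry.
  apply: le_integral_EFin; try exact: measurable_wcdf_int.
    by move=> t; rewrite mulr_ge0 ?edens_ge0//; have /andP[] := b (x - t `^ (- s)).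
  by move=> t; rewrite ler_wpM2r ?edens_ge0// nd// lerB.
have /andP[h1 h2] := fi x.
by rewrite fine_ge0//= -lee_fin fineK// ge0_fin_numE// (le_lt_trans h2)// ltry.
Qed.

Lemma nondecreasing_wcdf k : nondecreasing_fun (wcdf k).
Proof. by have [] := wcdf_basic k. Qed.

Lemma wcdf_ge0 k x : 0 <= wcdf k x.
Proof. by have [_ /(_ x) /andP[]] := wcdf_basic k. Qed.

Lemma wcdfS k x :
  (\int[leb]_t (wcdf k (x - t `^ (- s)) * edens 1 t)%:E = (wcdf k.+1 x)%:E)%E.
Proof.
have [nd b] := wcdf_basic k.
have /andP[h1 h2] := wcdf_int_fin x nd b.
by rewrite /= fineK// ge0_fin_numE// (le_lt_trans h2)// ltry.
Qed.

Lemma wcdf_le0 k x : (0 < k)%N -> x <= 0 -> wcdf k x = 0.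
Proof.
elim: k x => // k IH x _ x0 /=.
under eq_integral => t _.
  rewrite (_ : wcdf k _ * _ = 0); last first.
    have [t0|t0] := leP t 0; first by rewrite /edens ltNge t0 mulr0 mulr0.
    have y0 : x - t `^ (- s) < 0 by have := powR_gt0 (- s) t0; lra.
    case: k IH => [|k] IH; first by rewrite /= leNgt y0 mul0r.
    by rewrite IH ?mul0r// ltW.
  over.
by rewrite integral0.
Qed.

Lemma integral_expR_tail (a : R) :
  (\int[leb]_(t in `[a, +oo[) (expR (- t))%:E = (expR (- a))%:E)%E.
Proof.
have cont : continuous (fun t : R => expR (- t)).
  move=> t; apply: continuous_comp; last exact: continuous_expR.
  exact: continuousN.
rewrite (@ge0_continuous_FTC2y _ _ (fun x => - expR (- x)) _ 0).
- by rewrite -EFinB sub0r opprK.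
- by move=> x _; exact: expR_ge0.
- by apply: continuous_subspaceT => x; exact: cont.
- by rewrite -oppr0; apply: cvgN; exact: cvgr_expR.
- by move=> x _; apply: ex_derive.
- by apply: cvg_at_right_filter; apply: cvgN; exact: cont.
- move=> x _; rewrite derive1E; have h : is_derive x 1 (fun y : R => - expR (- y)) (expR (- x)).
    by apply: is_derive_eq; rewrite /GRing.scale/=; ring.
  exact: derive_val.
Qed.

Lemma wcdf1 x : 0 < x -> wcdf 1 x = expR (- (x `^ (- p))).
Proof.
move=> x0 /=.
rewrite -[RHS]/(fine (expR (- (x `^ (- p))))%:E) -integral_expR_tail.
congr fine; rewrite [RHS]integral_mkcond; apply: eq_integral => t _.
rewrite patchE mem_setE in_itv/= andbT subr_ge0 /edens mul1r.
have xp : 0 < x `^ (- p) by rewrite powR_gt0.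
have [t0|t0] := leP t 0.
  by rewrite !mulr0 leNgt (le_lt_trans t0).
rewrite mulr1.
rewrite powRN_le_swap// -/p.
by case: ifP; rewrite ?mul1r ?mul0r.
Qed.

(** Of the factor exp(-t) of the new edge, exp(-(1-d) t) completes the energy of k edges to that of
    k+1 edges by [rate_scale_ge]; the rest, exp(-d t), integrates to d^-1. The bound is uniform in k
    and x, as needed away from the Laplace window and for the sum over all lengths. *)
Lemma wcdf_chernoff k d x : (0 < k)%N -> 0 < d < 1 -> 0 < x ->
  wcdf k x <= d ^- k * expR (- ((1 - d) * (k%:R `^ (1 + p) * x `^ (- p)))).
Proof.
move=> k0 /andP[d0 d1]; elim: k k0 x => // -[_|k IH] _ x x0.
  rewrite wcdf1// powR1 mul1r expr1.
  apply: (@le_trans _ _ (expR (- ((1 - d) * x `^ (- p))))).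
    by rewrite ler_expR lerN2 ler_piMl ?powR_ge0//; lra.
  by rewrite ler_peMl ?expR_ge0// invf_ge1// ltW.
have ndk := @nondecreasing_wcdf k.+1.
pose c := d ^- k.+1 * expR (- ((1 - d) * (k.+2%:R `^ (1 + p) * x `^ (- p)))).
have c0 : 0 <= c by rewrite mulr_ge0 ?expR_ge0// invr_ge0 exprn_ge0// ltW.
have -> : d ^- k.+2 * expR (- ((1 - d) * (k.+2%:R `^ (1 + p) * x `^ (- p)))) = c * d^-1 + 0 * d^-1.
  by rewrite /c exprS invfM; ring.
rewrite -lee_fin -wcdfS.
rewrite -(integral_lincomb (measurable_edens d) (measurable_edens d) (edens_ge0 d)
  (edens_ge0 d) c0 (lexx 0) (integral_edens d0) (integral_edens d0)).
apply: le_integral_EFin.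
- exact: measurable_wcdf_int.
- by apply: measurable_funD; apply: measurable_funM => //; exact: measurable_edens.
- by move=> t; rewrite mulr_ge0 ?wcdf_ge0 ?edens_ge0.
move=> t; rewrite mul0r addr0 /edens mul1r.
have [t0|t0] := leP t 0; first by rewrite !mulr0.
rewrite !mulr1; have [y0|y0] := leP (x - t `^ (- s)) 0.
  by rewrite wcdf_le0// mul0r mulr_ge0 ?expR_ge0.
apply: le_trans (ler_wpM2r (expR_ge0 _) (IH _ _ y0)) _ => //.
rewrite /c -!mulrA ler_wpM2l ?invr_ge0 ?exprn_ge0 ?(ltW d0)//.
rewrite -!expRD ler_expR.
have h : k.+2%:R `^ (1 + p) * x `^ (- p) <=
    k.+1%:R `^ (1 + p) * (x - t `^ (- s)) `^ (- p) + t.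
  by rewrite -[k.+2%:R]natr1; apply: rate_scale_ge => //; rewrite ltr0n.
by nra.
Qed.

(** The quotient of [wcdf] by its predicted order exp(- k^(1+p) L) L^((k-1)/2), in the variable L =
    x^-p, which is large when x is small. *)
Definition wcdf_norm k (L : R) :=
  wcdf k (L `^ (- s)) * expR (k%:R `^ (1 + p) * L) * L `^ (- ((k%:R - 1) / 2)).

Lemma powR_unscale (a x z : R) : 0 < x -> 0 <= z ->
  z `^ a = (x * z) `^ a * x `^ (- a).
Proof.
by move=> x0 z0; rewrite powRM ?(ltW x0)// mulrAC -powRDp// subrr powRr0 mul1r.
Qed.

(** This puts the recursion for [wcdf] in Laplace form: a factor that tends to a_k by induction, a
    continuous prefactor in t / L, and the exponential of - L times a phase. *)
Lemma wcdf_integrandE k (L t h : R) : 0 < L -> 1 < t / L ->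
  let psi := (1 - (t / L) `^ (- s)) `^ (- p) in
  wcdf k (L `^ (- s) - t `^ (- s)) * edens 1 t *
    (expR (h * L) * L `^ (- ((k%:R - 1) / 2))) =
  wcdf_norm k (L * psi) * psi `^ ((k%:R - 1) / 2) *
    expR (- (L * (rate s k%:R (t / L) - h))).
Proof.
move=> L0 tL psi; have t0 : 0 < t by rewrite ltr_pdivlMr// in tL; lra.
have Ls0 : 0 < L `^ (- s) by rewrite powR_gt0.
have y0 : 0 < L `^ (- s) - t `^ (- s).
  rewrite subr_gt0 ltNge powRN_le_swap ?powR_gt0// powRNV_K ?(gt_eqF s0) ?(ltW t0)//.
  by rewrite -ltNge; rewrite ltr_pdivlMr// mul1r in tL.
have := rate_scale k%:R Ls0 t0 y0; rewrite /= powRNV_K ?(gt_eqF s0) ?(ltW L0)//.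
move=> [_ _ yE E]; rewrite -/psi in yE.
set y := L `^ (- s) - t `^ (- s) in y0 yE E *.
have WN : wcdf_norm k (L * psi) = wcdf k y * expR (k%:R `^ (1 + p) * y `^ (- p)) *
    (L * psi) `^ (- ((k%:R - 1) / 2)).
  by rewrite /wcdf_norm -yE (@powRNVV_K _ s y) ?(gt_eqF s0) ?(ltW y0).
have rE : expR (- (L * (rate s k%:R (t / L) - h))) =
    (expR (k%:R `^ (1 + p) * y `^ (- p)))^-1 * expR (- t) * expR (h * L).
  by rewrite [L * _]mulrBr -E -expRN -!expRD; congr expR; ring.
have psi0 : 0 <= psi by exact: powR_ge0.
have Lpsi0 : 0 < L * psi by rewrite -yE powR_gt0.
have eE : edens 1 t = expR (- t) by rewrite /edens t0 mul1r mulr1.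
rewrite WN rE eE (powR_unscale _ L0 psi0) (powRN (L * psi)).
have := expR_gt0 (k%:R `^ (1 + p) * y `^ (- p)).
have : 0 < (L * psi) `^ ((k%:R - 1) / 2) by rewrite !powR_gt0.
clear; move: (wcdf k y) (expR (- t)) (expR (h * L)) (expR _) (L `^ _) ((L * psi) `^ _).
by move=> a b c d e f d0 f0; field; rewrite !gt_eqF.
Qed.

Lemma gauss_sandwich (L t tau c e b A r : R) :
  0 < L -> 0 < c + e -> 0 < c - e -> 0 < b - e ->
  `|A - b| <= e ->
  `|r - c / 2 * (t / L - tau) ^+ 2| <= e / 2 * (t / L - tau) ^+ 2 ->
  (b - e) * gauss (L * tau) (L / (c + e)) t <= A * expR (- (L * r)) <=
  (b + e) * gauss (L * tau) (L / (c - e)) t.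
Proof.
move=> L0 ce ce' be; rewrite ler_norml => /andP[b1 b2].
have -> : t / L - tau = (t - L * tau) / L by field; rewrite gt_eqF.
rewrite ler_norml => /andP[q1 q2]; rewrite /gauss; apply/andP; split.
  apply: ler_pM; rewrite ?expR_ge0//; [lra|lra|rewrite ler_expR].
  have -> : - (t - L * tau) ^+ 2 / (2 * (L / (c + e))) =
     - (L * ((c + e) / 2 * ((t - L * tau) / L) ^+ 2)).
    by field; rewrite !gt_eqF.
  by rewrite lerN2 ler_wpM2l ?(ltW L0)//; lra.
apply: ler_pM; rewrite ?expR_ge0//; [lra|lra|rewrite ler_expR].
have -> : - (t - L * tau) ^+ 2 / (2 * (L / (c - e))) =
   - (L * ((c - e) / 2 * ((t - L * tau) / L) ^+ 2)).
  by field; rewrite !gt_eqF.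
by rewrite lerN2 ler_wpM2l ?(ltW L0)//; lra.
Qed.

Lemma a_1 : a_ s 1 = 1 :> R.
Proof. by rewrite /a_ subrr !mul0r powRr0 powR1 mulr1. Qed.

Lemma a_gt0 k : (0 < k)%N -> 0 < a_ s k.
Proof.
move=> k0; rewrite /a_ -/p mulr_gt0 ?powR_gt0 ?ltr0n// divr_gt0 ?mulr_gt0 ?pi_gt0//.
by have := p0; lra.
Qed.

(** The factors are those of Laplace's method: the previous constant, the prefactor at the minimizer
    and the Gaussian integral. In the product the powers of K cancel. *)
Lemma a_S (k : nat) : (0 < k)%N ->
  a_ s k * ((1 - rate_pt s k%:R `^ (- s)) `^ (- p)) `^ ((k%:R - 1) / 2) *
  Num.sqrt (2 * pi / rate_curv s k%:R) = a_ s k.+1.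
Proof.
move=> k0; pose K : R := k%:R; have K0 : 0 < K by rewrite ltr0n.
have K1 : 0 < K + 1 by lra.
pose A := 2 * pi * p / (1 + p).
have A0 : 0 < A by rewrite divr_gt0 ?mulr_gt0 ?pi_gt0//; have := p0; lra.
rewrite /a_ -[k.+1%:R]natr1 -/p -/K -/A addrK.
have -> : 1 - rate_pt s K `^ (- s) = K / (K + 1).
  by rewrite powRN rate_ptE//; field; rewrite gt_eqF.
have -> : 2 * pi / rate_curv s K = A * (K * (K + 1) `^ (p - 1)).
  rewrite /rate_curv -/p -(opprB 1 p) powRN /A /p; field.
  by rewrite !gt_eqF ?powR_gt0//; have := s0; lra.
clearbody A K; rewrite -powR12_sqrt; last by rewrite !mulr_ge0 ?powR_ge0 ?(ltW K0) ?(ltW A0).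
rewrite -powRrM powRM ?invr_ge0 ?(ltW K0) ?(ltW K1)//.
rewrite -[(K + 1)^-1]powR_inv1 ?(ltW K1)// -powRrM.
rewrite powRM ?mulr_ge0 ?powR_ge0 ?(ltW K0) ?(ltW A0)//.
rewrite powRM ?powR_ge0 ?(ltW K0)// -powRrM.
transitivity ((A `^ ((K - 1) / 2) * A `^ 2^-1) *
  (K `^ (((K - 1) * p - 1) / 2) * K `^ (- p * ((K - 1) / 2)) * K `^ 2^-1) *
  ((K + 1) `^ (-1 * (- p * ((K - 1) / 2))) * (K + 1) `^ ((p - 1) / 2))); first by ring.
rewrite -!powRDp//.
have -> : ((K - 1) * p - 1) / 2 + - p * ((K - 1) / 2) + 2^-1 = 0 by field.
rewrite powRr0 mulr1; congr (_ `^ _ * _ `^ _); by field.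
Qed.

Lemma wcdf_asymptotic k : (0 < k)%N -> wcdf_norm k L @[L --> +oo] --> a_ s k.
Proof.
elim: k => // -[_ _|k IH _].
  rewrite a_1; apply: cvg_near_cst; near=> L.
  have L0 : 0 < L by near: L; apply: nbhs_pinfty_gt; exact: num_real.
  rewrite /wcdf_norm wcdf1 ?powR_gt0// powRNV_K ?gt_eqF ?ltW//.
  by rewrite powR1 mul1r subrr mul0r oppr0 powRr0 mulr1 -expRD addNr expR0.
have {}IH := IH isT.
set m := k.+1 in IH *; have m0 : (0 < m)%N by []; clearbody m.
pose K : R := m%:R; have K0 : 0 < K by rewrite ltr0n.
pose h0 := (K + 1) `^ (1 + p); pose tau := rate_pt s K; pose c := rate_curv s K.
pose psi t := (1 - t `^ (- s)) `^ (- p).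
pose q t := psi t `^ ((K - 1) / 2).
pose b := a_ s m * q tau.
have tau1 : 1 < tau by exact: rate_pt_gt1.
have c0 : 0 < c by exact: rate_curv_gt0.
have a0 : 0 < a_ s m by exact: a_gt0.
have psi1 t : 1 < t -> 1 <= psi t.
  move=> t1; have /andP[u0 u1] := powRN_lt1 t1 s0.
  have := powRN_anti (ltW p0) u0 (ltW u1); by rewrite powR1.
have q1 t : 1 < t -> 0 < q t by move=> /psi1 ?; rewrite powR_gt0//; lra.
have b0 : 0 < b by rewrite mulr_gt0 ?q1.
have qc : {for tau, continuous q}.
  have /andP[u0 _] := powRN_lt1 tau1 s0.
  apply: (@continuous_comp _ _ _ psi (fun x => x `^ ((K - 1) / 2))).
    apply: (@continuous_comp _ _ _ (fun t => 1 - t `^ (- s)) (fun x => x `^ (- p))).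
      apply: continuousB; first exact: cst_continuous.
      by apply: continuous_powR; lra.
    exact: continuous_powR.
  by apply: continuous_powR; have := psi1 _ tau1; lra.
pose f L t := wcdf m (L `^ (- s) - t `^ (- s)) * edens 1 t *
  (expR (h0 * L) * L `^ (- ((K - 1) / 2))).
pose J L := wcdf m.+1 (L `^ (- s)) * (expR (h0 * L) * L `^ (- ((K - 1) / 2))).
have cc0 L : 0 <= expR (h0 * L) * L `^ (- ((K - 1) / 2)) by rewrite mulr_ge0 ?expR_ge0 ?powR_ge0.
have K1 : m.+1%:R = K + 1 by rewrite /K natr1.
(* The Gaussian has width of order sqrt L, which raises the power L^((K-1)/2) to the L^(K/2) that
   belongs to one more edge. *)
suff : J L / Num.sqrt L @[L --> +oo] --> b * Num.sqrt (2 * pi / c).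
  rewrite /b /q /psi /tau /c a_S//; apply: cvg_trans.
  apply: near_eq_cvg; near=> L.
  have L0 : 0 < L by near: L; apply: nbhs_pinfty_gt; exact: num_real.
  rewrite /wcdf_norm /J K1 -/h0 -powR12_sqrt ?(ltW L0)// -powRN.
  rewrite -!mulrA; congr (_ * (_ * _)); rewrite -powRDp//; congr (_ `^ _).
  by field.
apply: (@laplace _ f J tau c b) => //.
- by move=> L t; apply: mulr_ge0 => //; rewrite mulr_ge0 ?wcdf_ge0 ?edens_ge0.
- move=> L; apply: measurable_funM => //.
  by apply: measurable_wcdf_int; exact: nondecreasing_wcdf.
- move=> L L0; rewrite /f /J EFinM -wcdfS.
  under eq_integral do rewrite EFinM muleC.
  rewrite ge0_integralZl//; first by rewrite muleC.
  + apply/measurable_EFinP; apply: measurable_wcdf_int; exact: nondecreasing_wcdf.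
  + by move=> t _; rewrite lee_fin mulr_ge0 ?wcdf_ge0 ?edens_ge0.
  + by rewrite lee_fin.
- move=> e e0 eb ec.
  have ce : 0 < c + e by rewrite addr_gt0.
  have ce' : 0 < c - e by rewrite subr_gt0.
  (* If r and u are within eta <= 1 of a_m and q tau, then r u is within eta (q tau + 1) + a_m eta =
     eta S of b. *)
  pose S := a_ s m + q tau + 1.
  have S0 : 0 < S by have := q1 _ tau1; rewrite /S; lra.
  pose eta := Num.min 1 (e / S).
  have eta0 : 0 < eta by rewrite lt_min ltr01 divr_gt0.
  have [eta1 etaS] : eta <= 1 /\ eta * S <= e.
    by rewrite -ler_pdivlMr// /eta !ge_min !lexx orbT.
  have prod r u : `|r - a_ s m| <= eta -> `|u - q tau| <= eta -> `|r * u - b| <= e.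
    move=> ra uq; have -> : r * u - b = (r - a_ s m) * u + a_ s m * (u - q tau).
      by rewrite /b; ring.
    apply: le_trans (ler_normD _ _) _; rewrite 2!normrM (gtr0_norm a0).
    have u1 : `|u| <= q tau + 1.
      have -> : u = (u - q tau) + q tau by ring.
      apply: le_trans (ler_normD _ _) _; rewrite (gtr0_norm (q1 _ tau1)); lra.
    have : `|r - a_ s m| * `|u| <= eta * (q tau + 1) by rewrite ler_pM.
    have : a_ s m * `|u - q tau| <= a_ s m * eta by rewrite ler_wpM2l// ltW.
    by move: etaS; rewrite /S; lra.
  have /cvgrPdist_le/(_ _ eta0)/nbhs_ballP[d1 /= d10 d1P] := qc.
  have e20 : 0 < e / 2 by lra.
  have [d2 d20 d2P] := rate_quad s0 K0 e20.
  have /cvgrPdist_le/(_ _ eta0)[M [_ MP]] := IH.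
  exists (Num.min (d1 / 2) d2); first by rewrite lt_min d20 divr_gt0.
  exists (Num.max 1 (M + 1)) => L t; rewrite ge_max => /andP[L1 LM].
  have L0 : 0 < L by lra.
  have -> : `|t - L * tau| = `|t / L - tau| * L.
    rewrite -[X in _ = _ * X](gtr0_norm L0) -normrM; congr `|_|.
    by field; rewrite gt_eqF.
  rewrite ler_pM2r// le_min => /andP[t1 t2].
  have [tL quad] := d2P _ t2.
  have t0 : 0 < t by rewrite ltr_pdivlMr// in tL; lra.
  have qt : `|q (t / L) - q tau| <= eta.
    rewrite distrC; apply: d1P; rewrite /ball/= distrC (le_lt_trans t1)//.
    by rewrite ltr_pdivrMr// ltr_pMr// ltr1n.
  pose y := L * psi (t / L).
  (* The induction hypothesis is needed at L psi, which depends on t; psi >= 1 makes it hold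
     uniformly in t once L is large. *)
  have L' : L <= y by rewrite ler_peMr ?(ltW L0)// psi1.
  have r1 : `|wcdf_norm m y - a_ s m| <= eta.
    by rewrite distrC; apply: MP; apply: lt_le_trans L'; apply: lt_le_trans LM; rewrite ltrDl.
  have {r1 qt}:= prod _ _ r1 qt.
  have -> : f L t = wcdf_norm m y * q (t / L) * expR (- (L * (rate s K (t / L) - h0))).
    exact: wcdf_integrandE.
  move=> Ab; apply: gauss_sandwich => //.
  by rewrite subr_gt0.
- move=> d d0.
  have [e e0 far] := rate_far s0 K0 d0.
  have h00 : 0 < h0 by rewrite powR_gt0//; lra.
  (* The Chernoff bound loses a fraction de of the energy; this choice makes the loss exactly half
     of the gap e. *)
  pose de := e / (2 * (h0 + e)).
  have de0 : 0 < de by rewrite divr_gt0//; lra.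
  have de1 : de < 1 by rewrite ltr_pdivrMr//; lra.
  have deE : (1 - de) * (h0 + e) = h0 + e / 2 by rewrite /de; field; lra.
  clearbody de.
  exists (de ^- m), (e / 2), de, 1; split => //.
  + by rewrite invr_ge0 exprn_ge0// ltW.
  + by lra.
  move=> L t L1 Lt; have L0 : 0 < L by lra.
  rewrite /f /edens mul1r; have [t0|t0] := leP t 0.
    by rewrite !(mulr0, mul0r).
  rewrite !mulr1.
  have K11 : 1 <= K by rewrite ler1n.
  have Lp1 : L `^ (- ((K - 1) / 2)) <= 1.
    have := @powRN_anti ((K - 1) / 2) 1 L; rewrite powR1; apply => //; lra.
  have [y0|y0] := leP (L `^ (- s) - t `^ (- s)) 0.
    by rewrite wcdf_le0// !mul0r !mulr_ge0 ?expR_ge0// invr_ge0 exprn_ge0// ltW.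
  have Ls0 : 0 < L `^ (- s) by rewrite powR_gt0.
  have := rate_scale K Ls0 t0 y0; rewrite /= powRNV_K ?(gt_eqF s0) ?(ltW L0)//.
  move=> [_ tL _ E].
  have {}far := far (t / L) tL.
  have {far}: h0 + e <= rate s K (t / L).
    apply: far; rewrite -(ler_pM2r L0); apply: le_trans (ltW Lt) _.
    rewrite -/tau -[X in _ <= _ * X](gtr0_norm L0) -normrM mulrBl divfK ?gt_eqF//.
    by rewrite (mulrC L).
  rewrite -(ler_pM2l L0) -E => far.
  have de01 : 0 < de < 1 by rewrite de0.
  have W := wcdf_chernoff m0 de01 y0.
  apply: (@le_trans _ _ (de ^- m *
      expR (- ((1 - de) * (m%:R `^ (1 + p) * (L `^ (- s) - t `^ (- s)) `^ (- p)))) *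
      expR (- t) * expR (h0 * L))).
    rewrite mulrA -[leRHS]mulr1 ler_pM ?powR_ge0 ?mulr_ge0 ?wcdf_ge0 ?expR_ge0//.
    by rewrite ler_wpM2r ?expR_ge0// ler_wpM2r ?expR_ge0.
  rewrite -!mulrA ler_wpM2l ?invr_ge0 ?exprn_ge0 ?(ltW de0)//.
  rewrite -!expRD ler_expR -/K.
  have : (1 - de) * (L * (h0 + e)) = L * (h0 + e / 2) by rewrite -deE; ring.
  have : (1 - de) * (L * (h0 + e)) <=
      (1 - de) * (K `^ (1 + s^-1) * (L `^ (- s) - t `^ (- s)) `^ (- s^-1) + t).
    by rewrite ler_wpM2l//; lra.
  rewrite -/p; lra.
Unshelve. all: by end_near. Qed.

End weight_cdf.

(** * Independent families *)

Section block_independence.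
Context {R : realType} d (T : measurableType d) (P : probability T R).
Context (I : choiceType) (D : {pred I}) (X : I -> {RV P >-> R}).
Hypothesis indep : mutually_independent D X.
Implicit Types l : seq I.

(** These cylinders form a pi-system containing the whole space, and they generate the sigma-algebra
    of the variables indexed by l. *)
Definition rect l : set (set T) := [set A | exists2 B : I -> set R,
  (forall i, measurable (B i)) & A = \bigcap_(i in [set` l]) X i @^-1` B i].

Lemma rect_measurable l : rect l `<=` measurable.
Proof.
move=> _ [B mB ->]; apply: fin_bigcap_measurable => [|i _]; first exact: finite_seq.
by rewrite -[X in measurable X]setTI; exact: (measurable_funPT (X i)).
Qed.

Lemma rect_setI l : setI_closed (rect l).
Proof.
move=> _ _ [B mB ->] [B' mB' ->].
exists (fun i => B i `&` B' i) => [i|]; first exact: measurableI.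
by rewrite -bigcapI; apply: eq_bigcapr => i _; rewrite preimage_setI.
Qed.

Lemma rectT l : rect l setT.
Proof.
by exists (fun=> setT) => //; apply/esym/seteqP; split=> // w _ i _.
Qed.

Lemma rect_preimage l i (B : set R) : i \in l -> measurable B ->
  rect l (X i @^-1` B).
Proof.
move=> il mB; exists (fun j => if j == i then B else setT) => [j|].
  by case: ifP.
apply/seteqP; split=> [w /= wB j jl|w /= /(_ i il)]; last by rewrite eqxx.
by case: eqP => // ->.
Qed.

Definition gen l := g_sigma_algebraType (rect l).

Lemma measurable_gen_X l i : i \in l ->
  measurable_fun [set: gen l] (X i : gen l -> R).
Proof.
move=> il _ B mB; rewrite setTI; apply: sub_sigma_algebra.
exact: rect_preimage.
Qed.

Lemma gen_measurable l : <<s rect l >> `<=` measurable.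
Proof. by apply: smallest_sub; [exact: sigma_algebra_measurable|exact: rect_measurable]. Qed.

Lemma prob_rect l (B : I -> set R) : uniq l -> {subset l <= D} ->
  (forall i, measurable (B i)) ->
  (P (\bigcap_(i in [set` l]) X i @^-1` B i) = \prod_(i <- l) P (X i @^-1` B i))%E.
Proof.
move=> ul lD mB.
have -> : [set` l] = [set` [fset x in l]%fset].
  by apply/seteqP; split=> i /=; rewrite inE.
rewrite indep//; last by move=> i; rewrite inE => /lD.
apply: perm_big; apply: uniq_perm => // i.
by rewrite inE.
Qed.

Lemma rect_indep l1 l2 A B : uniq (l1 ++ l2) -> {subset l1 ++ l2 <= D} ->
  rect l1 A -> rect l2 B -> P (A `&` B) = (P A * P B)%E.
Proof.
move=> ul lD [A' mA ->] [B' mB ->].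
pose C i := if i \in l1 then A' i else B' i.
have mC i : measurable (C i) by rewrite /C; case: ifP.
have := prob_rect ul lD mC; rewrite big_cat/=.
move: ul; rewrite cat_uniq => /and3P[u1 /hasPn l12 u2].
rewrite -[X in (X * _)%E]prob_rect// -?[X in (_ * X)%E]prob_rect//; last first.
- by move=> i il; apply: lD; rewrite mem_cat il ?orbT.
- by move=> i il; apply: lD; rewrite mem_cat il ?orbT.
have -> : \bigcap_(i in [set` l1]) X i @^-1` C i = \bigcap_(i in [set` l1]) X i @^-1` A' i.
  by apply: eq_bigcapr => i /= il; rewrite /C il.
have -> : \bigcap_(i in [set` l2]) X i @^-1` C i = \bigcap_(i in [set` l2]) X i @^-1` B' i.
  by apply: eq_bigcapr => i /= il; rewrite /C; have /negbTE -> := l12 i il.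
move=> <-; congr (P _); apply/seteqP; split => [w [h1 h2] i|w h].
  rewrite /= mem_cat /C => /orP[il|il]; first by rewrite il; exact: h1.
  by have /negbTE -> := l12 i il; exact: h2.
split=> i /= il.
  by have := h i; rewrite /= mem_cat il /C il; apply.
by have := h i; rewrite /= mem_cat il orbT /C (negbTE (l12 i il)); apply.
Qed.

(** Uniqueness of measures on a pi-system, applied twice: E -> P(E and C) and E -> P(E) P(C) agree
    on the cylinders of one block, first with C a cylinder of the other block and then with C any
    event that it generates. *)
Lemma block_indep l1 l2 A B : uniq (l1 ++ l2) -> {subset l1 ++ l2 <= D} ->
  <<s rect l1 >> A -> <<s rect l2 >> B -> P (A `&` B) = (P A * P B)%E.
Proof.
move=> ul lD.
have pr_fin C : measurable C -> P C \is a fin_num by exact: fin_num_measure.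
have ext l C (C0 : measurable C) :
    (forall E, rect l E -> P (E `&` C) = (P E * P C)%E) ->
    forall E, <<s rect l >> E -> P (E `&` C) = (P E * P C)%E.
  move=> h E lE.
  have r0 : 0 <= fine (P C) by rewrite fine_ge0.
  have := @g_sigma_algebra_measure_unique _ R T (rect l) (@rect_measurable l)
    (fun=> setT) (fun=> rectT l) _ (mrestr P C0) (mscale (NngNum r0) P) (@rect_setI l) _ _ E lE.
  have mS F : mscale (NngNum r0) P F = (P F * P C)%E by rewrite /mscale/= fineK ?pr_fin// muleC.
  move=> H; apply: etrans (H _ _ _) (mS E).
  - by apply: bigcup_const; exists 0%N.
  - by move=> F lF; apply: etrans (esym (mS F)); exact: h.
  - by move=> _; apply: (@le_lt_trans _ _ 1%E); [apply: probability_le1; exact: measurableI|exact: ltry].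
move=> l1A l2B.
have mB := gen_measurable l2B.
apply: (ext l1 B) => // E l1E.
have mE := rect_measurable l1E.
rewrite setIC muleC; apply: (ext l2 E) => // F l2F.
by rewrite setIC muleC; exact: (rect_indep ul lD).
Qed.

End block_independence.

(** * Sums over independent exponential variables *)

Section exponential_sums.
Context {R : realType} d (T : measurableType d) (P : probability T R).
Context (I : choiceType) (D : {pred I}) (X : I -> {RV P >-> R}).
Hypothesis indep : mutually_independent D X.
Hypothesis expX : forall i, i \in D -> exponentially_distributed 1 (X i).
Local Notation leb := (@lebesgue_measure R).
Implicit Types l : seq I.

Lemma measurable_sumX l (h : R -> R) : measurable_fun [set: R] h ->
  measurable_fun [set: T] (fun w => \sum_(i <- l) h (X i w)).
Proof. by move=> mh; apply: measurable_sum => i; exact: measurableT_comp. Qed.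

Lemma gen_sumX l l' (h : R -> R) (B : set R) : measurable_fun [set: R] h ->
  {subset l <= l'} -> measurable B ->
  <<s rect X l' >> [set w | B (\sum_(i <- l) h (X i w))].
Proof.
move=> mh ll' mB.
have m : measurable_fun [set: gen X l'] (fun w : gen X l' => \sum_(i <- l) h (X i w)).
  elim: l ll' => [|i l IH] ll'.
    by under eq_fun do rewrite big_nil; exact: measurable_cst.
  under eq_fun do rewrite big_cons; apply: measurable_funD.
    apply: measurableT_comp => //; apply: measurable_gen_X; apply: ll'.
    by rewrite inE eqxx.
  by apply: IH => j jl; apply: ll'; rewrite inE jl orbT.
have := m measurableT B mB; rewrite setTI; exact.
Qed.

(** By block independence the pair of X i and the sum over l has a product law, so one may condition
    on X i. Both the exact distribution of the weight and the tail bound for the energy are obtained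
    from this by induction on l. *)
Lemma prob_conv (i : I) l (h : R -> R) (Q : set (R * R)) :
  measurable_fun [set: R] h -> measurable Q ->
  uniq (i :: l) -> {subset i :: l <= D} ->
  (P [set w | Q (X i w, (\sum_(j <- l) h (X j w))%R)] =
   \int[leb]_t (P [set w | Q (t, (\sum_(j <- l) h (X j w))%R)] * (edens 1 t)%:E))%E.
Proof.
move=> mh mQ ul lD.
pose Y w := \sum_(j <- l) h (X j w).
have mY : measurable_fun [set: T] Y by exact: measurable_sumX.
pose Ym : {mfun T >-> R} := mfun_Sub (mem_set mY).
pose Z w := (X i w, Y w).
have mZ : measurable_fun [set: T] Z by apply: measurable_fun_pair.
pose Zm : {mfun T >-> (R * R)%type} := mfun_Sub (mem_set mZ).
pose lY : probability R R := distribution P Ym.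
pose lZ : probability (R * R)%type R := distribution P Zm.
pose ex : probability R R := distribution P (X i).
have iD : i \in D by apply: lD; rewrite inE eqxx.
have lZE A B : measurable A -> measurable B -> lZ (A `*` B) = (ex A * lY B)%E.
  move=> mA mB; rewrite /lZ /lY /distribution /pushforward/=.
  apply: (block_indep indep (l1 := [:: i]) (l2 := l)) => //.
    by apply: sub_sigma_algebra; apply: rect_preimage; rewrite ?inE.
  exact: (@gen_sumX l l h B mh (fun _ => id) mB).
have -> : P [set w | Q (X i w, Y w)] = lZ Q by [].
rewrite -(product_measure_unique lZE mQ).
(* The law of X i is given by its values on sets. It is therefore first evaluated on the sections of
   Q, where it becomes an integral against the density, and only then are the integrals
   exchanged. *)
have -> : (ex \x lY)%E Q = (ex \x^ lY)%E Q.
  by apply: product_measure_unique => // A B mA mB; apply: etrans (product_measure2E _ _ mA mB) _.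
pose f (z : R * R) := (exponential_pdf 1 z.1 * \1_Q z)%:E.
have mf : measurable_fun [set: R * R] f.
  apply/measurable_EFinP; apply: measurable_funM.
    by apply: measurableT_comp => //; exact: measurable_exponential_pdf.
  exact: measurable_indic.
have f0 z : (0 <= f z)%E by rewrite lee_fin mulr_ge0 ?exponential_pdf_ge0.
transitivity (\int[lY]_y \int[leb]_t f (t, y))%E.
  apply: eq_integral => y _ /=.
  rewrite [LHS]expX//; last exact: measurable_ysection.
  rewrite /exponential_prob integral_mkcond; apply: eq_integral => t _.
  rewrite patchE mem_ysection /f /= indicE.
  by case: ifPn => _; rewrite ?mulr1 ?mulr0.
rewrite -fubini_tonelli//.
pose F t := fine (lY (xsection Q t)).
have lYf t : lY (xsection Q t) = (F t)%:E.
  by rewrite /F fineK// fin_num_measure//; exact: measurable_xsection.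
have mF : measurable_fun [set: R] F.
  apply/measurable_EFinP; rewrite (_ : _ \o _ = lY \o xsection Q).
    exact: measurable_fun_xsection.
  by apply/funext => t /=; rewrite lYf.
transitivity (\int[leb]_t (F t * exponential_pdf 1 t)%:E)%E.
  apply: eq_integral => t _; rewrite EFinM -lYf muleC.
  under eq_integral do rewrite /f/= EFinM.
  rewrite ge0_integralZl//.
  - congr (_ * _)%E.
    exact: (congr1 (fun g => g t) (indic_fubini_tonelli_FE lY mQ)).
  - apply/measurable_EFinP.
    rewrite (_ : (fun x => _) = \1_(xsection Q t)); last first.
      by apply/funext => y; rewrite !indicE mem_xsection.
    by apply: measurable_indic; exact: measurable_xsection.
  - by rewrite lee_fin exponential_pdf_ge0.
rewrite -edens_ae_exponential//; last by move=> t; rewrite fine_ge0.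
apply: eq_integral => t _; rewrite EFinM -lYf; congr (_ * _)%E.
by congr (P _); apply/seteqP; split=> w /=; rewrite /xsection/= inE.
Qed.

Lemma sum_wcdf (s : R) l x : 0 < s -> uniq l -> {subset l <= D} ->
  (P [set w | (\sum_(j <- l) X j w `^ (- s) <= x)%R] = (wcdf s (size l) x)%:E)%E.
Proof.
move=> s0; elim: l x => [|i l IH] x.
  move=> _ _; rewrite (_ : [set w | _] = if 0 <= x then setT else set0).
    by rewrite /=; case: (0 <= x); rewrite ?probability_setT ?measure0.
  apply/seteqP; split=> w /=; first by rewrite big_nil => ->.
  by case: ifP => // x0 _; rewrite big_nil x0.
move=> ul lD; have [il ul'] : i \notin l /\ uniq l by apply/andP; rewrite -cons_uniq.
have lD' : {subset l <= D} by move=> j jl; apply: lD; rewrite inE jl orbT.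
pose Q := [set z : R * R | z.2 <= x - z.1 `^ (- s)].
have mQ : measurable Q.
  rewrite -[X in measurable X]setTI; apply: measurable_fun_le => //.
  apply: measurable_funB => //.
  by apply: (measurableT_comp (measurable_powR _)).
have -> : [set w | \sum_(j <- i :: l) X j w `^ (- s) <= x] =
   [set w | Q (X i w, (\sum_(j <- l) X j w `^ (- s)))].
  by apply/seteqP; split=> w; rewrite /Q/= big_cons lerBrDl.
rewrite (prob_conv (measurable_powR (- s)) mQ ul lD) -[size _]/(size l).+1 -wcdfS//.
by apply: eq_integral => t _; rewrite [in RHS]EFinM -[in RHS]IH.
Qed.

(** Chernoff's bound at parameter 1 - c, for which an exponential variable of rate 1 has moment
    c^-1. *)
Lemma sum_tail l (c y : R) : 0 < c -> c < 1 -> uniq l -> {subset l <= D} ->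
  (P [set w | (y <= \sum_(j <- l) X j w)%R] <=
    (c ^- size l * expR (- ((1 - c) * y)))%:E)%E.
Proof.
move=> c0 c1; elim: l y => [|i l IH] y.
  move=> _ _; rewrite expr0 invr1 mul1r.
  have [y0|y0] := leP y 0.
    apply: (@le_trans _ _ 1%E).
      apply: probability_le1; rewrite -[X in measurable X]setTI.
      by apply: measurable_fun_le => //; exact: (measurable_sumX _ (h := id)).
    by rewrite lee_fin -[leLHS]expR0 ler_expR oppr_ge0 mulr_ge0_le0// subr_ge0 ltW.
  rewrite (_ : [set w | _] = set0) ?measure0 ?lee_fin ?expR_ge0//.
  by apply/seteqP; split=> w //=; rewrite big_nil leNgt y0.
move=> ul lD; have [il ul'] : i \notin l /\ uniq l by apply/andP; rewrite -cons_uniq.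
have lD' : {subset l <= D} by move=> j jl; apply: lD; rewrite inE jl orbT.
pose Q := [set z : R * R | y - z.1 <= z.2].
have mQ : measurable Q.
  rewrite -[X in measurable X]setTI; apply: measurable_fun_le => //.
  exact: measurable_funB.
have -> : [set w | y <= \sum_(j <- i :: l) X j w] =
   [set w | Q (X i w, (\sum_(j <- l) X j w))].
  by apply/seteqP; split=> w; rewrite /Q/= big_cons lerBlDl.
rewrite (prob_conv (@measurable_id _ _ setT) mQ ul lD).
pose C := c ^- size l * expR (- ((1 - c) * y)).
have C0 : 0 <= C by rewrite mulr_ge0 ?expR_ge0// invr_ge0 exprn_ge0// ltW.
have -> : c ^- size (i :: l) * expR (- ((1 - c) * y)) = C * c^-1 + 0 * c^-1.
  by rewrite /C /= exprS invfM; ring.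
rewrite -(integral_lincomb (measurable_edens c) (measurable_edens c) (edens_ge0 c)
  (edens_ge0 c) C0 (lexx 0) (integral_edens c0) (integral_edens c0)).
pose F t := fine (P [set w | Q (t, (\sum_(j <- l) X j w))]).
have mS t : measurable [set w | Q (t, (\sum_(j <- l) X j w))].
  rewrite -[X in measurable X]setTI; apply: measurable_fun_le => //=.
  exact: (measurable_sumX _ (h := id)).
have PF t : P [set w | Q (t, (\sum_(j <- l) X j w))] = (F t)%:E.
  by rewrite /F fineK// fin_num_measure.
under eq_integral do rewrite PF -EFinM.
have ndF : nondecreasing_fun F.
  move=> t u tu; rewrite /F fine_le ?fin_num_measure//.
  by apply: le_measure; rewrite ?inE// => w; rewrite /Q/=; apply: le_trans; rewrite lerB.
apply: le_integral_EFin.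
- apply: measurable_funM; last exact: measurable_edens.
  exact: nondecreasing_measurable.
- by apply: measurable_funD; apply: measurable_funM => //; exact: measurable_edens.
- by move=> t; rewrite mulr_ge0 ?edens_ge0// fine_ge0.
move=> t; rewrite mul0r addr0.
have : F t <= c ^- size l * expR (- ((1 - c) * (y - t))).
  by rewrite -lee_fin -(PF t); apply: (IH (y - t) ul' lD').
move=> /(ler_wpM2r (edens_ge0 1 t)) /le_trans; apply.
rewrite /C -!mulrA ler_wpM2l ?invr_ge0 ?exprn_ge0 ?(ltW c0)// /edens mulrA mulrA.
rewrite ler_wpM2r ?ler0n// -!expRD ler_expR; lra.
Qed.

Lemma prob_nonpos i : i \in D -> (P [set w | (X i w <= 0)%R] = 0)%E.
Proof.
move=> iD.
have -> : [set w | X i w <= 0] = X i @^-1` `]-oo, 0].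
  by apply/seteqP; split=> w /=; rewrite in_itv.
rewrite -[LHS]/(distribution P (X i) _) (expX iD)//.
rewrite /exponential_prob integral_mkcond.
transitivity (\int[leb]_t (\1_`]-oo, 0] t * exponential_pdf 1 t)%:E)%E.
  apply: eq_integral => t _; rewrite patchE indicE.
  by case: ifPn => _; rewrite ?mul1r ?mul0r.
rewrite -edens_ae_exponential//.
apply: integral0_eq => t _; rewrite indicE mem_setE in_itv/= /edens.
by have [t0|t0] := leP t 0; rewrite ?mulr0 ?mul0r.
Qed.

End exponential_sums.

Lemma set_seq_nil (I : eqType) : [set` ([::] : seq I)] = set0.
Proof. by apply/seteqP; split. Qed.

Lemma set_seq_cons (I : eqType) (i : I) (l : seq I) : [set` i :: l] = i |` [set` l].
Proof.
apply/seteqP; split=> j /=; rewrite inE; first by case/orP => [/eqP|]; [left|right].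
by case=> [->|->]; rewrite ?eqxx ?orbT.
Qed.

Section real_probability.
Context {R : realType} d (T : measurableType d) (P : probability T R).
Implicit Types A B : set T.

Definition pr A : R := fine (P A).

Lemma prE A : measurable A -> P A = (pr A)%:E.
Proof. by move=> mA; rewrite /pr fineK// fin_num_measure. Qed.

Lemma pr_ge0 A : 0 <= pr A. Proof. by rewrite fine_ge0. Qed.

Lemma pr_le1 A : measurable A -> pr A <= 1.
Proof. by move=> mA; rewrite -lee_fin -prE// probability_le1. Qed.

Lemma le_pr A B : measurable A -> measurable B -> A `<=` B -> pr A <= pr B.
Proof. by move=> mA mB AB; rewrite -lee_fin -!prE// le_measure// inE. Qed.

Lemma pr0 : pr set0 = 0. Proof. by rewrite /pr measure0. Qed.

Lemma prT : pr setT = 1. Proof. by rewrite /pr probability_setT. Qed.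

Lemma prD A B : measurable A -> measurable B -> pr (A `\` B) = pr A - pr (A `&` B).
Proof.
move=> mA mB; have mAB : measurable (A `&` B) by exact: measurableI.
apply: EFin_inj; rewrite EFinB -!prE//; last exact: measurableD.
by rewrite measureD// ltey_eq fin_num_measure.
Qed.

Lemma prC A : measurable A -> pr (~` A) = 1 - pr A.
Proof. by move=> mA; rewrite -setTD prD// setTI prT. Qed.

Lemma prU A B : measurable A -> measurable B -> pr (A `|` B) <= pr A + pr B.
Proof.
move=> mA mB; rewrite -lee_fin EFinD -!prE//; last exact: measurableU.
exact: measureU2.
Qed.

Lemma prU_disj A B : measurable A -> measurable B -> A `&` B = set0 ->
  pr (A `|` B) = pr A + pr B.
Proof.
move=> mA mB AB; apply: EFin_inj; rewrite EFinD -!prE//; last exact: measurableU.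
exact: measureU.
Qed.

Lemma prI_null A B : measurable A -> measurable B -> pr B = 1 -> pr (A `&` B) = pr A.
Proof.
move=> mA mB B1; apply/eqP; rewrite eq_le le_pr//=; last exact: measurableI.
have mC : measurable (~` B) by exact: measurableC.
have h : pr (A `&` ~` B) <= 0.
  by apply: le_trans (le_pr _ mC _) _ => //; [exact: measurableI|rewrite prC// B1 subrr].
rewrite -[leRHS]addr0 -{1}(setIT A) -(setUv B) setIUr.
apply: le_trans (prU _ _) _; rewrite ?lerD2l//; exact: measurableI.
Qed.

Lemma pr_bigcup (I : eqType) (l : seq I) (A : I -> set T) :
  (forall i, measurable (A i)) ->
  measurable (\bigcup_(i in [set` l]) A i) /\
  pr (\bigcup_(i in [set` l]) A i) <= \sum_(i <- l) pr (A i).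
Proof.
move=> mA; elim: l => [|i l [IH1 IH2]].
  by rewrite set_seq_nil bigcup_set0 big_nil pr0.
rewrite big_cons set_seq_cons bigcup_setU1; split; first exact: measurableU.
by apply: le_trans (prU _ _) _ => //; rewrite lerD2l.
Qed.

End real_probability.

(** * The probability that none of many weakly dependent events occurs *)

Section noev_probability.
Context {R : realType} d (T : measurableType d) (P : probability T R).
Local Notation pr := (pr P).
Context (I : eqType) (A : I -> set T) (dep : rel I).
Hypothesis mA : forall i, measurable (A i).

Definition noev (l : seq I) := \bigcap_(i in [set` l]) ~` A i.

Lemma noevE l : noev l = ~` \bigcup_(i in [set` l]) A i.
Proof. by rewrite setC_bigcup. Qed.

Lemma measurable_noev l : measurable (noev l).
Proof. by rewrite noevE; apply: measurableC; have [] := pr_bigcup P l mA. Qed.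

Lemma noev_cons i l : noev (i :: l) = noev l `\` A i.
Proof. by rewrite /noev set_seq_cons bigcap_setU1 setDE setIC. Qed.

(* The right-hand side is the error term of the Chen-Stein bound; peeling off the
   events one at a time suffices to obtain it. *)
Lemma noev_approx l : uniq l ->
  (forall i l', i \in l -> {subset l' <= l} -> (forall j, j \in l' -> ~~ dep i j) ->
     pr (A i `&` noev l') = pr (A i) * pr (noev l')) ->
  `|pr (noev l) - \prod_(i <- l) (1 - pr (A i))| <=
  \sum_(i <- l) \sum_(j <- l | (j != i) && dep i j)
     (pr (A i) * pr (A j) + pr (A i `&` A j)).
Proof.
have p0 B := pr_ge0 P B; have p1 i := pr_le1 P (mA i).
elim: l => [|i l IH] ul indep.
  by rewrite /noev set_seq_nil bigcap_set0 prT !big_nil subrr normr0.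
have [il ul'] : i \notin l /\ uniq l by apply/andP; rewrite -cons_uniq.
have mV := measurable_noev.
have {}IH : `|pr (noev l) - \prod_(i <- l) (1 - pr (A i))| <=
  \sum_(i <- l) \sum_(j <- l | (j != i) && dep i j)
     (pr (A i) * pr (A j) + pr (A i `&` A j)).
  apply: IH => // k l' kl l'l; apply: indep; first by rewrite inE kl orbT.
  by move=> x /l'l xl; rewrite inE xl orbT.
(* The tail is split into the events not linked to A i, for which the hypothesis gives independence,
   and its neighbours m, which enter the error only. *)
pose l' := [seq j <- l | ~~ dep i j]; pose m := [seq j <- l | dep i j].
have Bi : pr (A i `&` noev l') = pr (A i) * pr (noev l').
  apply: indep; first by rewrite inE eqxx.
    by move=> j; rewrite mem_filter inE => /andP[_ ->]; rewrite orbT.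
  by move=> j; rewrite mem_filter => /andP[].
have VB : noev l `<=` noev l'.
  by move=> w h j /=; rewrite mem_filter => /andP[_ jl]; exact: h.
have BV : noev l' `<=` noev l `|` \bigcup_(j in [set` m]) A j.
  move=> w h; case: (pselect (noev l w)) => [|nv]; [by left|right].
  move: nv; rewrite noevE => /contrapT[j /= jl Aj].
  exists j => //=; rewrite mem_filter jl andbT; apply: contrapT => /negP nd.
  by have := h j; rewrite /= mem_filter nd jl => /(_ isT).
have [mU leU] := pr_bigcup P m mA.
have mAi x : measurable (A i `&` A x) by exact: measurableI.
have [mU2 leU2] := pr_bigcup P m mAi.
have h1 : pr (noev l') <= pr (noev l) + \sum_(j <- m) pr (A j).
  apply: le_trans (le_pr _ _ _ BV) _ => //; first exact: measurableU.
  by apply: le_trans (prU _ _ _) _ => //; rewrite lerD2l.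
have h2 : pr (A i `&` noev l') <= pr (A i `&` noev l) + \sum_(j <- m) pr (A i `&` A j).
  apply: le_trans (@le_pr _ _ _ _ _ ((A i `&` noev l) `|` \bigcup_(j in [set` m]) (A i `&` A j)) _ _ _) _.
  - exact: measurableI.
  - by apply: measurableU => //; exact: measurableI.
  - rewrite -setI_bigcupr -setIUr; exact: setIS.
  - by apply: le_trans (prU _ _ _) _ => //; rewrite ?lerD2l//; exact: measurableI.
have h3 : pr (A i `&` noev l) <= pr (A i `&` noev l').
  by apply: le_pr; [exact: measurableI|exact: measurableI|exact: setIS].
have h4 : pr (noev l) <= pr (noev l') by exact: le_pr.
pose e := \sum_(j <- m) (pr (A i) * pr (A j) + pr (A i `&` A j)).
have eE : e = pr (A i) * (\sum_(j <- m) pr (A j)) + \sum_(j <- m) pr (A i `&` A j).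
  by rewrite /e big_split/= mulr_sumr.
have S1 : 0 <= \sum_(j <- m) pr (A j) by apply: sumr_ge0.
have S2 : 0 <= \sum_(j <- m) pr (A i `&` A j) by apply: sumr_ge0.
(* Passing from [noev l] to [noev l'] and back costs pr (A i) times the mass of the neighbours in
   one direction and the mass of the pairs A i, A j in the other. *)
have step : `|pr (A i) * pr (noev l) - pr (A i `&` noev l)| <= e.
  rewrite eE ler_norml; apply/andP; split; last first.
    have := ler_wpM2l (p0 (A i)) h4; have := mulr_ge0 (p0 (A i)) S1; lra.
  have := ler_wpM2l (p0 (A i)) h1; rewrite mulrDr; lra.
rewrite noev_cons prD// [noev l `&` _]setIC big_cons.
(* The old error is multiplied by 1 - pr (A i), which is at most 1, so the errors of the successive
   steps add up. *)
have -> : pr (noev l) - pr (A i `&` noev l) - (1 - pr (A i)) * \prod_(j <- l) (1 - pr (A j)) =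
  (1 - pr (A i)) * (pr (noev l) - \prod_(j <- l) (1 - pr (A j))) +
  (pr (A i) * pr (noev l) - pr (A i `&` noev l)) by ring.
apply: le_trans (ler_normD _ _) _; rewrite addrC big_cons; apply: lerD.
  apply: le_trans step _; rewrite big_cons eqxx/= /e /m big_filter.
  rewrite le_eqVlt; apply/orP; left; apply/eqP.
  rewrite [LHS]big_seq_cond [RHS]big_seq_cond; apply: eq_bigl => j.
  have [jl|] //= := boolP (j \in l).
  by case: eqP => //= ji; rewrite -ji jl in il.
rewrite normrM ger0_norm ?subr_ge0//.
apply: (@le_trans _ _ (`|pr (noev l) - \prod_(j <- l) (1 - pr (A j))|)).
  by rewrite ler_piMl// lerBlDr lerDl.
apply: le_trans IH _; apply: ler_sum => k _.
rewrite big_cons; case: ifP => // _; rewrite lerDr addr_ge0// mulr_ge0//.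
Qed.

End noev_probability.

(** * Paths of the complete graph *)

Section path_combinatorics.
Variable n : nat.
Local Notation V := 'I_n.+2.
Implicit Types (v u q : seq V) (e : {set V}).

(* A path is encoded by the sequence of its interior vertices. *)
Definition pathseq v : seq V := ord0 :: rcons v ord_max.

Lemma path_edges_cons2 (x y : V) q :
  path_edges (x :: y :: q) = [set x; y]%SET :: path_edges (y :: q).
Proof. by []. Qed.

Lemma size_path_edges (p : seq V) : size (path_edges p) = (size p).-1.
Proof.
rewrite size_map size_zip size_behead; apply/minn_idPr; exact: leq_pred.
Qed.

Lemma size_path_edges_pathseq v : size (path_edges (pathseq v)) = (size v).+1.
Proof. by rewrite size_path_edges /= size_rcons. Qed.

Lemma path_edges_sub (p : seq V) e x : e \in path_edges p -> x \in e -> x \in p.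
Proof.
elim: p => // a [|b q] IH //; rewrite path_edges_cons2 in_cons => /predU1P[->|].
  by rewrite !inE => /orP[] /eqP ->; rewrite eqxx ?orbT.
by move=> eq xe; rewrite in_cons IH ?orbT.
Qed.

Lemma path_edges_edges (p : seq V) : uniq p -> {subset path_edges p <= @edges n}.
Proof.
elim: p => // a [|b q] IH //; rewrite cons_uniq => /andP[ab ub] e.
rewrite path_edges_cons2 in_cons => /predU1P[->|/(IH ub)//].
rewrite inE cards2; move: ab; rewrite in_cons negb_or => /andP[ab _].
by rewrite ab.
Qed.

Lemma uniq_path_edges (p : seq V) : uniq p -> uniq (path_edges p).
Proof.
elim: p => // a [|b q] IH //; rewrite cons_uniq => /andP[ab ub].
rewrite path_edges_cons2 cons_uniq IH// andbT; apply: contra ab => h.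
by apply: path_edges_sub h _; rewrite !inE eqxx.
Qed.

Lemma is_path_pathseq (p : seq V) :
  is_path p -> exists2 v, p = pathseq v & uniq (pathseq v).
Proof.
case: p => // x q /and4P[/eqP -> /eqP lq pq uq].
case: (lastP q) lq pq uq => [|v y]; first by rewrite /= => /(congr1 val).
by rewrite last_rcons => -> _ uq; exists v.
Qed.

Lemma pathseq_is_path v : uniq (pathseq v) -> is_path (pathseq v).
Proof.
move=> uv; rewrite /is_path [pathseq _]/pathseq !eqxx last_rcons eqxx.
rewrite -/(pathseq v) uv andbT !andTb.
move: uv; rewrite /pathseq; move: (rcons v _) (ord0) => q x.
elim: q x => // y q IH x; rewrite cons_uniq => /andP[xy uq] /=.
rewrite IH// andbT /adjacent/=; apply: contra xy => /eqP ->.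
by rewrite inE eqxx.
Qed.

(** The start x lies on only one edge of a path without repetitions, so the first edge of the second
    path must be the first edge of the other one; then induct. *)
Lemma path_edges_inj (p q : seq V) x : uniq (x :: p) -> uniq (x :: q) ->
  last x p = last x q -> {subset path_edges (x :: q) <= path_edges (x :: p)} ->
  p = q.
Proof.
elim: p q x => [|y p IH] [|b q] x // up uq lpq sub.
- by have := sub _ (mem_head _ _).
- by move: up; rewrite /= in lpq; rewrite -lpq => /andP[]; rewrite mem_last.
have [xp up'] : x \notin y :: p /\ uniq (y :: p) by apply/andP; rewrite -cons_uniq.
have [xq uq'] : x \notin b :: q /\ uniq (b :: q) by apply/andP; rewrite -cons_uniq.
have := sub _ (mem_head _ _); rewrite -/path_edges in_cons => /predU1P[xbxy|h]; last first.
  by have := path_edges_sub h (set21 x b); rewrite (negbTE xp).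
have by_ : b = y.
  have : b \in [set x; y]%SET by rewrite -xbxy set22.
  rewrite !inE => /orP[/eqP bx|/eqP//].
  by move: xq; rewrite bx inE eqxx.
subst b; congr (_ :: _); apply: (IH _ y) => //.
move=> e eq; have := sub e; rewrite path_edges_cons2 !in_cons eq orbT.
move=> /(_ isT) /predU1P[exy|//].
by have := path_edges_sub eq (x := x); rewrite exy set21 (negbTE xq) => /(_ isT).
Qed.

(* An excursion of the walk outside S has one more edge than it has vertices. *)
Lemma count_outside (S : pred V) (F : pred {set V}) x q :
  (forall e y, F e -> y \in e -> S y) -> S (last x q) ->
  (count (predC S) q + (if S x then has (predC S) q : nat else 1) <=
   count (predC F) (path_edges (x :: q)))%N.
Proof.
(* If x is outside S, an excursion is under way and its closing edge is still to come: this is the 1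
   in that case of the statement. *)
move=> FS; elim: q x => [|y q IH] x; first by rewrite /= => ->.
rewrite [last _ _]/= => /IH {}IH; rewrite path_edges_cons2.
have ein a b : F [set a; b]%SET -> S a && S b.
  by move=> h; rewrite (FS _ _ h (set21 a b)) (FS _ _ h (set22 a b)).
move: IH; rewrite [count _ (y :: q)]/= [has _ (y :: q)]/= [count _ (_ :: path_edges _)]/=.
have := ein x y; case: (S x); case: (S y) => //=; case: (F _) => //= h; try by have := h isT.
all: case: (has _ q) => /=; lia.
Qed.

(** If u visits a vertex off v, some excursion supplies the extra edge. If it visits none, it still
    has an edge off v, since otherwise u = v by [path_edges_inj]. *)
Lemma overlap_count v u : uniq (pathseq v) -> uniq (pathseq u) -> v != u ->
  (count (predC (mem (pathseq v))) u <
   count (predC (mem (path_edges (pathseq v)))) (path_edges (pathseq u)))%N.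
Proof.
move=> uv uu vu.
have := @count_outside (mem (pathseq v)) (mem (path_edges (pathseq v))) ord0 (rcons u ord_max).
have lst : ord_max \in pathseq v by rewrite in_cons mem_rcons in_cons eqxx orbT.
rewrite last_rcons -/(pathseq u) => /(_ _ lst).
have -> : (mem (pathseq v)) ord0 by rewrite /= mem_head.
have cE : count (predC (mem (pathseq v))) (rcons u ord_max) = count (predC (mem (pathseq v))) u.
  rewrite -cats1 count_cat -[RHS]addn0; congr addn; apply/eqP.
  rewrite -leqn0 leqNgt -has_count; apply/hasPn => y; rewrite inE => /eqP ->.
  by rewrite inE negbK.
rewrite cE has_count cE => h.
have {h}: (count (predC (mem (pathseq v))) u + (0 < count (predC (mem (pathseq v))) u) <=
    count (predC (mem (path_edges (pathseq v)))) (path_edges (pathseq u)))%N.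
  by apply: h => e y; exact: path_edges_sub.
case: posnP => [->|]; last by rewrite addn1.
move=> _; rewrite lt0n; apply: contra vu => /eqP c0.
suff /(congr1 rev) : rcons v ord_max = rcons u ord_max.
  by rewrite !rev_rcons => -[] /(can_inj (@revK _)) ->.
apply: (@path_edges_inj _ _ ord0) => //; first by rewrite !last_rcons.
move=> e eu; apply: contraT => ev.
suff : (0 < count (predC (mem (path_edges (pathseq v)))) (path_edges (pathseq u)))%N.
  by rewrite c0.
by rewrite -has_count; apply/hasP; exists e.
Qed.

Definition paths m : seq (seq V) :=
  [seq tval t | t <- enum [pred t : m.-tuple V | uniq (pathseq t)]].

Lemma uniq_paths m : uniq (paths m).
Proof. by rewrite map_inj_uniq ?enum_uniq//; exact: val_inj. Qed.

Lemma mem_paths m v : (v \in paths m) = (size v == m) && uniq (pathseq v).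
Proof.
apply/mapP/andP => [[t + ->]|[/eqP sv uv]].
  by rewrite mem_enum inE size_tuple.
by exists (tcast sv (in_tuple v)); rewrite ?mem_enum ?inE val_tcast.
Qed.

Lemma size_paths m : size (paths m) = (n ^_ m)%N.
Proof.
rewrite size_map -cardE.
pose A : pred V := [pred x | (x != ord0) && (x != ord_max)].
have A_n : #|A| = n.
  have := cardsC [set ord0; (ord_max : V)]%SET; rewrite cards2 card_ord /= => -[cA].
  transitivity #|~: [set ord0; (ord_max : V)]%SET|; last exact: cA.
  by apply: eq_card => x; rewrite !inE negb_or.
rewrite -[in RHS]A_n -card_uniq_tuples cardsE; apply: eq_card => t.
rewrite !inE /pathseq cons_uniq rcons_uniq mem_rcons inE negb_or /=.
apply/andP/andP => [[t0 /andP[tm ut]]|[/allP tA ut]]; split=> //.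
  by apply/allP => x xt; rewrite /A /=; apply/andP; split; apply: contraTneq xt => ->.
  by apply: contraT; rewrite negbK => /tA.
rewrite ut andbT.
by apply: contraT; rewrite negbK => /tA; rewrite /A/= eqxx.
Qed.

Lemma sum_tuple_prod (R : comNzRingType) m (f : V -> R) :
  \sum_(t : m.-tuple V) \prod_(x <- t) f x = (\sum_x f x) ^+ m.
Proof.
rewrite -[in RHS](card_ord m) -prodr_const bigA_distr_bigA/=.
rewrite (reindex (@tuple_of_finfun V m)); last first.
  by apply: onW_bij; exists (@finfun_of_tuple V m); [exact: tuple_of_finfunK|exact: finfun_of_tupleK].
by apply: eq_bigr => g _; rewrite big_tuple; apply: eq_bigr => i _; rewrite tnth_mktuple.
Qed.

Lemma sum_paths_le (R : numDomainType) m (F : seq V -> R) :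
  (forall u, 0 <= F u) ->
  \sum_(u <- paths m) F u <= \sum_(t : m.-tuple V) F t.
Proof.
move=> F0; rewrite big_map big_enum/=.
rewrite [leRHS](bigID [pred t : m.-tuple V | uniq (pathseq t)])/=.
by rewrite lerDl sumr_ge0.
Qed.

(** Without the condition that vertices be distinct, the sum factors over the positions: a position
    has at most |v| + 2 choices on v, and at most N choices off v, each of weight 1/N. *)
Lemma sum_outside (R : numFieldType) v m :
  \sum_(u <- paths m) ((n.+2)%:R ^- count (predC (mem (pathseq v))) u : R) <=
  (size v).+3%:R ^+ m.
Proof.
pose f x : R := if x \in pathseq v then 1 else n.+2%:R^-1.
have f0 x : 0 <= f x by rewrite /f; case: ifP; rewrite ?ler01// invr_ge0.
have -> : \sum_(u <- paths m) ((n.+2)%:R ^- count (predC (mem (pathseq v))) u : R)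
   = \sum_(u <- paths m) \prod_(x <- u) f x.
  apply: eq_bigr => u _; elim: u => [|x u IH]; first by rewrite big_nil expr0 invr1.
  rewrite big_cons -IH /f /=.
  by case: (x \in _) => /=; rewrite ?mul1r// exprS invfM.
apply: le_trans (sum_paths_le _ _) _; first by move=> u; exact: prodr_ge0.
rewrite sum_tuple_prod lerXn2r ?nnegrE ?sumr_ge0//.
rewrite (bigID [pred x | x \in pathseq v])/=.
have -> : (size v).+3%:R = (size v).+2%:R + 1 :> R by rewrite natr1.
apply: lerD.
  rewrite (eq_bigr (fun=> 1)); last by move=> x xv; rewrite /f xv.
  rewrite sumr_const ler_nat; apply: leq_trans (card_size (pathseq v)) _.
  by rewrite /= size_rcons.
rewrite (eq_bigr (fun=> n.+2%:R^-1)); last by move=> x /negbTE xv; rewrite /f xv.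
rewrite sumr_const -[leLHS]mulr_natl ler_pdivrMr ?ltr0n// mul1r ler_nat.
by apply: leq_trans (max_card _) _; rewrite card_ord.
Qed.

End path_combinatorics.

(** * Thresholds and energies *)

Section special_constants.
Context {R : realType}.
Implicit Types (s : R) (k : nat).

(** The strict tangent inequality for the exponent -(q-1) at v^-1, multiplied by v. *)
Lemma bernoulli_powR (q v : R) : 1 < q -> 0 < v -> v != 1 -> 1 + q * (v - 1) < v `^ q.
Proof.
move=> q1 v0 v1; have q0 : 0 < q - 1 by lra.
have vi : 0 < v^-1 by rewrite invr_gt0.
have h : v^-1 != 1 by rewrite invr_eq1.
have := powRN_gt_tangent q0 vi h.
have -> : v^-1 `^ (- (q - 1)) = v `^ q / v.
  rewrite -[v^-1]powR_inv1 ?(ltW v0)// -powRrM mulrNN mul1r.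
  by rewrite powRDp// powRN powRr1 ?(ltW v0).
rewrite ltr_pdivlMr// => /(le_lt_trans _); apply.
by rewrite le_eqVlt; apply/orP; left; apply/eqP; field; rewrite gt_eqF.
Qed.

(** Bernoulli's inequality for the exponent 1/q at the point v^q. *)
Lemma powR_le_tangent (q v : R) : 0 < q -> q < 1 -> 0 < v -> v `^ q <= 1 + q * (v - 1).
Proof.
move=> q0 q1 v0; have [->|v1] := eqVneq v 1; first by rewrite powR1; lra.
have qi : 1 < q^-1 by rewrite invf_gt1.
have vq0 : 0 < v `^ q by rewrite powR_gt0.
have vq1 : v `^ q != 1 by rewrite powR_eq1 negb_or v1/= negb_or -leNgt (ltW v0) gt_eqF.
have := bernoulli_powR qi vq0 vq1.
rewrite -powRrM mulfV ?gt_eqF// powRr1 ?(ltW v0)//.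
move=> h; have := ler_wpM2l (ltW q0) (ltW h).
rewrite mulrDr mulrA mulfV ?gt_eqF//; lra.
Qed.

(** The origin of g_s: the energy k^(1+p) x^-p balances the entropy (k-1) log N exactly at x =
    g_s(k) / (log N)^s. *)
Lemma g_powR s k : 0 < s -> (1 < k)%N ->
  k%:R `^ (1 + s^-1) = (k%:R - 1) * (g s k%:R) `^ s^-1 :> R.
Proof.
move=> s0 k1; have k0 : 0 < k%:R - 1 :> R by rewrite subr_gt0 ltr1n.
have k0' : 0 < k%:R :> R by lra.
rewrite /g powRM ?invr_ge0 ?powR_ge0// -[((k%:R - 1) `^ s)^-1]powR_inv1 ?powR_ge0// -!powRrM.
have -> : s * (-1 / s) = -1 by field; rewrite gt_eqF.
rewrite powR_inv1 ?(ltW k0)// mulrC divfK ?gt_eqF//.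
by congr (_ `^ _); field; rewrite gt_eqF.
Qed.

Lemma special_s_gt1 s : special_s s -> 1 < s.
Proof.
move=> [j /= j2 <-]; apply: le_lt_trans (s_gt j2).
by have : 2 <= j%:R :> R by [rewrite (ler_nat _ 2)]; lra.
Qed.

Lemma special_kfloor s : special_s s ->
  (2 <= kfloor s)%N /\ kceil s = (kfloor s).+1.
Proof. by move=> [j /= j2 <-]; rewrite kfloor_s_// kceil_s_. Qed.

Lemma gstar_gt0 s : special_s s -> 0 < gstar s.
Proof.
move=> hs; have [k2 _] := special_kfloor hs.
rewrite /gstar /g divr_gt0// powR_gt0 ?subr_gt0 ?ltr1n ?ltr0n//.
by apply: leq_trans k2.
Qed.

Lemma special_energy s k : special_s s -> (k == kfloor s) || (k == kceil s) ->
  k%:R `^ (1 + s^-1) = (k%:R - 1) * gstar s `^ s^-1.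
Proof.
move=> hs; have s1 := special_s_gt1 hs; have [k2 kc] := special_kfloor hs.
have s0 : 0 < s by lra.
case/orP => /eqP ->; first exact: (g_powR s0 k2).
have kc2 : (1 < kceil s)%N by rewrite kc leqW.
by rewrite (g_powR s0 kc2) (gstarP hs).1.
Qed.

(** The line (r-1) G meets the strictly convex function r^(1+p) at r = j and r = j+1. The tangent at
    j has slope below G and the tangent at j+1 slope above G, so outside [j, j+1] the function
    exceeds the line by an amount that grows linearly with the distance; hence the gap is relative
    and uniform in k. *)
Lemma energy_gap s : special_s s -> exists2 eta : R, 0 < eta &
  forall k, (1 < k)%N -> k != kfloor s -> k != kceil s ->
    (1 + eta) * ((k%:R - 1) * gstar s `^ s^-1) <= k%:R `^ (1 + s^-1).
Proof.
move=> hs; have s1 := special_s_gt1 hs; have [k2 kc] := special_kfloor hs.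
have s0 : 0 < s by lra.
set j := kfloor s in k2 kc *; set p := s^-1; set G := gstar s `^ p.
have p0 : 0 < p by rewrite invr_gt0.
have G0 : 0 < G by apply: powR_gt0; exact: gstar_gt0.
have Ej : j%:R `^ (1 + p) = (j%:R - 1) * G by apply: special_energy; rewrite ?eqxx.
have Ej1 : j.+1%:R `^ (1 + p) = (j.+1%:R - 1) * G.
  by apply: special_energy; rewrite // kc eqxx orbT.
have tangent (r r0 : R) : 0 < r -> 0 < r0 -> r != r0 ->
    r0 `^ (1 + p) + (1 + p) * r0 `^ p * (r - r0) < r `^ (1 + p).
  move=> rp r0p rr0; have v0 : 0 < r / r0 by rewrite divr_gt0.
  have v1 : r / r0 != 1 by apply: contra rr0 => /eqP h; rewrite -(divfK (lt0r_neq0 r0p) r) h mul1r.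
  have := @bernoulli_powR (1 + p) (r / r0); rewrite v0 v1 => /(_ _ isT isT) h.
  have {}h : 1 + (1 + p) * (r / r0 - 1) < (r / r0) `^ (1 + p) by apply: h; lra.
  have r0q : 0 < r0 `^ (1 + p) by rewrite powR_gt0.
  have -> : r `^ (1 + p) = r0 `^ (1 + p) * (r / r0) `^ (1 + p).
    by rewrite -powRM ?(ltW r0p) ?(ltW v0)// mulrC divfK ?gt_eqF.
  rewrite -(ltr_pM2l r0q) in h; apply: le_lt_trans h.
  have -> : r0 `^ (1 + p) = r0 * r0 `^ p by rewrite powRDp// powRr1 ?(ltW r0p).
  by rewrite le_eqVlt; apply/orP; left; apply/eqP; field; rewrite gt_eqF.
have j0 : 0 < j%:R :> R by rewrite ltr0n; exact: leq_trans k2.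
have j10 : 0 < j.+1%:R :> R by rewrite ltr0n.
have jne : (j.+1%:R : R) != j%:R by rewrite eqr_nat; lia.
pose c1 := (1 + p) * j.+1%:R `^ p - G.
pose c0 := G - (1 + p) * j%:R `^ p.
have jS : j.+1%:R = j%:R + 1 :> R by rewrite natr1.
have c1_gt0 : 0 < c1.
  have := tangent j%:R j.+1%:R j0 j10; rewrite eq_sym jne => /(_ isT).
  rewrite Ej Ej1 /c1 jS; lra.
have c0_gt0 : 0 < c0.
  have := tangent j.+1%:R j%:R j10 j0 jne.
  rewrite Ej Ej1 /c0 jS; lra.
have j1G : 0 < j.+1%:R * G by rewrite mulr_gt0.
(* The factor j+1 compares k - 1 with the distance to the interval: k - 1 <= j+1 for k < j, and k -
   1 <= (j+1) (k - (j+1)) for k > j+1. *)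
pose eta := Num.min c0 c1 / (j.+1%:R * G).
have m0 : 0 < Num.min c0 c1 by rewrite lt_min c0_gt0.
have eta0 : 0 < eta by rewrite divr_gt0.
have etaG : eta * G * j.+1%:R = Num.min c0 c1.
  by rewrite /eta; field; rewrite !gt_eqF.
have etaj : eta * G * j.+1%:R <= c0 /\ eta * G * j.+1%:R <= c1.
  by rewrite etaG !ge_min !lexx orbT.
exists eta => // k k1 kj; rewrite kc => kj1.
have k0 : 0 < k%:R :> R by rewrite ltr0n; exact: leq_trans k1.
have e0 : 0 < eta * G by rewrite mulr_gt0.
have [ltkj|ltjk|kje] := ltngtP k j; last by rewrite kje eqxx in kj.
  have kS : k%:R + 1 <= j%:R :> R by rewrite natr1 ler_nat.
  have := tangent k%:R j%:R k0 j0; rewrite eqr_nat kj Ej => /(_ isT).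
  have : eta * G * (k%:R - 1) <= c0 * (j%:R - k%:R).
    apply: (@le_trans _ _ c0); last by nra.
    by case: etaj => + _; apply: le_trans; rewrite ler_wpM2l ?(ltW e0)//; lra.
  rewrite /c0; nra.
have {}ltjk : (j.+1 < k)%N by rewrite ltn_neqAle eq_sym kj1.
have kS : j.+1%:R + 1 <= k%:R :> R by rewrite natr1 ler_nat.
have := tangent k%:R j.+1%:R k0 j10; rewrite eqr_nat kj1 Ej1 => /(_ isT).
have : eta * G * (k%:R - 1) <= c1 * (k%:R - j.+1%:R).
  apply: (@le_trans _ _ (eta * G * (j.+1%:R * (k%:R - j.+1%:R)))).
    rewrite ler_wpM2l ?(ltW e0)//; nra.
  by rewrite mulrA ler_wpM2r ?subr_ge0//; [lra|case: etaj].
rewrite /c1; nra.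
Qed.

End special_constants.

Section threshold.
Context {R : realType}.
Variable s : R.
Hypothesis hs : special_s s.
Let p := s^-1.
Let gs := gstar s.
Let G := gs `^ p.
Let s1 : 1 < s. Proof. exact: special_s_gt1. Qed.
Let s0 : 0 < s. Proof. by have := s1; lra. Qed.
Let p0 : 0 < p. Proof. by rewrite invr_gt0. Qed.
Let p1 : p < 1. Proof. by rewrite invf_lt1. Qed.
Let gs0 : 0 < gs. Proof. exact: gstar_gt0. Qed.
Let G0 : 0 < G. Proof. exact: powR_gt0. Qed.

(* The value of [opt_weight] at which [normalized_weight] equals y. *)
Definition xthr (y L : R) : R :=
  gstar s / L `^ s + s * gstar s / L `^ (s + 1) *
    (y - 2^-1 * ln L + s^-1 * ln (gstar s) / 2).

(** The level is gs L^-s (1 + u) with u = s z / L. As z grows only like log L, the quantity L u^2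
    vanishes in the limit although L u = s z does not: first-order terms in u count, second-order
    terms do not. *)
Let z y L := y + p * ln gs / 2 - 2^-1 * ln L.
Let u y L := s * z y L / L.

Lemma xthrE y L : 0 < L -> xthr y L = gs * L `^ (- s) * (1 + u y L).
Proof.
move=> L0; rewrite /xthr -/gs -/p powRDp// powRr1 ?(ltW L0)// powRN /u /z.
by field; rewrite !gt_eqF ?powR_gt0.
Qed.

Lemma sqrt_ge1 (x : R) : 1 <= x -> exists2 q : R, 1 <= q & x = q ^+ 2.
Proof.
move=> x1; have x0 : 0 < x by lra.
exists (Num.sqrt x); last by rewrite sqr_sqrtr// ltW.
by have := @ler_sqrt R 1 x (ltW x0); rewrite sqrtr1 x1.
Qed.

Lemma ln_sq_le (r : R) : 1 <= r -> (ln (r ^+ 2)) ^+ 2 <= 16 * r.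
Proof.
move=> r1; have [q q1 ->] := sqrt_ge1 r1.
rewrite -exprM lnXn; last lra.
have lq : ln q < q by apply: ln_sublinear; lra.
have lq0 : 0 <= ln q by exact: ln_ge0.
have -> : ln q *+ (2 * 2) = 4 * ln q by rewrite -[LHS]mulr_natl.
by nra.
Qed.

Lemma z_small y : (z y L) ^+ 2 / L @[L --> +oo] --> 0.
Proof.
(* With L = r^2, (c - ln L / 2)^2 is at most 2 c^2 + (ln L)^2 / 2, hence at most (2 c^2 + 8) r by
   [ln_sq_le] and r >= 1. *)
pose c := y + p * ln gs / 2; pose C := 2 * c ^+ 2 + 8.
have C0 : 0 < C by have := sqr_ge0 c; rewrite /C; lra.
apply/cvgrPdist_le => e e0; near=> L.
have L1 : 1 <= L by near: L; apply: nbhs_pinfty_ge; exact: num_real.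
have Le : (C / e) ^+ 2 <= L by near: L; apply: nbhs_pinfty_ge; exact: num_real.
have L0 : 0 < L by lra.
rewrite sub0r normrN ger0_norm ?divr_ge0 ?sqr_ge0 ?(ltW L0)//.
rewrite ler_pdivrMr// /z -/c.
have [r r1 rL] := sqrt_ge1 L1.
have r0 : 0 <= r by lra.
have lr : (ln L) ^+ 2 <= 16 * r by rewrite rL; exact: ln_sq_le.
have rC : C / e <= r.
  rewrite -(@ler_pXn2r _ 2)// ?nnegrE -?rL ?divr_ge0 ?(ltW C0) ?(ltW e0)//.
have rC' : C <= r * e by rewrite -ler_pdivrMr.
have h1 : (c - 2^-1 * ln L) ^+ 2 <= 2 * c ^+ 2 + 2^-1 * (ln L) ^+ 2.
  have := sqr_ge0 (c + 2^-1 * ln L); nra.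
have h2 : (c - 2^-1 * ln L) ^+ 2 <= C * r by have := sqr_ge0 c; rewrite /C; nra.
apply: le_trans h2 _; rewrite rL expr2 mulrA ler_wpM2r// mulrC.
by [].
Unshelve. all: by end_near. Qed.

Lemma u_cvg y : u y L @[L --> +oo] --> 0.
Proof.
apply/cvgrPdist_le => e e0.
have es : 0 < (e / s) ^+ 2 by rewrite exprn_gt0// divr_gt0.
have /cvgrPdist_le/(_ _ es) zs := z_small y.
near=> L.
have L1 : 1 <= L by near: L; apply: nbhs_pinfty_ge; exact: num_real.
have L0 : 0 < L by lra.
have : `|0 - (z y L) ^+ 2 / L| <= (e / s) ^+ 2 by near: L.
rewrite sub0r normrN ger0_norm ?divr_ge0 ?sqr_ge0 ?(ltW L0)// => h.
rewrite sub0r normrN /u -mulrA normrM (gtr0_norm s0) mulrC -ler_pdivlMr//.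
rewrite -(@ler_pXn2r _ 2)// ?nnegrE ?normr_ge0 ?divr_ge0 ?(ltW s0) ?(ltW e0)//.
rewrite real_normK ?num_real//; apply: le_trans h.
rewrite exprMn exprVn ler_wpM2l ?sqr_ge0// lef_pV2 ?posrE ?exprn_gt0//.
by rewrite expr2 ler_peMr// ltW.
Unshelve. all: by end_near. Qed.

Lemma near_u y e : 0 < e -> \forall L \near +oo, `|u y L| <= e.
Proof.
move=> e0; have /cvgrPdist_le/(_ _ e0) := u_cvg y.
by apply: filterS => L; rewrite sub0r normrN.
Qed.

Lemma xthr_gt0 y : \forall L \near +oo, 0 < xthr y L.
Proof.
near=> L.
have L0 : 0 < L by near: L; apply: nbhs_pinfty_gt; exact: num_real.
have : `|u y L| <= 2^-1 by near: L; apply: near_u; rewrite invr_gt0.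
rewrite ler_norml xthrE// => /andP[h _].
have u0 : 0 < 1 + u y L by lra.
apply: mulr_gt0 => //; apply: mulr_gt0 => //; exact: powR_gt0.
Unshelve. all: by end_near. Qed.

Lemma xthr_energy y L : 0 < L -> 0 < 1 + u y L ->
  G * xthr y L `^ (- p) = L * (1 + u y L) `^ (- p).
Proof.
move=> L0 u0; have gL : 0 <= gs * L `^ (- s) := mulr_ge0 (ltW gs0) (powR_ge0 _ _).
rewrite xthrE// (powRM _ gL (ltW u0)) (powRM _ (ltW gs0) (powR_ge0 _ _)) powRNV_K ?(gt_eqF s0) ?(ltW L0)//.
rewrite !mulrA; congr (_ * _); rewrite -[RHS]mul1r; congr (_ * _).
by rewrite /G -powRDp// subrr powRr0.
Qed.

Lemma energy_ratio y : G * xthr y L `^ (- p) / L @[L --> +oo] --> (1 : R).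
Proof.
have h : (1 + u y L) `^ (- p) @[L --> +oo] --> (1 : R).
  rewrite -[X in _ --> X](_ : (1 + 0) `^ (- p) = 1); last by rewrite addr0 powR1.
  apply: (@cvg_comp _ _ _ (fun L => 1 + u y L) (fun x => x `^ (- p)) _ (nbhs (1 + 0 : R))).
    by apply: cvgD; [exact: cvg_cst|exact: u_cvg].
  by apply: continuous_powR; rewrite addr0.
apply: cvg_trans h; apply: near_eq_cvg; near=> L.
have L0 : 0 < L by near: L; apply: nbhs_pinfty_gt; exact: num_real.
have : `|u y L| <= 2^-1 by near: L; apply: near_u; rewrite invr_gt0.
rewrite ler_norml => /andP[h _].
by rewrite xthr_energy//; [field; rewrite gt_eqF|lra].
Unshelve. all: by end_near. Qed.

(** For an optimal length k, N^(k-1) exp(- k^(1+p) x^-p) x^(-p(k-1)/2) is the exponential of k - 1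
    times this expression. The log log and log g* terms of the normalization are there to make it
    converge to y. *)
Lemma energy_cvg y :
  L - G * xthr y L `^ (- p) + 2^-1 * ln (xthr y L `^ (- p)) @[L --> +oo] --> y.
Proof.
have h1 : ln (1 + u y L) @[L --> +oo] --> (0 : R).
  rewrite -[X in _ --> X](_ : ln (1 + 0) = 0); last by rewrite addr0 ln1.
  apply: (@cvg_comp _ _ _ (fun L => 1 + u y L) (@ln R) _ (nbhs (1 + 0 : R))).
    by apply: cvgD; [exact: cvg_cst|exact: u_cvg].
  by apply: continuous_ln; rewrite addr0.
(* The remainder after the linear term in u. It is nonnegative by convexity, and p < 1 bounds it by
   2 p L u^2 through the concave tangent inequality at 1/(1+u). *)
pose r L := L * ((1 + u y L) `^ (- p) - 1 + p * u y L).
have h2 : r L @[L --> +oo] --> (0 : R).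
  apply/cvgrPdist_le => e e0; pose C := 2 * p * s ^+ 2.
  have C0 : 0 < C by rewrite !mulr_gt0 ?exprn_gt0.
  have eC : 0 < e / C by rewrite divr_gt0.
  have /cvgrPdist_le/(_ _ eC) zs := z_small y.
  near=> L.
  have L0 : 0 < L by near: L; apply: nbhs_pinfty_gt; exact: num_real.
  have : `|u y L| <= 2^-1 by near: L; apply: near_u; rewrite invr_gt0.
  rewrite ler_norml => /andP[h _].
  have u0 : 0 < 1 + u y L by lra.
  have lo := powRN_ge_tangent p0 u0.
  have ui : 0 < (1 + u y L)^-1 by rewrite invr_gt0.
  have up := powR_le_tangent p0 p1 ui.
  have E : (1 + u y L)^-1 `^ p = (1 + u y L) `^ (- p).
    by rewrite -[(1 + u y L)^-1]powR_inv1 ?(ltW u0)// -powRrM mulN1r.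
  rewrite E in up.
  have r0 : 0 <= r L by rewrite /r mulr_ge0 ?(ltW L0)//; lra.
  have rle : r L <= L * (p * (2 * (u y L) ^+ 2)).
    rewrite /r ler_wpM2l ?(ltW L0)//.
    have e2 : p * ((1 + u y L)^-1 - 1) + p * u y L = p * (u y L ^+ 2 / (1 + u y L)).
      by field; rewrite gt_eqF.
    have : u y L ^+ 2 / (1 + u y L) <= 2 * u y L ^+ 2.
      by rewrite ler_pdivrMr//; have := sqr_ge0 (u y L); nra.
    move=> /(ler_wpM2l (ltW p0)); lra.
  rewrite sub0r normrN ger0_norm//; apply: le_trans rle _.
  have -> : L * (p * (2 * u y L ^+ 2)) = C * (z y L ^+ 2 / L).
    by rewrite /C /u; field; rewrite gt_eqF.
  have : `|0 - (z y L) ^+ 2 / L| <= e / C by near: L.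
  rewrite sub0r normrN ger0_norm ?divr_ge0 ?sqr_ge0 ?(ltW L0)// => hz.
  by rewrite mulrC -ler_pdivlMr.
have h3 : y - r L - 2^-1 * p * ln (1 + u y L) @[L --> +oo] --> y - 0 - 2^-1 * p * 0.
  apply: cvgB; first by apply: cvgB => //; exact: cvg_cst.
  exact: cvgMl_tmp.
rewrite mulr0 !subr0 in h3.
apply: cvg_trans h3; apply: near_eq_cvg; near=> L.
have L0 : 0 < L by near: L; apply: nbhs_pinfty_gt; exact: num_real.
have : `|u y L| <= 2^-1 by near: L; apply: near_u; rewrite invr_gt0.
rewrite ler_norml => /andP[h _].
have u0 : 0 < 1 + u y L by lra.
rewrite xthr_energy// ln_powR xthrE//.
have Ls0 : 0 < L `^ (- s) by exact: powR_gt0.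
have gL0 : 0 < gs * L `^ (- s) := mulr_gt0 gs0 Ls0.
rewrite lnM ?posrE// lnM ?posrE// ln_powR /r.
have Lu : L * u y L = s * z y L by rewrite /u mulrC divfK ?gt_eqF.
have ps : p * s = 1 by rewrite mulVf ?gt_eqF.
have -> : y - L * ((1 + u y L) `^ (- p) - 1 + p * u y L) =
   y - L * (1 + u y L) `^ (- p) + L - p * (L * u y L) by ring.
rewrite Lu mulrA ps mul1r.
have -> : 2^-1 * (- p * (ln gs + - s * ln L + ln (1 + u y L))) =
  2^-1 * (- p * ln gs + (p * s) * ln L - p * ln (1 + u y L)) by ring.
rewrite ps /z; field.
Unshelve. all: by end_near. Qed.

Lemma wcdf_threshold y k : (0 < k)%N ->
  k%:R `^ (1 + p) = (k%:R - 1) * G ->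
  wcdf s k (xthr y L) * expR ((k%:R - 1) * L) @[L --> +oo] -->
  a_ s k * expR ((k%:R - 1) * y).
Proof.
move=> k0 kG.
have Linf : xthr y L `^ (- p) @[L --> +oo] --> +oo.
  apply/cvgryPge => A; near=> L.
  have L0 : 0 < L by near: L; apply: nbhs_pinfty_gt; exact: num_real.
  have LA : 2 * G * A <= L by near: L; apply: nbhs_pinfty_ge; exact: num_real.
  have : 2^-1 <= G * xthr y L `^ (- p) / L.
    near: L; apply: (@cvgr_ge _ _ _ _ _ 1 (energy_ratio y)).
    by rewrite invf_lt1// ltr1n.
  rewrite ler_pdivlMr// => h.
  by rewrite -(ler_pM2l G0); lra.
have h1 : wcdf_norm s k (xthr y L `^ (- p)) @[L --> +oo] --> a_ s k.
  apply: (@cvg_comp _ _ _ (fun L => xthr y L `^ (- p)) (wcdf_norm s k) _ (pinfty_nbhs R)) => //.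
  exact: wcdf_asymptotic.
have h2 : expR ((k%:R - 1) * (L - G * xthr y L `^ (- p) + 2^-1 * ln (xthr y L `^ (- p))))
    @[L --> +oo] --> expR ((k%:R - 1) * y).
  apply: (@cvg_comp _ _ _ _ (@expR R) _ (nbhs ((k%:R - 1) * y))); last exact: continuous_expR.
  by apply: cvgMl_tmp; exact: energy_cvg.
apply: cvg_trans (cvgM h1 h2); apply: near_eq_cvg; near=> L.
have x0 : 0 < xthr y L by near: L; exact: xthr_gt0.
have La0 : 0 < xthr y L `^ (- p) by rewrite powR_gt0.
rewrite /= /wcdf_norm -/p powRNVV_K ?(gt_eqF s0) ?(ltW x0)// kG.
rewrite -!mulrA; congr (_ * _).
have -> : (xthr y L `^ (- p)) `^ (- ((k%:R - 1) / 2)) =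
   expR (- ((k%:R - 1) / 2) * ln (xthr y L `^ (- p))) by rewrite [LHS]/powR gt_eqF.
rewrite -!expRD; congr expR; ring.
Unshelve. all: by end_near. Qed.

End threshold.

Section pair_energy.
Context {R : realType}.
Variables (s G M : R).
Hypotheses (s0 : 0 < s) (G0 : 0 < G) (M0 : 0 < M).
Let p := s^-1.
Let p0 : 0 < p. Proof. by rewrite invr_gt0. Qed.
Hypothesis energyG : forall m, (0 < m)%N -> (m%:R - 1) * G <= m%:R `^ (1 + p).

(* Either the shared edge uses up a fraction u of the weight x that b may spend,
   or its energy alone exceeds M G x^-p. *)
Lemma pair_energy : exists2 kappa : R, 0 < kappa <= 1 &
  forall (I : eqType) (a b : seq I) (t : I -> R) (x : R),
    0 < x -> (forall i, 0 < t i) -> (size a)%:R + (size b)%:R <= M ->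
    has (mem a) b -> let c := [seq i <- b | i \notin a] in (0 < size c)%N ->
    \sum_(i <- a) t i `^ (- s) <= x -> \sum_(i <- b) t i `^ (- s) <= x ->
    ((size a)%:R + (size c)%:R - 2 + kappa) * G * x `^ (- p) <=
    \sum_(i <- a ++ c) t i.
Proof.
(* A shared edge of weight at most u x has energy at least (u x)^-p >= M G x^-p, more than the claim
   requires of all edges together. *)
pose u := Num.min 2^-1 ((M * G) `^ (- s)).
have MG : 0 < M * G by rewrite mulr_gt0.
have u0 : 0 < u by rewrite lt_min invr_gt0 powR_gt0// ltr0n.
have [u2 uM] : u <= 2^-1 /\ u <= (M * G) `^ (- s) by rewrite /u !ge_min !lexx orbT.
have uMG : M * G <= u `^ (- p).
  rewrite -[leLHS](@powRNV_K _ s) ?(gt_eqF s0) ?(ltW MG)//.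
  by apply: powRN_anti => //; exact: ltW.
have w0 : 0 < 1 - u by lra.
pose B := (1 - u) `^ (- p).
have B1 : 1 < B.
  have w1 : 1 - u != 1 by rewrite lt_eqF//; lra.
  have := powRN_gt_tangent p0 w0 w1; have := mulr_gt0 p0 u0; rewrite -/B; nra.
(* If the shared edge is heavier than u x, the edges of c have to share (1-u) x, which multiplies
   their least energy by B; since that energy is at least x^-p, the gain is at least (B-1) x^-p. *)
pose kappa := Num.min 1 ((B - 1) / G).
have k0 : 0 < kappa by rewrite lt_min ltr01 divr_gt0//; lra.
have [k1 kB] : kappa <= 1 /\ kappa * G <= B - 1.
  by rewrite -ler_pdivlMr// /kappa !ge_min !lexx orbT.
exists kappa; first by rewrite k0.
move=> I a b t x x0 t0 abM /hasP[i0 i0b i0a] c c0 Sa Sb.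
have X0 i : 0 < t i `^ (- s) by rewrite powR_gt0.
have La : 0 < x `^ (- p) by rewrite powR_gt0.
have a0 : (0 < size a)%N by case: a i0a {abM c c0 Sa}.
have Ea := power_mean s0 x0 a0 t0 Sa.
have Sbc : \sum_(i <- c) t i `^ (- s) + t i0 `^ (- s) <= x.
  apply: le_trans Sb; rewrite [leRHS](bigID (mem a)) [leRHS]addrC.
  apply: lerD; first by rewrite /c big_filter.
  by rewrite (big_rem i0)//= ifT// lerDl sumr_ge0// => i _; exact: ltW.
have c_le : (size c <= size b)%N by rewrite size_filter count_size.
have c_leR : (size c)%:R <= (size b)%:R :> R by rewrite ler_nat.
rewrite big_cat/=.
have sa1 : 1 <= (size a)%:R :> R by rewrite ler1n.
have [ux|xu] := leP (t i0 `^ (- s)) (u * x).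
  have t0E : M * G * x `^ (- p) <= t i0.
    rewrite -[leRHS](@powRNV_K _ s) ?(gt_eqF s0) ?(ltW (t0 i0))//.
    apply: (@le_trans _ _ ((u * x) `^ (- p))).
      by rewrite powRM ?(ltW u0) ?(ltW x0)// ler_wpM2r ?(ltW La).
    by apply: powRN_anti => //; exact: ltW.
  have h1 : t i0 <= \sum_(i <- a) t i.
    by rewrite (big_rem i0)//= lerDl sumr_ge0// => i _; exact: ltW.
  have h2 : 0 <= \sum_(i <- c) t i by apply: sumr_ge0 => i _; exact: ltW.
  apply: (@le_trans _ _ (M * G * x `^ (- p))); last by lra.
  by rewrite !ler_wpM2r ?(ltW La) ?(ltW G0)//; lra.
have Sc : \sum_(i <- c) t i `^ (- s) <= (1 - u) * x by lra.
have x'0 : 0 < (1 - u) * x by rewrite mulr_gt0.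
have := power_mean s0 x'0 c0 t0 Sc.
rewrite powRM ?(ltW w0) ?(ltW x0)// -/B -/p mulrA => Ec.
have Ga := energyG a0; have Gc := energyG c0.
have c1 : 1 <= (size c)%:R `^ (1 + p).
  have sc : 1 <= (size c)%:R :> R by rewrite ler1n.
  by rewrite -[leLHS](powRr0 (size c)%:R) ler_powR//; have := p0; lra.
apply: (@le_trans _ _ (((size a)%:R - 1) * G * x `^ (- p) + ((size c)%:R `^ (1 + p) * B) * x `^ (- p))).
  rewrite -mulrDl ler_wpM2r ?(ltW La)//.
  have : (size c)%:R `^ (1 + p) + (B - 1) <= (size c)%:R `^ (1 + p) * B by nra.
  nra.
apply: lerD => //; apply: le_trans Ea.
by rewrite ler_wpM2r ?(ltW La).
Qed.

End pair_energy.

(** * Negligibility of all other lengths *)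

Section other_lengths.
Context {R : realType}.
Variable s : R.
Hypothesis hs : special_s s.
Let p := s^-1.
Let G := gstar s `^ p.
Let s0 : 0 < s. Proof. by have := special_s_gt1 hs; lra. Qed.
Let G0 : 0 < G. Proof. by apply: powR_gt0; exact: gstar_gt0. Qed.

Lemma energy_lower k : (0 < k)%N -> (k%:R - 1) * G <= k%:R `^ (1 + p).
Proof.
move=> k0; have [k1|k1] := leqP k 1.
  have -> : k = 1%N by lia.
  by rewrite subrr mul0r powR_ge0.
have [/eqP kf|kf] := boolP (k == kfloor s).
  by rewrite (special_energy hs) ?kf ?eqxx.
have [/eqP kc|kc] := boolP (k == kceil s).
  by rewrite (special_energy hs) ?kc ?eqxx ?orbT.
have [eta eta0 /(_ k k1 kf kc)] := energy_gap hs; apply: le_trans.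
have k10 : 0 <= k%:R - 1 :> R by rewrite subr_ge0 ler1n.
by rewrite ler_peMl ?mulr_ge0 ?(ltW G0)//; lra.
Qed.

Lemma sum_geometric_le (r : R) m : 0 <= r -> r <= 2^-1 ->
  \sum_(0 <= i < m) r ^+ i.+1 <= 2 * r.
Proof.
move=> r0 r2; suff : \sum_(0 <= i < m) r ^+ i.+1 + 2 * r ^+ m.+1 <= 2 * r.
  by have := exprn_ge0 m.+1 r0; lra.
elim: m => [|m IH]; first by rewrite big_nil expr1 add0r.
rewrite big_nat_recr//=; apply: le_trans IH.
by rewrite -addrA lerD2l [r ^+ m.+2]exprS; have := exprn_ge0 m.+1 r0; nra.
Qed.

(** The relative gap eta makes the terms decay geometrically in i, with a ratio that tends to 0 with
    L. The bound is uniform in m because the number of possible lengths grows with n. *)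
Lemma other_lengths_small y e : 0 < e -> \forall L \near +oo, forall m,
  \sum_(0 <= i < m | (i.+1 != kfloor s) && (i.+1 != kceil s))
    expR (i%:R * L) * wcdf s i.+1 (xthr s y L) <= e.
Proof.
move=> e0; have [eta eta0 gap] := energy_gap hs.
(* Two factors 1 - de are lost, one in the Chernoff bound and one in the comparison of G x^-p with
   L; this choice gives (1-de)^2 (1+eta) >= 1 + eta/2. *)
pose de := eta / (4 * (1 + eta)).
have de0 : 0 < de by rewrite divr_gt0//; lra.
have deE : de * (4 * (1 + eta)) = eta by rewrite /de divfK// gt_eqF//; lra.
have de1 : de < 1 by rewrite ltr_pdivrMr//; lra.
clearbody de.
have de01 : 0 < de < 1 by rewrite de0.
near=> L.
have L0 : 0 < L by near: L; apply: nbhs_pinfty_gt; exact: num_real.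
have x0 : 0 < xthr s y L by near: L; exact: xthr_gt0.
have ratio : 1 - de <= G * xthr s y L `^ (- p) / L.
  near: L; apply: (@cvgr_ge _ _ _ _ _ 1 (energy_ratio hs y)); lra.
rewrite ler_pdivlMr// in ratio.
pose rho := de^-1 * expR (- (eta / 2 * L)).
have rho0 : 0 <= rho by rewrite mulr_ge0 ?expR_ge0// invr_ge0 ltW.
have rho2 : rho <= 2^-1.
  by rewrite /rho; near: L; apply: near_expRN_le; [lra|rewrite invr_gt0].
have rhoe : 2 * rho <= de * (e / 2).
  rewrite /rho mulrA; near: L; apply: near_expRN_le; [lra|by rewrite mulr_gt0//; lra].
(* For the direct edge the gap, proportional to k - 1, is zero; it is only one path, and its
   probability of being light tends to 0. *)
have w1 : wcdf s 1 (xthr s y L) <= e / 2.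
  rewrite wcdf1//.
  apply: (@le_trans _ _ (1 * expR (- ((1 - de) / G * L)))).
    rewrite mul1r ler_expR lerN2 -/p -(ler_pM2l G0).
    by apply: le_trans ratio; rewrite mulrA (mulrC G) divfK// gt_eqF.
  near: L; apply: near_expRN_le; rewrite ?divr_gt0//; lra.
case=> [|m]; first by rewrite big_nil ltW.
rewrite big_ltn_cond//.
have rest : \sum_(1 <= i < m.+1 | (i.+1 != kfloor s) && (i.+1 != kceil s))
    expR (i%:R * L) * wcdf s i.+1 (xthr s y L) <= e / 2.
  apply: (@le_trans _ _ (\sum_(1 <= i < m.+1) de^-1 * rho ^+ i)).
    rewrite big_mkcond; apply: ler_sum_nat => i /andP[i1 _].
    have rh : 0 <= de^-1 * rho ^+ i by rewrite mulr_ge0 ?exprn_ge0// invr_ge0 ltW.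
    case: ifP => // /andP[if_ ic].
    have i1' : (1 < i.+1)%N by rewrite ltnS.
    have gi := gap i.+1 i1' if_ ic.
    have W := wcdf_chernoff s0 (isT : (0 < i.+1)%N) de01 x0.
    apply: le_trans (ler_wpM2l (expR_ge0 _) W) _.
    have -> : de^-1 * rho ^+ i = de ^- i.+1 * expR (i%:R * (- (eta / 2 * L))).
      by rewrite /rho exprMn exprS invfM exprVn expRM_natl mulrA.
    rewrite mulrCA -expRD ler_wpM2l ?invr_ge0 ?exprn_ge0 ?(ltW de0)// ler_expR.
    have La : 0 < xthr s y L `^ (- p) by rewrite powR_gt0.
    have iR : 0 < i%:R :> R by rewrite ltr0n.
    have iE : i.+1%:R - 1 = i%:R :> R by rewrite -natr1 addrK.
    have h1 : (1 + eta) * (i%:R * ((1 - de) * L)) <= i.+1%:R `^ (1 + p) * xthr s y L `^ (- p).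
      apply: (@le_trans _ _ ((1 + eta) * ((i.+1%:R - 1) * G) * xthr s y L `^ (- p))); last first.
        by rewrite ler_wpM2r ?(ltW La).
      rewrite iE -!mulrA ler_wpM2l//; first by lra.
      by rewrite ler_wpM2l ?(ltW iR).
    have h2 : i%:R * ((1 + eta / 2) * L) <= (1 - de) * ((1 + eta) * (i%:R * ((1 - de) * L))).
      have -> : (1 - de) * ((1 + eta) * (i%:R * ((1 - de) * L))) =
          i%:R * ((1 - de) * (1 + eta) * (1 - de) * L) by ring.
      rewrite ler_wpM2l ?(ltW iR)// ler_wpM2r ?(ltW L0)//; nra.
    have h3 := ler_wpM2l (_ : 0 <= 1 - de) h1.
    have {}h3 := h3 ltac:(lra).
    rewrite -/p; lra.
  rewrite -mulr_sumr big_add1/= ler_pdivrMl//.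
  by apply: le_trans rhoe; exact: sum_geometric_le.
case: ifP => _; last by apply: le_trans rest _; lra.
rewrite mulr0n mul0r expR0 mul1r; lra.
Unshelve. all: by end_near. Qed.

End other_lengths.

Lemma leq_expn2r a b k : (a <= b)%N -> (a ^ k <= b ^ k)%N.
Proof. by move=> ab; elim: k => // k IH; rewrite !expnS leq_mul. Qed.

Lemma ffact_le_exp n k : (n ^_ k <= n ^ k)%N.
Proof.
rewrite ffact_prod -[X in (_ <= _ ^ X)%N](card_ord k) -prod_nat_const.
by apply: leq_prod => i _; exact: leq_subr.
Qed.

(** * Light paths *)

Section path_events.
Context {R : realType} (s : R) (hs : special_s s).
Let p := s^-1.
Let G := gstar s `^ p.
Let s0 : 0 < s. Proof. by have := special_s_gt1 hs; lra. Qed.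
Let G0 : 0 < G. Proof. by apply: powR_gt0; exact: gstar_gt0. Qed.

Context d (T : measurableType d) (P : probability T R) (n : nat).
Variable E : {set 'I_n.+2} -> {RV P >-> R}.
Hypothesis E_indep : mutually_independent (@edges n) E.
Hypothesis E_exp : forall e : {set 'I_n.+2}, e \in @edges n ->
  exponentially_distributed 1 (E e).
Local Notation V := 'I_n.+2.
Implicit Types (v u : seq V).

Definition light v (x : R) : set T :=
  [set w | path_weight (edge_weight s E w) (pathseq v) <= x].

Definition sharing v u : bool :=
  has (mem (path_edges (pathseq v))) (path_edges (pathseq u)).

Lemma gen_light v l x : {subset path_edges (pathseq v) <= l} ->
  <<s rect E l >> (light v x).
Proof.
move=> vl; have := @gen_sumX _ _ _ _ _ E _ l (fun t => t `^ (- s)) `]-oo, x]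
  (measurable_powR _) vl (measurable_itv _).
by under eq_set do rewrite /= in_itv /=.
Qed.

Lemma measurable_light v x : measurable (light v x).
Proof. by apply: (@gen_measurable _ _ _ _ _ E (path_edges (pathseq v))); exact: gen_light. Qed.

Lemma le_light v x y : x <= y -> light v x `<=` light v y.
Proof. by move=> xy w /le_trans; exact. Qed.

Lemma pr_light v x : uniq (pathseq v) -> pr P (light v x) = wcdf s (size v).+1 x.
Proof.
move=> uv; rewrite -size_path_edges_pathseq.
have := sum_wcdf E_indep E_exp x s0 (uniq_path_edges uv) (path_edges_edges uv).
by rewrite /pr => ->.
Qed.

(** The light event of v depends on the edges of v, the other event on the complementary block l2 of
    edges, so block independence applies. *)
Lemma indep_light v l (x : seq V -> R) : uniq (pathseq v) ->
  (forall u, u \in l -> uniq (pathseq u) && ~~ sharing v u) ->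
  pr P (light v (x v) `&` noev (fun u => light u (x u)) l) =
  pr P (light v (x v)) * pr P (noev (fun u => light u (x u)) l).
Proof.
move=> uv lP; pose l2 := [seq e <- enum (@edges n) | e \notin path_edges (pathseq v)].
have ul : uniq (path_edges (pathseq v) ++ l2).
  rewrite cat_uniq uniq_path_edges// filter_uniq ?enum_uniq// andbT/=.
  by apply/hasPn => e; rewrite mem_filter => /andP[].
have lD : {subset path_edges (pathseq v) ++ l2 <= @edges n}.
  move=> e; rewrite mem_cat => /orP[/(path_edges_edges uv)//|].
  by rewrite mem_filter mem_enum => /andP[].
have gV : <<s rect E l2 >> (noev (fun u => light u (x u)) l).
  pose TG := gen E l2.
  apply: (@fin_bigcap_measurable _ TG); first exact: finite_seq.
  move=> u /= /lP/andP[uu vu].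
  apply: (@measurableC _ TG); apply: gen_light => e eu.
  rewrite mem_filter mem_enum (path_edges_edges uu eu) andbT.
  by move/hasPn: vu => /(_ e eu).
have := block_indep E_indep ul lD (@gen_light v _ (x v) (fun _ => id)) gV.
have mv := measurable_light v (x v).
have mV : measurable (noev (fun u => light u (x u)) l) by exact: gen_measurable gV.
rewrite !prE//; last exact: measurableI.
by move=> [].
Qed.

(** The energy inequalities are applied outcome by outcome and require positive E; this event has
    probability 1. *)
Definition positive : set T := [set w | forall e, e \in @edges n -> 0 < E e w].

Lemma positiveE : positive = ~` \bigcup_(e in [set` enum (@edges n)]) [set w | E e w <= 0].
Proof.
rewrite setC_bigcup; apply/seteqP; split=> w h e /=.
  by rewrite mem_enum => /h; rewrite ltNge => /negP.
by move=> eD; rewrite ltNge; apply/negP; apply: h; rewrite /= mem_enum.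
Qed.

Lemma measurable_positive_and_pr : measurable positive /\ pr P positive = 1.
Proof.
have mE e : measurable [set w | E e w <= 0].
  by rewrite -[X in measurable X]setTI; apply: measurable_fun_le.
have [mU leU] := pr_bigcup P (enum (@edges n)) mE.
rewrite positiveE; split; first exact: measurableC.
have U0 : pr P (\bigcup_(i in [set` enum (@edges n)]) [set w | E i w <= 0]) = 0.
  apply/eqP; rewrite eq_le pr_ge0 andbT; apply: le_trans leU _.
  rewrite big1_seq// => e; rewrite mem_enum => /andP[_ eD].
  by have := prob_nonpos E_exp eD; rewrite /pr => ->.
by rewrite prC// U0 subr0.
Qed.

Section bound.
Variables (kappa : R) (M : nat) (c x : R).
Hypothesis kappaP : forall (I : eqType) (a b : seq I) (t : I -> R) (x : R),
    0 < x -> (forall i, 0 < t i) -> (size a)%:R + (size b)%:R <= (M%:R : R) ->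
    has (mem a) b -> let c := [seq i <- b | i \notin a] in (0 < size c)%N ->
    \sum_(i <- a) t i `^ (- s) <= x -> \sum_(i <- b) t i `^ (- s) <= x ->
    ((size a)%:R + (size c)%:R - 2 + kappa) * G * x `^ (- p) <=
    \sum_(i <- a ++ c) t i.
Hypotheses (c0 : 0 < c) (c1 : c < 1) (x0 : 0 < x).

(** When both paths are light, [pair_energy] forces a large sum of E over the union of their edges,
    counted once each; the tail bound for that sum does the rest. *)
Lemma pr_light_pair v u : uniq (pathseq v) -> uniq (pathseq u) -> v != u ->
  sharing v u -> ((size v).+1 + (size u).+1 <= M)%N ->
  pr P (light v x `&` light u x) <=
  c ^- M * expR (- ((1 - c) * (((size v)%:R +
    (count (predC (mem (pathseq v))) u)%:R + kappa) * G * x `^ (- p)))).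
Proof.
move=> uv uu vu sh kM.
have [mPos prPos] := measurable_positive_and_pr.
set a := path_edges (pathseq v); set b := path_edges (pathseq u).
pose l := [seq e <- b | e \notin a].
have ua : uniq a by exact: uniq_path_edges.
have ub : uniq b by exact: uniq_path_edges.
have ul : uniq (a ++ l).
  rewrite cat_uniq ua filter_uniq// andbT/=.
  by apply/hasPn => e; rewrite mem_filter => /andP[].
have lD : {subset a ++ l <= @edges n}.
  move=> e; rewrite mem_cat mem_filter.
  by move=> /orP[|/andP[_]]; exact: path_edges_edges.
have out_l : (count (predC (mem (pathseq v))) u < size l)%N.
  by rewrite size_filter; exact: overlap_count.
have sa : size a = (size v).+1 by exact: size_path_edges_pathseq.
have sb : size b = (size u).+1 by exact: size_path_edges_pathseq.
have slb : (size l <= size b)%N by rewrite size_filter count_size.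
have sal : (size (a ++ l) <= M)%N.
  by rewrite size_cat; apply: leq_trans kM; rewrite sa -sb leq_add2l.
set o := count _ u in out_l *.
have La : 0 < x `^ (- p) by rewrite powR_gt0.
pose y := ((size v)%:R + o%:R + kappa) * G * x `^ (- p).
have mAB : measurable (light v x `&` light u x).
  by apply: measurableI; exact: measurable_light.
have mS : measurable [set w | y <= \sum_(e <- a ++ l) E e w].
  rewrite -[X in measurable X]setTI; apply: measurable_fun_le => //.
  exact: (measurable_sumX _ _ (h := id)).
rewrite -(prI_null mAB mPos prPos).
apply: (@le_trans _ _ (pr P [set w | y <= \sum_(e <- a ++ l) E e w])).
  apply: le_pr => //; first exact: measurableI.
  move=> w [[lv lu] pw] /=.
  (* [kappaP] asks for positivity at every index, so sets that are not edges receive the value 1. *)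
  pose t e := if e \in @edges n then E e w else 1.
  have t0 e : 0 < t e by rewrite /t; case: ifPn => // /pw.
  have tE (r : seq {set V}) : {subset r <= @edges n} ->
      \sum_(e <- r) t e `^ (- s) = \sum_(e <- r) E e w `^ (- s).
    by move=> rD; apply: eq_big_seq => e /rD eD; rewrite /t eD.
  have aD : {subset a <= @edges n} by exact: path_edges_edges.
  have bD : {subset b <= @edges n} by exact: path_edges_edges.
  have := @kappaP _ a b t x x0 t0; rewrite !tE// sa sb -natrD ler_nat.
  move=> /(_ kM sh); rewrite -/l => /(_ (leq_ltn_trans (leq0n _) out_l) lv lu).
  have -> : \sum_(e <- a ++ l) t e = \sum_(e <- a ++ l) E e w.
    by apply: eq_big_seq => e /lD eD; rewrite /t eD.
  (* v has size v + 1 edges and u has at least o + 1 edges off v, which makes up for the 2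
     subtracted in [kappaP]. *)
  apply: le_trans; rewrite /y !ler_wpM2r ?(ltW La) ?(ltW G0)// lerD2r.
  have : o.+1%:R <= (size l)%:R :> R by rewrite ler_nat.
  rewrite -!natr1; lra.
have := sum_tail E_indep E_exp y c0 c1 ul lD.
rewrite prE// lee_fin => /le_trans; apply.
rewrite ler_wpM2r ?expR_ge0// lef_pV2 ?posrE ?exprn_gt0//.
by rewrite ler_wiXn2l// ltW.
Qed.

Lemma pr_light_le v : uniq (pathseq v) ->
  pr P (light v x) <= c ^- (size v).+1 * expR (- ((1 - c) * ((size v)%:R * G * x `^ (- p)))).
Proof.
move=> uv; rewrite pr_light//.
have c01 : 0 < c < 1 by rewrite c0.
apply: le_trans (wcdf_chernoff s0 _ c01 x0) _ => //.
rewrite ler_wpM2l ?invr_ge0 ?exprn_ge0 ?(ltW c0)// ler_expR lerN2.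
rewrite ler_wpM2l ?subr_ge0 ?(ltW c1)// ler_wpM2r ?powR_ge0//.
have := energy_lower hs (isT : (0 < (size v).+1)%N).
by rewrite -[(size v).+1%:R]natr1 addrK.
Qed.

Variable L : R.
Hypotheses (L0 : 0 <= L) (ratio : (1 - c) * L <= G * x `^ (- p)).
Hypotheses (kappa0 : 0 < kappa) (kappa1 : kappa <= 1).
Hypothesis (cM : 2 * c * M%:R <= kappa / 2).

(** One factor 1 - c comes from the Chernoff bound, the other from comparing G x^-p with L; by [cM]
    they cost together at most half of kappa. *)
Lemma exponent_bound (z : R) : 0 <= z -> z <= M%:R ->
  z - kappa / 2 <= (1 - c) * (1 - c) * z.
Proof.
move=> z0 zM; have : c * z <= c * M%:R by rewrite ler_wpM2l// ltW.
have : 0 <= c * (c * z) by rewrite !mulr_ge0// ltW.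
have -> : (1 - c) * (1 - c) * z = z - 2 * (c * z) + c * (c * z) by ring.
have : 2 * (c * M%:R) <= kappa / 2 by rewrite mulrA.
by lra.
Qed.

(** The joint event has the gain kappa from [pair_energy]. In the product the exponent is |v| + |u|,
    and a shared edge forces |u| >= o + 1 >= o + kappa. Half of kappa survives in both cases. *)
Lemma pr_light_interaction v u : uniq (pathseq v) -> uniq (pathseq u) -> v != u ->
  sharing v u -> ((size v).+1 + (size u).+1 <= M)%N ->
  pr P (light v x) * pr P (light u x) + pr P (light v x `&` light u x) <=
  2 * c ^- (M + M) * (expR (- (kappa / 2 * L)) * (expR (- ((size v)%:R * L)) *
    expR (- ((count (predC (mem (pathseq v))) u)%:R * L)))).
Proof.
move=> uv uu vu sh kM.
have out_b : (count (predC (mem (pathseq v))) u < size u)%N.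
  have := overlap_count uv uu vu; move/leq_trans; apply.
  rewrite -ltnS -size_path_edges_pathseq -[leqRHS](count_predC (mem (path_edges (pathseq v)))).
  by rewrite -[X in (X < _)%N]add0n ltn_add2r -has_count.
have pv := pr_light_le uv; have pu := pr_light_le uu.
have puv := pr_light_pair uv uu vu sh kM.
set o := count _ u in out_b puv *.
set C := c ^- (M + M).
have aM : ((size v).+1 <= M)%N by apply: leq_trans kM; rewrite leq_addr.
have bM : ((size u).+1 <= M)%N by apply: leq_trans kM; rewrite leq_addl.
have C1 m : (m <= M + M)%N -> c ^- m <= C.
  by move=> mM; rewrite /C lef_pV2 ?posrE ?exprn_gt0// ler_wiXn2l// ltW.
have C0 : 0 <= C by rewrite invr_ge0 exprn_ge0// ltW.
have decay (z : R) : 0 <= z -> z <= M%:R ->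
    expR (- ((1 - c) * (z * G * x `^ (- p)))) <= expR (- ((z - kappa / 2) * L)).
  move=> z0 zM; rewrite ler_expR lerN2.
  apply: (@le_trans _ _ ((1 - c) * (1 - c) * z * L)).
    by rewrite ler_wpM2r// exponent_bound.
  have -> : (1 - c) * (1 - c) * z * L = (1 - c) * (z * ((1 - c) * L)) by ring.
  by rewrite ler_wpM2l ?subr_ge0 ?(ltW c1)// -mulrA ler_wpM2l.
have aR : (size v)%:R + (size u)%:R + 2 <= M%:R :> R.
  have -> : (size v)%:R + (size u)%:R + 2 = ((size v).+1 + (size u).+1)%:R :> R.
    by rewrite natrD -!natr1; ring.
  by rewrite ler_nat.
have oR : o%:R + 1 <= (size u)%:R :> R by rewrite natr1 ler_nat.
have v0 : 0 <= (size v)%:R :> R by [].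
have u0 : 0 <= (size u)%:R :> R by [].
have o0 : 0 <= o%:R :> R by [].
set D := expR (- (kappa / 2 * L)) * _.
have DE : D = expR (- (((size v)%:R + o%:R + kappa / 2) * L)).
  by rewrite /D -!expRD; congr expR; ring.
have D0 : 0 <= D by rewrite DE expR_ge0.
have b2 : pr P (light v x `&` light u x) <= C * D.
  apply: le_trans puv _; apply: ler_pM; rewrite ?expR_ge0 ?invr_ge0 ?exprn_ge0 ?(ltW c0)//.
    by apply: C1; rewrite leq_addl.
  apply: le_trans (decay _ _ _) _; [by move: v0 o0 kappa0; lra| |].
    by move: aR oR kappa1; lra.
  by rewrite DE ler_expR lerN2 ler_wpM2r//; lra.
have b1 : pr P (light v x) * pr P (light u x) <= C * D.
  have h := ler_pM (pr_ge0 _ _) (pr_ge0 _ _) pv pu.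
  apply: le_trans h _; rewrite mulrACA -invfM -exprD -expRD.
  have -> : - ((1 - c) * ((size v)%:R * G * x `^ (- p))) +
      - ((1 - c) * ((size u)%:R * G * x `^ (- p))) =
      - ((1 - c) * (((size v)%:R + (size u)%:R) * G * x `^ (- p))) by ring.
  apply: ler_pM; rewrite ?expR_ge0 ?invr_ge0 ?exprn_ge0 ?(ltW c0)//.
    by apply: C1; rewrite leq_add.
  apply: le_trans (decay _ _ _) _; [by move: v0 u0; lra|by move: aR; lra|].
  by rewrite DE ler_expR lerN2 ler_wpM2r//; move: oR kappa1; lra.
have -> : 2 * C * D = C * D + C * D by ring.
exact: lerD.
Qed.

(** In the pair sum of [noev_approx], [sum_outside] bounds the sum of N^-o over u by a constant, and
    the number of paths v compensates N^-|v|; the factor N^(-kappa/2) is left over. The 8 collects a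
    2 from the bound for a pair, one from the sum over u and one from the sum over v. *)
Lemma noev_paths_bound m (thr : seq V -> R) :
  L = ln n.+2%:R -> M = (m.+2 + m.+2)%N -> (forall v, thr v <= x) ->
  `|pr P (noev (fun v => light v (thr v)) (paths n m ++ paths n m.+1)) -
    \prod_(v <- paths n m ++ paths n m.+1) (1 - pr P (light v (thr v)))| <=
  8 * c ^- (M + M) * m.+4%:R ^+ m.+1 * expR (- (kappa / 2 * L)).
Proof.
move=> LE ME thrx; set l := paths n m ++ paths n m.+1; pose N : R := n.+2%:R.
have N0 : 0 < N by rewrite ltr0n.
have eL k : expR (- (k%:R * L)) = N ^- k by rewrite expRN LE expRM_natl lnK ?posrE.
have lP v : v \in l -> uniq (pathseq v) /\ (size v <= m.+1)%N.
  by rewrite mem_cat !mem_paths => /orP[] /andP[/eqP -> ->].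
have ul : uniq l.
  rewrite cat_uniq !uniq_paths andbT/=; apply/hasPn => v.
  by rewrite /= !mem_paths => /andP[/eqP -> _]; rewrite gtn_eqF.
have mlight v := measurable_light v (thr v).
have indep v l' : v \in l -> {subset l' <= l} -> (forall u, u \in l' -> ~~ sharing v u) ->
    pr P (light v (thr v) `&` noev (fun u => light u (thr u)) l') =
    pr P (light v (thr v)) * pr P (noev (fun u => light u (thr u)) l').
  move=> vl l'l nd; apply: indep_light; first by have [] := lP v vl.
  by move=> u ul'; rewrite (nd u ul') andbT; have [] := lP u (l'l u ul').
have := @noev_approx _ _ _ P _ (fun v => light v (thr v)) sharing mlight l ul indep.
move=> /le_trans; apply.
pose D := 2 * c ^- (M + M) * expR (- (kappa / 2 * L)).
have D0 : 0 <= D by rewrite !mulr_ge0 ?expR_ge0 ?invr_ge0 ?exprn_ge0 ?(ltW c0).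
pose o v u := count (predC (mem (pathseq v))) u.
apply: (@le_trans _ _ (\sum_(v <- l) D * N ^- size v * (\sum_(u <- l) N ^- o v u))).
  rewrite big_seq [leRHS]big_seq; apply: ler_sum => v vl.
  have [uv sv] := lP v vl.
  rewrite mulr_sumr big_mkcond big_seq [leRHS]big_seq; apply: ler_sum => u ul'.
  have [uu su] := lP u ul'.
  have N1 k : 0 <= N ^- k by rewrite invr_ge0 exprn_ge0// ltW.
  case: ifP => [/andP[uv_ sh]|_]; last first.
    by apply: mulr_ge0 => //; exact: mulr_ge0.
  rewrite eq_sym in uv_.
  (* The two lengths have different levels; both are raised to the common level x, at which the pair
     bound is stated. *)
  apply: le_trans (_ : _ <= pr P (light v x) * pr P (light u x) + pr P (light v x `&` light u x)) _.
    have mx w := measurable_light w x.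
    have le1 w : pr P (light w (thr w)) <= pr P (light w x).
      by apply: le_pr => //; exact: le_light.
    apply: lerD; first by apply: ler_pM => //; exact: pr_ge0.
    apply: le_pr; [exact: measurableI|exact: measurableI|].
    by apply: setISS; exact: le_light.
  apply: le_trans (pr_light_interaction uv uu uv_ sh _) _.
    by rewrite ME leq_add.
  by rewrite !eL /D !mulrA.
have So v : v \in l -> \sum_(u <- l) N ^- o v u <= 2 * m.+4%:R ^+ m.+1.
  move=> vl; have [uv sv] := lP v vl.
  rewrite big_cat/=.
  have h k : (k <= m.+1)%N -> \sum_(u <- paths n k) N ^- o v u <= m.+4%:R ^+ m.+1.
    move=> km; apply: le_trans (sum_outside R v k) _.
    apply: (@le_trans _ _ (m.+4%:R ^+ k)).
      by rewrite lerXn2r ?nnegrE// ler_nat.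
    by rewrite ler_weXn2l// ler1n.
  have := lerD (h m _) (h m.+1 _); rewrite leqnSn leqnn => /(_ isT isT).
  by move=> H; apply: le_trans H _; rewrite -mulr2n mulr_natl.
have Ss : \sum_(v <- l) N ^- size v <= 2.
  rewrite big_cat/=.
  have h k : \sum_(v <- paths n k) N ^- size v <= 1.
    rewrite (eq_big_seq (fun=> N ^- k)); last by move=> v; rewrite mem_paths => /andP[/eqP ->].
    rewrite big_const_seq count_predT iter_addr_0 size_paths -mulr_natl.
    rewrite ler_pdivrMr ?exprn_gt0// mul1r /N -natrX ler_nat.
    exact: leq_trans (ffact_le_exp n k) (leq_expn2r k (leqW (leqnSn n))).
  by have := lerD (h m) (h m.+1).
apply: (@le_trans _ _ (\sum_(v <- l) D * (2 * m.+4%:R ^+ m.+1) * N ^- size v)).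
  rewrite big_seq [leRHS]big_seq; apply: ler_sum => v vl.
  rewrite [leRHS]mulrAC ler_wpM2l ?So// mulr_ge0// invr_ge0 exprn_ge0//.
rewrite -mulr_sumr.
apply: (@le_trans _ _ (D * (2 * m.+4%:R ^+ m.+1) * 2)).
  by rewrite ler_wpM2l// mulr_ge0// mulr_ge0// exprn_ge0.
by rewrite /D le_eqVlt; apply/orP; left; apply/eqP; ring.
Qed.

End bound.

End path_events.

(** * Poisson limit for the two optimal lengths *)

Section limit_lemmas.
Context {R : realType}.

Lemma cvg_ln_succ2 : (ln n.+2%:R : R) @[n --> \oo] --> +oo.
Proof.
apply/cvgryPge => A; near=> n.
rewrite -[A]expRK ler_ln ?posrE ?expR_gt0//.
apply: (@le_trans _ _ n%:R); last by rewrite ler_nat leqW.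
by near: n; exact: nbhs_infty_ger.
Unshelve. all: by end_near. Qed.

Lemma cvg_ffact_ratio m : ((n ^_ m)%:R / n.+2%:R ^+ m : R) @[n --> \oo] --> (1 : R).
Proof.
elim: m => [|m IH].
  by apply: cvg_near_cst; apply: nearW => n; rewrite ffactn0 expr0 divr1.
have h : ((n - m)%:R / n.+2%:R : R) @[n --> \oo] --> (1 : R).
  have h0 : (1 - m.+2%:R * n.+1%:R^-1 : R) @[n --> \oo] --> (1 : R).
    rewrite -[X in _ --> X](_ : 1 - m.+2%:R * 0 = 1); last by rewrite mulr0 subr0.
    apply: cvgB; first exact: cvg_cst.
    by apply: cvgMl_tmp; exact: cvg_harmonic.
  apply: (@squeeze_cvgr _ _ _ _ (fun n => 1 - m.+2%:R * n.+1%:R^-1) (cst 1)).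
  - near=> n; apply/andP; split.
      apply: (@le_trans _ _ (1 - m.+2%:R / n.+2%:R)).
        by rewrite lerD2l lerN2 ler_wpM2l// lef_pV2 ?posrE// ler_nat.
      rewrite -[X in X - _](@divff _ n.+2%:R) ?pnatr_eq0// -mulrBl ler_wpM2r//.
      by rewrite lerBlDr -natrD ler_nat; lia.
    by rewrite ler_pdivrMr// mul1r ler_nat; lia.
  - exact: h0.
  - exact: cvg_cst.
have /(_ _) := cvgM IH h; rewrite mulr1 => hh; apply: (cvg_trans _ hh); apply: near_eq_cvg.
by near=> n; rewrite ffactnSr natrM exprSr invfM mulrACA.
Unshelve. all: by end_near. Qed.

(** The power lies between exp(- M q / (1-q)) and exp(- M q), by e^v >= 1 + v at v = q/(1-q) and at
    v = -q. *)
Lemma cvg_poisson (M : nat -> nat) (q : nat -> R) lam : (forall n, 0 <= q n) ->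
  q @ \oo --> 0 -> (M n)%:R * q n @[n --> \oo] --> lam ->
  (1 - q n) ^+ M n @[n --> \oo] --> expR (- lam).
Proof.
move=> q0 q_cvg Mq_cvg.
have e_cvg (f : nat -> R) b : f @ \oo --> b -> expR (- f n) @[n --> \oo] --> expR (- b).
  move=> fb; apply: (@cvg_comp _ _ _ (fun n => - f n) (@expR R) _ (nbhs (- b))).
    exact: cvgN.
  exact: continuous_expR.
have near_q : \forall n \near \oo, q n < 1.
  by apply: cvgr_lt; [exact: q_cvg|exact: ltr01].
apply: (@squeeze_cvgr _ _ _ _ (fun n => expR (- ((M n)%:R * q n / (1 - q n))))
  (fun n => expR (- ((M n)%:R * q n)))).
- near=> n; have q1 : 0 < 1 - q n by rewrite subr_gt0; near: n.
  apply/andP; split; last first.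
    rewrite -mulrN expRM_natl lerXn2r ?nnegrE ?expR_ge0 ?(ltW q1)//.
    exact: expR_ge1Dx.
  rewrite -mulrA -mulrN expRM_natl lerXn2r ?nnegrE ?expR_ge0 ?(ltW q1)//.
  rewrite expRN -[leRHS]invrK lef_pV2 ?posrE ?invr_gt0 ?expR_gt0//.
  apply: le_trans (expR_ge1Dx _); rewrite le_eqVlt; apply/orP; left; apply/eqP.
  by field; rewrite gt_eqF.
- apply: e_cvg; rewrite -[X in _ --> X](_ : lam / (1 - 0) = lam); last by rewrite subr0 divr1.
  apply: cvgM => //; apply: cvgV; first by rewrite subr0 oner_neq0.
  by apply: cvgB => //; exact: cvg_cst.
- exact: e_cvg.
Unshelve. all: by end_near. Qed.

Lemma cvg_paths_mean s m y : special_s s -> (0 < m)%N ->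
  (m.+1 == kfloor s) || (m.+1 == kceil s) ->
  wcdf s m.+1 (xthr s y (ln n.+2%:R)) @[n --> \oo] --> (0 : R) /\
  (n ^_ m)%:R * wcdf s m.+1 (xthr s y (ln n.+2%:R)) @[n --> \oo] -->
    (a_ s m.+1 * expR (m%:R * y) : R).
Proof.
move=> hs m0 mk.
have h : wcdf s m.+1 (xthr s y (ln n.+2%:R)) * n.+2%:R ^+ m @[n --> \oo] -->
    (a_ s m.+1 * expR (m%:R * y) : R).
  have := @wcdf_threshold _ _ hs y _ (ltn0Sn m) (special_energy hs mk).
  rewrite -natr1 addrK => h.
  have hh := cvg_comp _ _ cvg_ln_succ2 h.
  apply: (cvg_trans _ hh); apply: near_eq_cvg; near=> n.
  by rewrite /= expRM_natl lnK// posrE ltr0n.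
split.
  have h0 : n.+2%:R ^- m @[n --> \oo] --> (0 : R).
    apply: (@squeeze_cvgr _ _ _ _ (cst 0) (fun n => n.+1%:R^-1)).
    - near=> n; rewrite invr_ge0 exprn_ge0//= lef_pV2 ?posrE ?exprn_gt0//.
      apply: (@le_trans _ _ n.+2%:R); first by rewrite ler_nat.
      by rewrite -[leLHS]expr1 ler_weXn2l// ler1n.
    - exact: cvg_cst.
    - exact: cvg_harmonic.
  have /(_ _) := cvgM h h0; rewrite mulr0 => hh.
  apply: (cvg_trans _ hh); apply: near_eq_cvg; near=> n.
  by rewrite /= mulfK// expf_neq0// pnatr_eq0.
have /(_ _) := cvgM h (cvg_ffact_ratio m); rewrite mulr1 => hh.
apply: (cvg_trans _ hh); apply: near_eq_cvg; near=> n.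
rewrite /= -[RHS]mulrC -[LHS]mulrA; congr (_ * _).
by rewrite mulrC divfK// expf_neq0// pnatr_eq0.
Unshelve. all: by end_near. Qed.

End limit_lemmas.

Section two_lengths.
Context {R : realType} (s : R) (hs : special_s s).
Let p := s^-1.
Let G := gstar s `^ p.
Let s0 : 0 < s. Proof. by have := special_s_gt1 hs; lra. Qed.
Let G0 : 0 < G. Proof. by apply: powR_gt0; exact: gstar_gt0. Qed.

Context (d : nat -> measure_display) (T : forall n, measurableType (d n))
  (P : forall n, probability (T n) R)
  (E : forall n, {set 'I_n.+2} -> {RV (P n) >-> R}).
Arguments E : clear implicits.
Hypothesis E_indep : forall n, mutually_independent (@edges n) (E n).
Hypothesis E_exp : forall n (e : {set 'I_n.+2}), e \in @edges n ->
  exponentially_distributed 1 (E n e).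
Let thr n (y : R) := xthr s y (ln n.+2%:R).

Lemma xthr_le (y z L : R) : 0 < L -> y <= z -> xthr s y L <= xthr s z L.
Proof.
move=> L0 yz; rewrite /xthr lerD2l ler_wpM2l ?lerD2r//.
by rewrite divr_ge0 ?powR_ge0// mulr_ge0 ?(ltW s0)// ltW// gstar_gt0.
Qed.

(** The optimal lengths are m+2 and m+3 edges, that is, m+1 and m+2 interior vertices. *)
Let m := (kfloor s).-2.

Let mE : kfloor s = m.+2.
Proof. by rewrite /m; have [] := special_kfloor hs; case: (kfloor s) => [|[]]. Qed.

Let mE' : kceil s = m.+3.
Proof. by have [_ ->] := special_kfloor hs; rewrite mE. Qed.

Lemma cvg_noev_paths (y z : R) :
  pr (P n) (noev (fun v : seq 'I_n.+2 =>
      light s (E n) v (if size v == m.+1 then thr n y else thr n z))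
    (paths n m.+1 ++ paths n m.+2)) @[n --> \oo] -->
  expR (- (a_ s m.+2 * expR (m.+1%:R * y))) * expR (- (a_ s m.+3 * expR (m.+2%:R * z))).
Proof.
pose q n := wcdf s m.+2 (thr n y); pose q' n := wcdf s m.+3 (thr n z).
have prodE n : \prod_(v <- paths n m.+1 ++ paths n m.+2)
     (1 - pr (P n) (light s (E n) v (if size v == m.+1 then thr n y else thr n z))) =
   (1 - q n) ^+ (n ^_ m.+1) * (1 - q' n) ^+ (n ^_ m.+2).
  rewrite big_cat/=; congr (_ * _).
    rewrite (eq_big_seq (fun=> 1 - q n)).
      by rewrite big_const_seq count_predT iter_mulr_1 size_paths.
    move=> v; rewrite mem_paths => /andP[sv uv].
    by rewrite sv (pr_light hs (@E_indep n) (@E_exp n))// (eqP sv).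
  rewrite (eq_big_seq (fun=> 1 - q' n)).
    by rewrite big_const_seq count_predT iter_mulr_1 size_paths.
  move=> v; rewrite mem_paths => /andP[/eqP sv uv].
  by rewrite sv gtn_eqF// (pr_light hs (@E_indep n) (@E_exp n))// sv.
have [q0 Mq] : _ /\ _ := @cvg_paths_mean R s m.+1 y hs isT ltac:(by rewrite mE eqxx).
have [q'0 Mq'] : _ /\ _ := @cvg_paths_mean R s m.+2 z hs isT ltac:(by rewrite mE' eqxx orbT).
have prod_cvg : (1 - q n) ^+ (n ^_ m.+1) * (1 - q' n) ^+ (n ^_ m.+2) @[n --> \oo] -->
    expR (- (a_ s m.+2 * expR (m.+1%:R * y))) * expR (- (a_ s m.+3 * expR (m.+2%:R * z))).
  have q_ge0 n : 0 <= q n by exact: wcdf_ge0.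
  have q'_ge0 n : 0 <= q' n by exact: wcdf_ge0.
  exact: (cvgM (cvg_poisson q_ge0 q0 Mq) (cvg_poisson q'_ge0 q'0 Mq')).
pose M := (m.+3 + m.+3)%N.
have M0 : 0 < M%:R :> R by rewrite ltr0n.
have [kappa /andP[k0 k1] kappaP] := pair_energy s0 G0 M0 (fun k => energy_lower hs (k := k)).
(* The largest c with 2 c M <= kappa / 2, the condition under which half of kappa survives. *)
pose c := kappa / (4 * M%:R).
have M1 : 1 <= M%:R :> R by rewrite ler1n.
have c0 : 0 < c by rewrite divr_gt0// mulr_gt0.
have cM : 2 * c * M%:R <= kappa / 2.
  by rewrite le_eqVlt; apply/orP; left; apply/eqP; rewrite /c; field; rewrite gt_eqF.
have c1 : c < 1 by rewrite ltr_pdivrMr ?mulr_gt0//; lra.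
have err : 8 * c ^- (M + M) * m.+1.+4%:R ^+ m.+2 * expR (- (kappa / 2 * ln n.+2%:R)) @[n --> \oo] --> (0 : R).
  rewrite -[X in _ --> X](mulr0 (8 * c ^- (M + M) * m.+1.+4%:R ^+ m.+2)).
  apply: cvgMl_tmp.
  apply: (@cvg_comp _ _ _ (fun n => ln n.+2%:R) (fun L => expR (- (kappa / 2 * L))) _ +oo).
    exact: cvg_ln_succ2.
  by apply: cvg_expRN_pinfty; rewrite divr_gt0.
apply/cvgrPdist_le => e e0.
have e2 : 0 < e / 2 by rewrite divr_gt0.
move/cvgrPdist_le : prod_cvg => /(_ _ e2) near_prod.
have /(_ _) near_err := @cvgr_le _ _ _ _ _ 0 err (e / 2) e2.
pose w : R := Num.max y z.
have near_ratio : \forall n \near \oo, (1 - c) * ln n.+2%:R <= G * thr n w `^ (- p).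
  have : \forall L \near +oo, (1 - c) * L <= G * xthr s w L `^ (- p).
    near=> L.
    have L0 : 0 < L by near: L; apply: nbhs_pinfty_gt; exact: num_real.
    rewrite -ler_pdivlMr//; near: L.
    by apply: (@cvgr_ge _ _ _ _ _ 1 (energy_ratio hs w)); lra.
    Unshelve. all: try by end_near.
  exact: cvg_ln_succ2.
have near_pos : \forall n \near \oo, 0 < thr n w.
  exact: (cvg_ln_succ2 (xthr_gt0 hs w)).
near=> n.
have L0 : 0 < ln n.+2%:R :> R by rewrite ln_gt0// ltr1n.
have x0 : 0 < thr n w by near: n.
have ratio : (1 - c) * ln n.+2%:R <= G * thr n w `^ (- p) by near: n.
have := @noev_paths_bound R s hs _ _ (P n) n (E n) (@E_indep n) (@E_exp n) kappa M c _ kappaP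
   c0 c1 x0 _ (ltW L0) ratio k0 k1 cM m.+1
   (fun v => if size v == m.+1 then thr n y else thr n z) erefl erefl.
have thrx (v : seq 'I_n.+2) : (if size v == m.+1 then thr n y else thr n z) <= thr n w.
  by case: ifP => _; apply: xthr_le => //; rewrite le_max lexx ?orbT.
move=> /(_ thrx); rewrite prodE => h1.
have h2 : 8 * c ^- (M + M) * m.+1.+4%:R ^+ m.+2 * expR (- (kappa / 2 * ln n.+2%:R)) <= e / 2.
  by near: n.
set l := expR _ * _.
have h3 : `|l - (1 - q n) ^+ (n ^_ m.+1) * (1 - q' n) ^+ (n ^_ m.+2)| <= e / 2 by near: n.
move: h1; set a := pr _ _; set b := _ * _ in h3 *; move=> h1.
have -> : l - a = (l - b) - (a - b) by ring.
apply: le_trans (ler_normB _ _) _; rewrite [leRHS]splitr.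
by apply: lerD => //; apply: le_trans h1 h2.
Unshelve. all: by end_near. Qed.

End two_lengths.

(** * Which length is reached first *)

Section gumbel.
Context {R : realType}.

(** With a = a_k and c = k - 1 this is the probability that Xi_k / (k-1) exceeds y. *)
Definition gumbel_tail (a c y : R) : R := expR (- (a * expR (c * y))).

Variables a c : R.
Hypotheses (a0 : 0 < a) (c0 : 0 < c).
Local Notation F := (gumbel_tail a c).

Lemma gumbel_tail_gt0 y : 0 < F y. Proof. exact: expR_gt0. Qed.

Lemma gumbel_tail_le1 y : F y <= 1.
Proof. by rewrite -expR0 ler_expR oppr_le0 mulr_ge0 ?expR_ge0// ltW. Qed.

Lemma gumbel_tail_anti y z : y <= z -> F z <= F y.
Proof. by move=> yz; rewrite ler_expR lerN2 ler_pM2l// ler_expR ler_pM2l. Qed.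

(** The step multiplies u = a e^(c y) by 1 + e, so the tail drops by e^-u (1 - e^(-u e)) <= u e^-u
    e, and u e^-u <= 1. *)
Lemma gumbel_tail_step y e : 0 < e -> F y - F (y + ln (1 + e) / c) <= e.
Proof.
move=> e0; rewrite /gumbel_tail; set u := a * expR (c * y).
have u0 : 0 < u by rewrite mulr_gt0// expR_gt0.
have -> : a * expR (c * (y + ln (1 + e) / c)) = u + u * e.
  rewrite mulrDr expRD [c * (_ / _)]mulrC divfK ?gt_eqF// lnK ?posrE; last by lra.
  by rewrite mulrA -/u mulrDr mulr1.
rewrite opprD expRD.
have h1 : 1 - u * e <= expR (- (u * e)) := expR_ge1Dx _.
have h2 : expR (- u) * u <= 1.
  rewrite expRN mulrC ler_pdivrMr ?expR_gt0// mul1r.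
  by apply: le_trans (expR_ge1Dx u); lra.
have h3 := expR_gt0 (- u).
have h4 : expR (- u) * (1 - expR (- (u * e))) <= expR (- u) * (u * e) by rewrite ler_pM2l//; lra.
have h5 : expR (- u) * u * e <= 1 * e by rewrite ler_pM2r.
by move: h4 h5; rewrite mulrBr mulr1 mulrA; lra.
Qed.

Lemma gumbel_tail_low e : 0 < e -> exists y0, forall y, y <= y0 -> 1 - e <= F y.
Proof.
move=> e0; exists (ln (e / a) / c) => y yy0.
apply: le_trans (expR_ge1Dx _); rewrite lerD2l lerN2 mulrC -ler_pdivlMr//.
rewrite -[leRHS]lnK ?posrE ?divr_gt0// ler_expR.
by rewrite mulrC -ler_pdivlMr.
Qed.

Lemma gumbel_tail_high e : 0 < e -> exists y0, forall y, y0 <= y -> F y <= e.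
Proof.
move=> e0; exists (ln (e^-1 / a) / c) => y yy0.
rewrite /gumbel_tail expRN -[leRHS]invrK lef_pV2 ?posrE ?invr_gt0 ?expR_gt0//.
apply: le_trans (expR_ge1Dx _); suff : e^-1 <= a * expR (c * y) by lra.
rewrite mulrC -ler_pdivrMr// -[leLHS]lnK ?posrE ?divr_gt0 ?invr_gt0// ler_expR.
by rewrite [c * y]mulrC -ler_pdivrMr.
Qed.

End gumbel.

Section race.
Context {R : realType}.

(** The i-th summand is the probability that A starts between steps i and i+1 while B has not
    started by step i+1. These events are disjoint and lie in D; writing them through complements
    makes the known limits applicable. *)
Lemma race_lower d (T : measurableType d) (P : probability T R)
    (A B : nat -> set T) (D : set T) r :
  (forall i, measurable (A i)) -> (forall i, measurable (B i)) -> measurable D ->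
  (forall i, A i `<=` A i.+1) -> (forall i, (i < r)%N -> A i.+1 `\` B i.+1 `<=` D) ->
  \sum_(i < r) (pr P (~` A i `&` ~` B i.+1) - pr P (~` A i.+1 `&` ~` B i.+1)) <= pr P D.
Proof.
move=> mA mB mD AS ABD.
have mC (X : set T) : measurable X -> measurable (~` X) by exact: measurableC.
(* The intersection with A r keeps what is already counted disjoint from the next piece, which
   avoids A r. *)
apply: (@le_trans _ _ (pr P (D `&` A r))); last first.
  by apply: le_pr => //; exact: measurableI.
elim: r ABD => [_|r IH ABD]; first by rewrite big_ord0 pr_ge0.
rewrite big_ord_recr/=; set W := A r.+1 `\` B r.+1 `\` A r.
have mW : measurable W by do 2!apply: measurableD => //.
have -> : pr P (~` A r `&` ~` B r.+1) - pr P (~` A r.+1 `&` ~` B r.+1) = pr P W.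
  have -> : ~` A r.+1 `&` ~` B r.+1 = (~` A r `&` ~` B r.+1) `&` ~` A r.+1.
    apply/seteqP; split=> w /=; last by move=> [[]].
    by move=> [nA nB]; do 2!split=> //; move/AS.
  rewrite -prD; [|by apply: measurableI; exact: mC|exact: mC].
  congr (pr P _); apply/seteqP; split=> w /=.
    by move=> [[nA nB] /contrapT Ar]; split.
  by move=> [[Ar nB] nA]; split.
have {}IH := IH (fun i ir => ABD i (ltnW ir)).
apply: le_trans (lerD IH (lexx _)) _.
rewrite -prU_disj//; last 2 first.
- exact: measurableI.
- by apply/seteqP; split=> w //= [[_ Ar] [_ /(_ Ar)]].
apply: le_pr; [by apply: measurableU => //; exact: measurableI|exact: measurableI|].
move=> w [[Dw /AS //]|[[Ar nB] _]]; split => //.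
by apply: (ABD r (ltnSn r)); split.
Qed.

(* [al.1] and [al.2] are Riemann sums for the probabilities that the first family
   of events starts before the second one and conversely.  They depend only on
   the tails, so that they bound the prelimits and the limit alike. *)
Lemma race_bounds (a b c c' e : R) : 0 < a -> 0 < b -> 0 < c -> 0 < c' -> 0 < e ->
  exists2 al : R * R, 1 - e <= al.1 + al.2 &
  forall (d : nat -> measure_display) (T : forall n, measurableType (d n))
    (P : forall n, probability (T n) R) (A B C : forall n, R -> set (T n))
    (D D' : forall n, set (T n)),
  (forall n y, measurable (A n y)) -> (forall n y, measurable (B n y)) ->
  (forall n y, measurable (C n y)) ->
  (forall n, measurable (D n)) -> (forall n, measurable (D' n)) ->
  (forall n y z, y <= z ->
     [/\ A n y `<=` A n z, B n y `<=` B n z & C n y `<=` C n z]) ->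
  (forall n y, A n y `\` B n y `<=` D n `|` C n y) ->
  (forall n y, B n y `\` A n y `<=` D' n `|` C n y) ->
  (forall y z, pr (P n) (~` A n y `&` ~` B n z) @[n --> \oo] -->
     gumbel_tail a c y * gumbel_tail b c' z) ->
  (forall y, pr (P n) (C n y) @[n --> \oo] --> (0 : R)) ->
  \forall n \near \oo, al.1 - e <= pr (P n) (D n) /\ al.2 - e <= pr (P n) (D' n).
Proof.
move=> a0 b0 c0 c'0 e0; set FA := gumbel_tail a c; set FB := gumbel_tail b c'.
have e4 : 0 < e / 4 by rewrite divr_gt0.
have [y1 low1] := gumbel_tail_low a0 c0 e4.
have [y2 low2] := gumbel_tail_low b0 c'0 e4.
have [yh high] := gumbel_tail_high a0 c0 e4.
(* The grid starts where both tails are nearly 1, ends where FA is nearly 0, and is so fine that FA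
   drops by at most e/4 in each step. *)
pose q0 := Num.min y1 y2; pose step := ln (1 + e / 4) / c.
have step0 : 0 < step by rewrite divr_gt0// ln_gt0//; lra.
pose q i : R := q0 + i%:R * step.
have qS i : q i <= q i.+1 by rewrite /q -natr1 mulrDl mul1r; lra.
have q_le i j : (i <= j)%N -> q i <= q j.
  by move=> ij; rewrite lerD2l ler_wpM2r ?(ltW step0)// ler_nat.
pose r := Num.bound (`|yh - q0| / step).
have qr : yh <= q r.
  have : `|yh - q0| / step < r%:R by rewrite archi_boundP// divr_ge0// ltW.
  by rewrite ltr_pdivrMr// /q => h; have := ler_norm (yh - q0); lra.
have FA0 : 1 - e / 4 <= FA (q 0%N) by apply: low1; rewrite /q mul0r addr0 ge_min lexx.
have FB0 : 1 - e / 4 <= FB (q 0%N) by apply: low2; rewrite /q mul0r addr0 ge_min lexx orbT.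
have FAr : FA (q r) <= e / 4 by exact: high.
have FA_step i : FA (q i) - FA (q i.+1) <= e / 4.
  have -> : q i.+1 = q i + step by rewrite /q -natr1; ring.
  exact: gumbel_tail_step.
have FBd i : 0 <= FB (q i) - FB (q i.+1) by rewrite subr_ge0 gumbel_tail_anti.
exists (\sum_(i < r) (FA (q i) * FB (q i.+1) - FA (q i.+1) * FB (q i.+1)),
        \sum_(i < r) (FA (q i.+1) * FB (q i) - FA (q i.+1) * FB (q i.+1))) => /=.
  rewrite -big_split/=.
  (* Each summand is the decrease of FA FB over a cell minus the product of the two drops, the
     probability that both families start in that cell. These products are at most e/4 times the
     drops of FB, which telescope. *)
  have h : FA (q 0%N) * FB (q 0%N) - FA (q r) * FB (q r) - e / 4 * (FB (q 0%N) - FB (q r)) <=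
     \sum_(i < r) ((FA (q i) * FB (q i.+1) - FA (q i.+1) * FB (q i.+1)) +
                   (FA (q i.+1) * FB (q i) - FA (q i.+1) * FB (q i.+1))).
    elim: (r) => [|k IH]; first by rewrite big_ord0; lra.
    rewrite big_ord_recr/=; apply: le_trans (lerD IH (lexx _)).
    have := ler_wpM2r (FBd k) (FA_step k).
    move: (FA (q k)) (FA (q k.+1)) (FB (q k)) (FB (q k.+1)) (FA (q 0%N) * FB (q 0%N)) (FB (q 0%N)).
    by clear; move=> fa fa' fb fb' f g; lra.
  apply: le_trans h.
  have := FA0; have := FB0; have := FAr.
  have := gumbel_tail_le1 c a0 (q 0%N); have := gumbel_tail_le1 c' b0 (q 0%N).
  have := gumbel_tail_le1 c' b0 (q r); have := gumbel_tail_gt0 a c (q r).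
  have := gumbel_tail_gt0 b c' (q r); rewrite -/FA -/FB; move: e0.
  move: (FA (q 0%N)) (FA (q r)) (FB (q 0%N)) (FB (q r)); clear.
  move=> x x' y y' e0 y'0 x'0 y'1 y1 x1 x'e ye xe.
  have h1 : 0 <= (1 - x) * (1 - y) by rewrite mulr_ge0// subr_ge0.
  have h2 : x' * y' <= x' by rewrite ler_piMr// ltW.
  have h3 : e / 4 * (y - y') <= e / 4 by rewrite ler_piMr//; lra.
  lra.
move=> d T P A B C D D' mA mB mC mD mD' mono ABD BAD AB_cvg C_cvg.
have mN n (X : set (T n)) : measurable X -> measurable (~` X) by exact: measurableC.
have sub1 k : pr (P n) (~` A n (q k) `&` ~` B n (q k.+1)) -
    pr (P n) (~` A n (q k.+1) `&` ~` B n (q k.+1)) @[n --> \oo] -->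
    FA (q k) * FB (q k.+1) - FA (q k.+1) * FB (q k.+1).
  by apply: cvgB; exact: AB_cvg.
have sub2 k : pr (P n) (~` A n (q k.+1) `&` ~` B n (q k)) -
    pr (P n) (~` A n (q k.+1) `&` ~` B n (q k.+1)) @[n --> \oo] -->
    FA (q k.+1) * FB (q k) - FA (q k.+1) * FB (q k.+1).
  by apply: cvgB; exact: AB_cvg.
have sumcvg (f : nat -> nat -> R) (g : nat -> R) : (forall k, f k n @[n --> \oo] --> g k) ->
    \forall n \near \oo, \sum_(k < r) g k - e / 2 <= \sum_(k < r) f k n.
  move=> fg; have h : \sum_(k < r) f k n @[n --> \oo] --> \sum_(k < r) g k.
    by apply: cvg_big => [|k _]; [exact: add_continuous|exact: fg].
  by apply: (cvgr_ge _ h); lra.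
have C_small : \forall n \near \oo, pr (P n) (C n (q r)) <= e / 2.
  by apply: (cvgr_le _ (C_cvg (q r))); lra.
near=> n.
have A_S k : A n (q k) `<=` A n (q k.+1) by have [] := mono n _ _ (qS k).
have B_S k : B n (q k) `<=` B n (q k.+1) by have [] := mono n _ _ (qS k).
have C_S k : (k < r)%N -> C n (q k.+1) `<=` C n (q r).
  by move=> kr; have [] := mono n _ _ (q_le _ _ kr).
have Csm : pr (P n) (C n (q r)) <= e / 2 by near: n.
have mDC : measurable (D n `|` C n (q r)) by exact: measurableU.
have mDC' : measurable (D' n `|` C n (q r)) by exact: measurableU.
split.
  have h1 : \sum_(i < r) (FA (q i) * FB (q i.+1) - FA (q i.+1) * FB (q i.+1)) - e / 2 <=
      \sum_(k < r) (pr (P n) (~` A n (q k) `&` ~` B n (q k.+1)) -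
                    pr (P n) (~` A n (q k.+1) `&` ~` B n (q k.+1))).
    by near: n; exact: (sumcvg _ _ sub1).
  have h2 := @race_lower _ _ (P n) (fun k => A n (q k)) (fun k => B n (q k)) (D n `|` C n (q r)) r
    (fun k => mA n _) (fun k => mB n _) mDC A_S.
  have h3 := prU (P n) (mD n) (mC n (q r)).
  have : (forall k, (k < r)%N -> A n (q k.+1) `\` B n (q k.+1) `<=` D n `|` C n (q r)).
    by move=> k kr; apply: subset_trans (ABD n _) _; apply: setUS; exact: C_S.
  move=> /h2; lra.
have h1 : \sum_(i < r) (FA (q i.+1) * FB (q i) - FA (q i.+1) * FB (q i.+1)) - e / 2 <=
    \sum_(k < r) (pr (P n) (~` A n (q k.+1) `&` ~` B n (q k)) -
                  pr (P n) (~` A n (q k.+1) `&` ~` B n (q k.+1))).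
  by near: n; exact: (sumcvg _ _ sub2).
have h2 := @race_lower _ _ (P n) (fun k => B n (q k)) (fun k => A n (q k)) (D' n `|` C n (q r)) r
  (fun k => mB n _) (fun k => mA n _) mDC' B_S.
have h3 := prU (P n) (mD' n) (mC n (q r)).
have : (forall k, (k < r)%N -> B n (q k.+1) `\` A n (q k.+1) `<=` D' n `|` C n (q r)).
  by move=> k kr; apply: subset_trans (BAD n _) _; apply: setUS; exact: C_S.
move=> /h2; rewrite [X in X <= _ -> _](eq_bigr (fun k : 'I_r =>
  pr (P n) (~` A n (q k.+1) `&` ~` B n (q k)) -
  pr (P n) (~` A n (q k.+1) `&` ~` B n (q k.+1)))); first lra.
by move=> k _; rewrite ![~` B n _ `&` _]setIC.
Unshelve. all: by end_near. Qed.

(** Lower bounds suffice: two disjoint events whose probabilities are at least al - e and be - e,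
    with al + be >= 1 - e, are each determined up to 3 e. The same al and be serve for the limit. *)
Lemma race_cvg (a b c c' : R) (d : nat -> measure_display)
    (T : forall n, measurableType (d n)) (P : forall n, probability (T n) R)
    (A B C : forall n, R -> set (T n)) (D D' : forall n, set (T n))
    (e0 : measure_display) (U : measurableType e0) (Q : probability U R) (X Y : U -> R) :
  0 < a -> 0 < b -> 0 < c -> 0 < c' ->
  (forall n y, measurable (A n y)) -> (forall n y, measurable (B n y)) ->
  (forall n y, measurable (C n y)) ->
  (forall n, measurable (D n)) -> (forall n, measurable (D' n)) ->
  (forall n y z, y <= z ->
     [/\ A n y `<=` A n z, B n y `<=` B n z & C n y `<=` C n z]) ->
  (forall n y, A n y `\` B n y `<=` D n `|` C n y) ->
  (forall n y, B n y `\` A n y `<=` D' n `|` C n y) ->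
  (forall n, D n `&` D' n = set0) ->
  (forall y z, pr (P n) (~` A n y `&` ~` B n z) @[n --> \oo] -->
     gumbel_tail a c y * gumbel_tail b c' z) ->
  (forall y, pr (P n) (C n y) @[n --> \oo] --> (0 : R)) ->
  measurable_fun [set: U] X -> measurable_fun [set: U] Y ->
  (forall y z, pr Q [set w | y < X w /\ z < Y w] =
     gumbel_tail a c y * gumbel_tail b c' z) ->
  pr (P n) (D n) @[n --> \oo] --> pr Q [set w | X w <= Y w] /\
  pr (P n) (D' n) @[n --> \oo] --> 1 - pr Q [set w | X w <= Y w].
Proof.
move=> a0 b0 c0 c'0 mA mB mC mD mD' mono ABD BAD DD' AB_cvg C_cvg mX mY XY.
have mle y : measurable [set w | X w <= y] by rewrite -[X in measurable X]setTI; apply: measurable_fun_le.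
have mle' y : measurable [set w | Y w <= y] by rewrite -[X in measurable X]setTI; apply: measurable_fun_le.
have mXY : measurable [set w | X w <= Y w] by rewrite -[X in measurable X]setTI; apply: measurable_fun_le.
set pi := pr Q _.
have main e : 0 < e -> \forall n \near \oo,
    `|pi - pr (P n) (D n)| <= 3 * e /\ `|1 - pi - pr (P n) (D' n)| <= 3 * e.
  move=> e_gt0; have [[al be]/= ab bounds] := race_bounds a0 b0 c0 c'0 e_gt0.
  have near_P := bounds _ _ _ _ _ _ _ _ mA mB mC mD mD' mono ABD BAD AB_cvg C_cvg.
  (* The limiting variables are treated as a constant sequence, with empty exceptional events C. *)
  have near_Q : \forall n \near \oo, al - e <= pi /\ be - e <= pr Q (~` [set w | X w <= Y w]).
    apply: (bounds (fun=> e0) (fun=> U) (fun=> Q) (fun _ y => [set w | X w <= y])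
      (fun _ y => [set w | Y w <= y]) (fun _ _ => set0) (fun=> [set w | X w <= Y w])
      (fun=> ~` [set w | X w <= Y w])) => //.
    - by move=> _; exact: measurableC.
    - by move=> _ y z yz; split=> // w /le_trans; exact.
    - by move=> _ y w /= [Xy /negP]; rewrite -ltNge => /ltW yY; left; exact: le_trans yY.
    - move=> _ y w /= [Yy /negP]; rewrite -ltNge => yX; left; apply/negP.
      by rewrite -ltNge; exact: le_lt_trans yX.
    - move=> y z; rewrite -XY; apply: cvg_near_cst; apply: nearW => _; congr (pr Q _).
      apply/seteqP; split=> w /=; first by move=> [/negP + /negP]; rewrite -!ltNge.
      by rewrite !ltNge => -[/negP + /negP].
    - by move=> _; rewrite pr0; exact: cvg_cst.
  have [_ []] := filter_ex near_Q; rewrite prC// -/pi => pi_al pi_be.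
  near=> n.
  have [Dal Dbe] : al - e <= pr (P n) (D n) /\ be - e <= pr (P n) (D' n) by near: n.
  have : pr (P n) (D n) + pr (P n) (D' n) <= 1.
    by rewrite -prU_disj//; apply: pr_le1; exact: measurableU.
  rewrite !ler_norml; move: pi_al pi_be Dal Dbe ab e_gt0; move: (pr (P n) (D n)) (pr (P n) (D' n)).
  clearbody pi; clear; move=> x y *; split; apply/andP; split; lra.
split; apply/cvgrPdist_le => e e_gt0; have e3 : 0 < e / 3 by rewrite divr_gt0.
  by near=> n; have [] : `|pi - pr (P n) (D n)| <= 3 * (e / 3) /\ 
    `|1 - pi - pr (P n) (D' n)| <= 3 * (e / 3) by [near: n; exact: main]; rewrite mulrC divfK.
by near=> n; have [_] : `|pi - pr (P n) (D n)| <= 3 * (e / 3) /\ 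
    `|1 - pi - pr (P n) (D' n)| <= 3 * (e / 3) by [near: n; exact: main]; rewrite mulrC divfK.
Unshelve. all: by end_near. Qed.

End race.

(** * From light paths to the optimal path *)

Section optimal_path_events.
Context {R : realType} (s : R) (hs : special_s s).
Let s0 : 0 < s. Proof. by have := special_s_gt1 hs; lra. Qed.
Context d (T : measurableType d) (P : probability T R) (n : nat).
Variable E : {set 'I_n.+2} -> {RV P >-> R}.
Local Notation V := 'I_n.+2.
Implicit Types (v : seq V) (l : seq (seq V)) (x : R).

Definition reach l x : set T := \bigcup_(v in [set` l]) light s E v x.

Definition other_paths : seq (seq V) :=
  flatten [seq paths n i | i <- iota 0 n.+1 & (i.+1 != kfloor s) && (i.+1 != kceil s)].

Lemma measurable_reach l x : measurable (reach l x).
Proof. by have [] := pr_bigcup P l (fun v => measurable_light s E v x). Qed.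

Lemma le_reach l x y : x <= y -> reach l x `<=` reach l y.
Proof. by move=> xy w [v vl vx]; exists v => //; exact: le_light vx. Qed.

Lemma mem_other_paths v : (v \in other_paths) =
  [&& (size v).+1 != kfloor s, (size v).+1 != kceil s & uniq (pathseq v)].
Proof.
apply/flatten_mapP/and3P => [[i]|[vf vc uv]].
  by rewrite mem_filter mem_paths => /andP[/andP[f c] _] /andP[/eqP -> ->].
exists (size v); last by rewrite mem_paths eqxx.
rewrite mem_filter vf vc mem_iota add0n ltnS leq0n /=.
have := max_card [in pathseq v]; rewrite (card_uniqP uv) card_ord /= size_rcons.
by rewrite !ltnS.
Qed.

Lemma optimal_interior w : exists v, [/\ uniq (pathseq v),
  opt_weight s E w = path_weight (edge_weight s E w) (pathseq v),
  hopcount s E w = (size v).+1%:R &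
  forall u, uniq (pathseq u) -> opt_weight s E w <= path_weight (edge_weight s E w) (pathseq u)].
Proof.
have [ip opt] := optimal_pathP (edge_weight s E w).
have [v vE uv] := is_path_pathseq ip.
exists v; split=> //; first by rewrite /opt_weight vE.
  by rewrite /hopcount vE size_path_edges_pathseq.
by move=> u uu; apply: opt; exact: pathseq_is_path.
Qed.

Lemma opt_weight_le x : [set w | opt_weight s E w <= x] =
  reach (paths n (kfloor s).-1) x `|` reach (paths n (kceil s).-1) x `|` reach other_paths x.
Proof.
have [k2 kc] := special_kfloor hs.
apply/seteqP; split=> w.
  move=> /= ; have [v [uv -> _ _] vx] := optimal_interior w.
  have [/eqP vf|vf] := boolP ((size v).+1 == kfloor s).
    by left; left; exists v => //=; rewrite mem_paths uv andbT -vf.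
  have [/eqP vc|vc] := boolP ((size v).+1 == kceil s).
    by left; right; exists v => //=; rewrite mem_paths uv andbT -vc.
  by right; exists v => //=; rewrite mem_other_paths vf vc.
have [_ [_ _ _ opt]] := optimal_interior w.
have sub l : {in l, forall u, uniq (pathseq u)} -> reach l x w -> opt_weight s E w <= x.
  by move=> lu [u ul ux]; apply: le_trans ux; apply: opt; exact: lu.
move=> [[]|]; apply: sub => u; rewrite ?mem_paths ?mem_other_paths.
- by move=> /andP[].
- by move=> /andP[].
- by move=> /and3P[].
Qed.

(** The optimal path is no heavier than the light path with k edges, so it is light itself; its
    length is not k', hence it is k or one of the other lengths. *)
Lemma hopcount_reach (k k' : nat) x :
  (k == kfloor s) && (k' == kceil s) || (k == kceil s) && (k' == kfloor s) ->
  reach (paths n k.-1) x `\` reach (paths n k'.-1) x `<=`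
  [set w | hopcount s E w = k%:R] `|` reach other_paths x.
Proof.
have [k2 kc] := special_kfloor hs.
move=> kk' w [[u ul ux] nk'].
have [v [uv vw vh opt]] := optimal_interior w.
have vx : path_weight (edge_weight s E w) (pathseq v) <= x.
  by rewrite -vw; apply: le_trans ux; apply: opt; move: ul; rewrite /= mem_paths => /andP[].
have [/eqP vk|vk] := boolP ((size v).+1 == k); first by left; rewrite /= vh vk.
have [/eqP vk'|vk'] := boolP ((size v).+1 == k').
  by case: nk'; exists v => //=; rewrite mem_paths uv andbT -vk'.
right; exists v => //=; rewrite mem_other_paths uv andbT.
by case/orP: kk' => /andP[/eqP <- /eqP <-]; rewrite ?vk ?vk'.
Qed.

Lemma normalized_weight_le y : [set w | normalized_weight s E w <= y] =
  [set w | opt_weight s E w <= xthr s y (ln n.+2%:R)].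
Proof.
have L0 : 0 < ln n.+2%:R :> R by rewrite ln_gt0// ltr1n.
have g0 := gstar_gt0 hs.
apply/seteqP; split=> w /=; rewrite /normalized_weight /xthr; set L := ln _ in L0 *.
  move=> h; rewrite -lerBlDl -[leRHS]mulrC -ler_pdivrMr ?invf_div; last first.
    by rewrite divr_gt0 ?powR_gt0// mulr_gt0.
  by rewrite mulrC; lra.
move=> h; suff : L `^ (s + 1) / (s * gstar s) * (opt_weight s E w - gstar s / L `^ s) <=
   y - 2^-1 * ln L + s^-1 * ln (gstar s) / 2 by lra.
rewrite [leLHS]mulrC -ler_pdivlMr ?invf_div; last first.
  by rewrite divr_gt0 ?powR_gt0// mulr_gt0.
by rewrite mulrC; lra.
Qed.

Hypothesis E_indep : mutually_independent (@edges n) E.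
Hypothesis E_exp : forall e : {set 'I_n.+2}, e \in @edges n ->
  exponentially_distributed 1 (E e).

Lemma pr_reach_other_paths x : pr P (reach other_paths x) <=
  \sum_(0 <= i < n.+1 | (i.+1 != kfloor s) && (i.+1 != kceil s))
    expR (i%:R * ln n.+2%:R) * wcdf s i.+1 x.
Proof.
have [_ /le_trans] := pr_bigcup P other_paths (fun v => measurable_light s E v x); apply.
rewrite big_flatten big_map big_filter /index_iota subn0; apply: ler_sum => i _.
rewrite (eq_big_seq (fun=> wcdf s i.+1 x)); last first.
  by move=> v; rewrite mem_paths => /andP[/eqP <- uv]; rewrite (pr_light hs E_indep E_exp).
rewrite big_const_seq count_predT iter_addr_0 size_paths -[leLHS]mulr_natl.
rewrite ler_wpM2r ?wcdf_ge0// expRM_natl lnK ?posrE ?ltr0n// -natrX ler_nat.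
exact: leq_trans (ffact_le_exp n i) (leq_expn2r i (leqW (leqnSn n))).
Qed.

End optimal_path_events.

(** * Limit laws of the optimal weight and of the hopcount *)

Section main.
Context {R : realType} (s : R) (hs : special_s s).
Let s0 : 0 < s. Proof. by have := special_s_gt1 hs; lra. Qed.
Context (d : nat -> measure_display) (T : forall n, measurableType (d n))
  (P : forall n, probability (T n) R)
  (E : forall n, {set 'I_n.+2} -> {RV (P n) >-> R}).
Arguments E : clear implicits.
Hypothesis E_indep : forall n, mutually_independent (@edges n) (E n).
Hypothesis E_exp : forall n (e : {set 'I_n.+2}), e \in @edges n ->
  exponentially_distributed 1 (E n e).
Let thr n (y : R) := xthr s y (ln n.+2%:R).
Let m := (kfloor s).-2.
Let mE : kfloor s = m.+2.
Proof. by rewrite /m; have [] := special_kfloor hs; case: (kfloor s) => [|[]]. Qed.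
Let mE' : kceil s = m.+3.
Proof. by have [_ ->] := special_kfloor hs; rewrite mE. Qed.

Let A n y := reach s (E n) (paths n m.+1) (thr n y).
Let B n y := reach s (E n) (paths n m.+2) (thr n y).
Let C n y := reach s (E n) (other_paths s n) (thr n y).
Arguments A : clear implicits.
Arguments B : clear implicits.
Arguments C : clear implicits.

Let mA n y : measurable (A n y). Proof. exact: measurable_reach. Qed.
Let mB n y : measurable (B n y). Proof. exact: measurable_reach. Qed.
Let mC n y : measurable (C n y). Proof. exact: measurable_reach. Qed.

Let AB_cvg y z : pr (P n) (~` A n y `&` ~` B n z) @[n --> \oo] -->
  gumbel_tail (a_ s m.+2) m.+1%:R y * gumbel_tail (a_ s m.+3) m.+2%:R z.
Proof.
have h := @cvg_noev_paths _ _ hs _ _ _ _ E_indep E_exp y z.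
apply: cvg_trans h; apply: near_eq_cvg; near=> n.
rewrite -/m; congr (pr (P n) _); rewrite noevE -setCU; congr (~` _).
apply/seteqP; split=> w.
  move=> [v /=]; rewrite mem_cat => /orP[] vl; have := vl; rewrite mem_paths => /andP[/eqP ->] _.
    by rewrite eqxx => h; left; exists v.
  by rewrite gtn_eqF// => h; right; exists v.
move=> [[v vl vx]|[v vl vx]]; exists v => //=; rewrite ?mem_cat ?vl ?orbT//.
  by move: vl; rewrite /= mem_paths => /andP[->].
by move: vl; rewrite /= mem_paths => /andP[/eqP -> _]; rewrite gtn_eqF.
Unshelve. all: by end_near. Qed.

Let C_cvg y : pr (P n) (C n y) @[n --> \oo] --> (0 : R).
Proof.
apply/cvgrPdist_le => e e0; near=> n.
rewrite sub0r normrN ger0_norm ?pr_ge0//.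
apply: le_trans (pr_reach_other_paths hs (@E_indep n) (@E_exp n) _) _.
have : forall m, \sum_(0 <= i < m | (i.+1 != kfloor s) && (i.+1 != kceil s))
    expR (i%:R * ln n.+2%:R) * wcdf s i.+1 (thr n y) <= e.
  by near: n; exact: (cvg_ln_succ2 (other_lengths_small hs y e0)).
by apply.
Unshelve. all: by end_near. Qed.

Context (d' : measure_display) (T' : measurableType d') (Q : probability T' R)
  (Xi : nat -> {RV Q >-> R}).
Hypothesis Xi_indep : mutually_independent [pred k | (2 <= k)%N] Xi.
Hypothesis Xi_law : forall (k : nat) (t : R), (2 <= k)%N ->
  Q [set w | t < Xi k w] = (expR (- (a_ s k * expR t)))%:E.

Let X w := Xi m.+2 w / (m.+2%:R - 1).
Let Y w := Xi m.+3 w / (m.+3%:R - 1).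

Let XY y z : pr Q [set w | y < X w /\ z < Y w] =
  gumbel_tail (a_ s m.+2) m.+1%:R y * gumbel_tail (a_ s m.+3) m.+2%:R z.
Proof.
have sub : {subset [fset m.+2; m.+3]%fset <= [pred k | (2 <= k)%N]}.
  by move=> k; rewrite !inE => /orP[] /eqP ->.
pose t k := if k == m.+2 then m.+1%:R * y else m.+2%:R * z.
have := Xi_indep (B := fun k => `]t k, +oo[%classic) sub (fun k => measurable_itv _).
have m32 : m.+2 \notin [fset m.+3]%fset by rewrite inE neq_ltn ltnSn.
rewrite bigcap_fsetU1 big_fsetU1//= big_seq_fset1 set_fset1 bigcap_set1.
have preim k u : Xi k @^-1` `]u, +oo[ = [set w | u < Xi k w].
  by apply/seteqP; split=> w /=; rewrite in_itv/= andbT.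
rewrite !preim !Xi_law// {1 3}/t eqxx /t gtn_eqF// => QE.
rewrite /pr (_ : [set w | _] = [set w | m.+1%:R * y < Xi m.+2 w] `&` [set w | m.+2%:R * z < Xi m.+3 w]).
  by rewrite QE.
have pred_natr k : k.+1%:R - 1 = k%:R :> R by rewrite -natr1 addrK.
rewrite /X /Y !pred_natr; apply/seteqP; split=> w /=;
by rewrite !ltr_pdivlMr ?ltr0n// (mulrC y) (mulrC z).
Qed.

Let mX : measurable_fun [set: T'] X.
Proof. by apply: measurable_funM => //; exact: measurable_cst. Qed.
Let mY : measurable_fun [set: T'] Y.
Proof. by apply: measurable_funM => //; exact: measurable_cst. Qed.

Lemma weight_limit : cvg_in_distribution
  (fun n => normalized_weight s (E n) : {RV (P n) >-> R})
  (limit_weight s Xi : {RV Q >-> R}).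
Proof.
move=> y _.
have itv_le d1 (T1 : measurableType d1) (Z : T1 -> R) : Z @^-1` `]-oo, y] = [set w | Z w <= y].
  by apply/seteqP; split=> w /=; rewrite in_itv.
rewrite /cdf /distribution /pushforward itv_le.
have -> : [set w | limit_weight s Xi w <= y] = ~` [set w | y < X w /\ y < Y w].
  apply/seteqP; split=> w /=; rewrite /limit_weight mE mE' -/(X w) -/(Y w) ge_min.
    by move=> h [h1 h2]; move: h; rewrite !leNgt h1 h2.
  by move=> h; rewrite !leNgt -negb_and; apply/negP => /andP.
have mXY : measurable [set w | y < X w /\ y < Y w].
  have mlt (f : T' -> R) : measurable_fun [set: T'] f -> measurable [set w | y < f w].
    move=> mf; rewrite (_ : [set w | _] = f @^-1` `]y, +oo[).
      by rewrite -[X in measurable X]setTI; apply: mf => //; exact: measurable_itv.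
    by apply/seteqP; split=> w /=; rewrite in_itv/= andbT.
  by apply: measurableI; exact: mlt.
rewrite prE ?prC ?XY//; last exact: measurableC.
have AC n : measurable (A n y `|` B n y) by exact: measurableU.
have cvgAB : pr (P n) (A n y `|` B n y) @[n --> \oo] -->
    1 - gumbel_tail (a_ s m.+2) m.+1%:R y * gumbel_tail (a_ s m.+3) m.+2%:R y.
  have h : 1 - pr (P n) (~` A n y `&` ~` B n y) @[n --> \oo] -->
      1 - gumbel_tail (a_ s m.+2) m.+1%:R y * gumbel_tail (a_ s m.+3) m.+2%:R y.
    by apply: cvgB; [exact: cvg_cst|exact: AB_cvg].
  apply: cvg_trans h; apply: near_eq_cvg; near=> n.
  by rewrite -setCU prC// opprB addrC subrK.
have mO n : measurable (A n y `|` B n y `|` C n y) by exact: measurableU.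
have cvgO : pr (P n) (A n y `|` B n y `|` C n y) @[n --> \oo] -->
    1 - gumbel_tail (a_ s m.+2) m.+1%:R y * gumbel_tail (a_ s m.+3) m.+2%:R y.
  (* Paths of other lengths change the event by at most C, whose probability tends to 0. *)
  apply: (@squeeze_cvgr _ _ _ _ (fun n => pr (P n) (A n y `|` B n y))
    (fun n => pr (P n) (A n y `|` B n y) + pr (P n) (C n y))).
  - near=> n; rewrite prU// le_pr//; exact: measurableU.
  - exact: cvgAB.
  - rewrite -[X in _ --> X]addr0; exact: (cvgD cvgAB (C_cvg y)).
apply: cvg_EFin.
  apply: nearW => n; rewrite itv_le normalized_weight_le// opt_weight_le// mE mE'.
  exact: fin_num_measure (mO n).
apply: cvg_trans cvgO; apply: near_eq_cvg; near=> n.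
by rewrite /= itv_le normalized_weight_le// opt_weight_le// mE mE'.
Unshelve. all: by end_near. Qed.

Let D n k : set (T n) := [set w | hopcount s (E n) w = k%:R].
Arguments D : clear implicits.

Let mD n k : measurable (D n k).
Proof.
have := @measurable_funPT _ _ _ _ (hopcount s (E n) : {RV (P n) >-> R}) measurableT _
  (measurable_set1 (k%:R : R)).
by rewrite setTI.
Qed.

Let D_disj n : D n m.+2 `&` D n m.+3 = set0.
Proof.
apply/seteqP; split=> w // [h2 h3].
have /eqP : (m.+2%:R : R) = m.+3%:R by exact: etrans (esym h2) h3.
by rewrite eqr_nat eqn_leq ltnn andbF.
Qed.

Let mono n y z : y <= z -> [/\ A n y `<=` A n z, B n y `<=` B n z & C n y `<=` C n z].
Proof.
have L0 : 0 < ln n.+2%:R :> R by rewrite ln_gt0// ltr1n.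
by move=> yz; have h := xthr_le hs L0 yz; split; exact: le_reach.
Qed.

Let tie_le : set T' := [set w | X w <= Y w].

Let hopcount_prob : pr (P n) (D n m.+2) @[n --> \oo] --> pr Q tie_le /\
  pr (P n) (D n m.+3) @[n --> \oo] --> 1 - pr Q tie_le.
Proof.
apply: (@race_cvg _ _ _ _ _ _ _ P A B C (fun n => D n m.+2) (fun n => D n m.+3)
  _ _ Q X Y _ _ _ _ mA mB mC (fun n => mD n _) (fun n => mD n _) mono _ _ _ AB_cvg C_cvg mX mY XY).
- exact: a_gt0.
- exact: a_gt0.
- by rewrite ltr0n.
- by rewrite ltr0n.
- move=> n y; apply: (@hopcount_reach _ _ hs _ _ _ _ _ m.+2 m.+3).
  by rewrite mE mE' !eqxx.
- move=> n y; apply: (@hopcount_reach _ _ hs _ _ _ _ _ m.+3 m.+2).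
  by rewrite mE mE' !eqxx orbT.
- exact: D_disj.
Qed.

Lemma hopcount_limit : cvg_in_distribution
  (fun n => hopcount s (E n) : {RV (P n) >-> R})
  (limit_hopcount s Xi : {RV Q >-> R}).
Proof.
move=> x _; have [D_cvg D'_cvg] := hopcount_prob.
have itv_le d1 (T1 : measurableType d1) (Z : T1 -> R) : Z @^-1` `]-oo, x] = [set w | Z w <= x].
  by apply/seteqP; split=> w /=; rewrite in_itv.
have mtie : measurable tie_le.
  by rewrite -[X in measurable X]setTI; apply: measurable_fun_le.
have mH n : measurable [set w | hopcount s (E n) w <= x].
  by rewrite -[X in measurable X]setTI; apply: measurable_fun_le.
rewrite /cdf /distribution /pushforward itv_le.
have limE w : limit_hopcount s Xi w = if w \in tie_le then m.+2%:R else m.+3%:R.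
  rewrite /limit_hopcount mE mE' -/(X w) -/(Y w); case: ifPn => h.
    by rewrite mem_set.
  by rewrite memNset//= /tie_le/=; exact/negP.
have lt23 : m.+2%:R < m.+3%:R :> R by rewrite ltr_nat.
suff [l lE l_cvg] : exists2 l, Q [set w | limit_hopcount s Xi w <= x] = l%:E &
    pr (P n) [set w | hopcount s (E n) w <= x] @[n --> \oo] --> l.
  rewrite lE; apply: cvg_EFin; first by apply: nearW => n; rewrite itv_le fin_num_measure.
  by apply: cvg_trans l_cvg; apply: near_eq_cvg; near=> n; rewrite /= itv_le.
have DD' n : pr (P n) (D n m.+2 `|` D n m.+3) = pr (P n) (D n m.+2) + pr (P n) (D n m.+3).
  by apply: prU_disj => //; exact: D_disj.
(* The limit has two values, so x lies in one of three ranges. Before the limit other values may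
   occur; the squeezes therefore use only the probabilities of the two values, whose limits add up
   to 1. *)
have [x3|x3] := lerP m.+3%:R x.
  exists 1.
    rewrite (_ : [set w | _] = setT) ?probability_setT//.
    apply/seteqP; split=> w //= _; rewrite limE; case: ifP => _ //.
    by apply: le_trans x3; exact: ltW.
  apply: (@squeeze_cvgr _ _ _ _ (fun n => pr (P n) (D n m.+2) + pr (P n) (D n m.+3)) (cst 1)).
  - near=> n; rewrite pr_le1// andbT -DD' le_pr//; first exact: measurableU.
    by move=> w [] /= ->//; apply: le_trans x3; exact: ltW.
  - by rewrite -[X in _ --> X](subrKC (pr Q tie_le)); exact: cvgD.
  - exact: cvg_cst.
have [x2|x2] := lerP m.+2%:R x.
  exists (pr Q tie_le).
    rewrite -prE//; congr (Q _); apply/seteqP; split=> w /=; rewrite limE.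
      by case: ifPn => [/set_mem//|_]; rewrite leNgt x3.
    by move=> h; rewrite mem_set.
  apply: (@squeeze_cvgr _ _ _ _ (fun n => pr (P n) (D n m.+2)) (fun n => 1 - pr (P n) (D n m.+3))).
  - near=> n; rewrite le_pr//=; last by move=> w /= ->.
    rewrite -prC// le_pr//; first exact: measurableC.
    by move=> w /= Hx Hm; move: Hx; rewrite Hm leNgt x3.
  - exact: D_cvg.
  - rewrite -[X in _ --> X](_ : 1 - (1 - pr Q tie_le) = _); last by ring.
    by apply: cvgB; [exact: cvg_cst|exact: D'_cvg].
exists 0.
  rewrite (_ : [set w | _] = set0) ?measure0//.
  apply/seteqP; split=> w //=; rewrite limE leNgt => /negP; apply.
  by case: ifP => _ //; exact: lt_trans lt23.
apply: (@squeeze_cvgr _ _ _ _ (cst 0) (fun n => 1 - (pr (P n) (D n m.+2) + pr (P n) (D n m.+3)))).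
- near=> n; rewrite pr_ge0/= -DD' -prC; last exact: measurableU.
  rewrite le_pr//; first by apply: measurableC; exact: measurableU.
  by move=> w /= Hx [] Hm; move: Hx; rewrite Hm leNgt ?x3 ?x2.
- exact: cvg_cst.
- rewrite -[X in _ --> X](_ : 1 - (pr Q tie_le + (1 - pr Q tie_le)) = 0); last by ring.
  by apply: cvgB; [exact: cvg_cst|exact: cvgD].
Unshelve. all: by end_near. Qed.

End main.

Theorem theorem2p2 (R : realType) (s : R) (hs : special_s s)
    (d : nat -> measure_display) (T : forall n, measurableType (d n))
    (P : forall n, probability (T n) R)
    (E : forall n, {set 'I_n.+2} -> {RV (P n) >-> R})
    (E_indep : forall n, mutually_independent (@edges n) (E n))
    (E_exp : forall n (e : {set 'I_n.+2}), e \in @edges n ->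
      exponentially_distributed 1 (E n e))
    (d' : measure_display) (T' : measurableType d') (Q : probability T' R)
    (Xi : nat -> {RV Q >-> R})
    (Xi_indep : mutually_independent [pred k | (2 <= k)%N] Xi)
    (Xi_law : forall (k : nat) (t : R), (2 <= k)%N ->
      Q [set w | t < Xi k w] = (expR (- (a_ s k * expR t)))%:E) :
  cvg_in_distribution (fun n => normalized_weight s (E n) : {RV (P n) >-> R})
    (limit_weight s Xi : {RV Q >-> R}) /\
  cvg_in_distribution (fun n => hopcount s (E n) : {RV (P n) >-> R})
    (limit_hopcount s Xi : {RV Q >-> R}).
Proof.
split; first exact: (weight_limit hs E_indep E_exp Xi_indep Xi_law).
exact: (hopcount_limit hs E_indep E_exp Xi_indep Xi_law).
Qed.
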